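(* Let $X=\mathrm{D}^+(c_0,R_0)-\bigcup_{i=1}^n\mathrm{D}^-(c_i,R_i)$ be a $K$-affinoid, let $0<r\le r_X$, and let $S\subseteq\mathrm{D}^-(1,r/\max(|c_0|,R_0))$ with $S^\circ\ne\emptyset$. For all $q\in S^\circ$, in the commutative square $$\begin{array}{ccc}\sigma\text{-}\mathrm{Mod}(\mathcal{H}_K(X))^{[r]}_S&\xleftarrow{\ \mathrm{Forget}\ \delta\ }&(\sigma,\delta)\text{-}\mathrm{Mod}(\mathcal{H}_K(X))^{[r]}_S\\ {\scriptstyle\mathrm{Res}^S_{\{q\}}}\downarrow&&\downarrow{\scriptstyle\mathrm{Res}^S_{\{q\}}}\\ \sigma_q\text{-}\mathrm{Mod}(\mathcal{H}_K(X))^{[r]}&\xleftarrow{\ \mathrm{Forget}\ \delta_q\ }&(\sigma_q,\delta_q)\text{-}\mathrm{Mod}(\mathcal{H}_K(X))^{[r]}\end{array}$$ all functors are equivalences. Taking the union over all $r$, with $\tau_q:=|q-1|\max(|c_0|,R_0)$ and $\mathrm{D}_r:=\mathrm{D}^-(1,r/\max(|c_0|,R_0))$, all functors in the analogous commutative square with upper row $\bigcup_{r>\tau_q}\sigma\text{-}\mathrm{Mod}(\mathcal{H}_K(X))^{\mathrm{adm}}_{\mathrm{D}_r}\leftarrow\bigcup_{r>\tau_q}(\sigma,\delta)\text{-}\mathrm{Mod}(\mathcal{H}_K(X))^{\mathrm{adm}}_{\mathrm{D}_r}$, lower row $\sigma_q\text{-}\mathrm{Mod}(\mathcal{H}_K(X))^{\mathrm{adm}}\leftarrow(\sigma_q,\delta_q)\text{-}\mathrm{Mod}(\mathcal{H}_K(X))^{\mathrm{adm}}$,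 and vertical arrows $\bigcup_{r>\tau_q}\mathrm{Res}^{\mathrm{D}_r}_{\{q\}}$, are equivalences. In particular, if $q,q'\in\mathrm{D}^-(1,1)$ are not $p$-power roots of unity and satisfy $\max(|q-1|,|q'-1|)\max(|c_0|,R_0)<r$, then with $\mathrm{D}:=\mathrm{D}^-(1,r/\max(|c_0|,R_0))$ one has an equivalence $$\mathrm{Res}^{\mathrm{D}}_{q'}\circ(\mathrm{Res}^{\mathrm{D}}_q)^{-1}:\ \sigma_q\text{-}\mathrm{Mod}(\mathcal{H}_K(X))^{[r]}\xrightarrow{\ \sim\ }\sigma_{q'}\text{-}\mathrm{Mod}(\mathcal{H}_K(X))^{[r]}.$$ The same statement holds for $(\sigma,\delta)$-modules without assuming that $q,q'$ are not $p$-power roots of unity.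
   Context: $K$ is a complete ultrametric valued field of mixed characteristic $(0,p)$. A $K$-affinoid is $X=\mathrm{D}^+(c_0,R_0)-\bigcup_{i=1}^n\mathrm{D}^-(c_i,R_i)$ (closed disc minus open discs) with $R_i>0$, $c_i\in K$, $c_1,\dots,c_n\in\mathrm{D}^+(c_0,R_0)$; $\mathcal{H}_K(X)$ is the completion for the sup-norm on $X$ of the ring of rational functions in $K(T)$ without poles in $X(K^{\mathrm{alg}})$; $r_X:=\min(R_0,\dots,R_n)$; $\sigma_q:f(T)\mapsto f(qT)$; $\delta_1:=T\frac{d}{dT}$; $\mathcal{Q}(X)$ is the group of $q\in K$ such that $\sigma_q$ is an automorphism of $\mathcal{H}_K(X)$; $\mathcal{Q}_1(X)=\mathcal{Q}(X)\cap\mathrm{D}^-(1,1)$; $\mathcal{U}_R:=\{(x,y)\in X\times X:|x-y|<R\}$. For $S\subseteq\mathcal{Q}(X)$, $\langle S\rangle$ is the generated subgroup and $S^\circ$ is the set of elements of $S$ that are not roots of unity. Discrete modules. A discrete $\sigma$-module over $S$ is a finite free $\mathcal{H}_K(X)$-module $\mathrm{M}$ with a group morphism $\sigma^{\mathrm{M}}:\langle S\rangle\to\mathrm{Aut}_K^{\mathrm{cont}}(\mathrm{M})$, $q\mapsto\sigma_q^{\mathrm{M}}$, with $\sigma_q^{\mathrm{M}}(fm)=\sigma_q(f)\sigma_q^{\mathrm{M}}(m)$. Morphisms are $\mathcal{H}_K(X)$-linear maps commuting with $\sigma_q$ for all $q\in S$. A discrete $(\sigma,\delta)$-module over $S$ has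 in addition a connection $\delta_1^{\mathrm{M}}$, $\delta_1^{\mathrm{M}}(fm)=\delta_1(f)m+f\delta_1^{\mathrm{M}}(m)$, and morphisms must also commute with $\delta_1$. In a basis $(e_i)$ write $\sigma_q^{\mathrm{M}}(e_i)=\sum_ja_{ij}(q,T)e_j$, $A(q,T)=(a_{ij})$, and $\delta_1^{\mathrm{M}}(e_i)=\sum_jg_{ij}e_j$, $G(1,T)=(g_{ij})$; the associated equations are $\sigma_q(Y)=A(q,T)Y$ and $\delta_1(Y)=G(1,T)Y$. $\mathrm{Res}^S_{\{q\}}$ keeps only the operators indexed by $\langle q\rangle$ (and $\delta_1^{\mathrm{M}}$ in the $(\sigma,\delta)$ case); the functors Forget $\delta$, Forget $\delta_q$ forget the connection. Taylor solutions. For $q$ not a root of unity: $d_q=\frac{\sigma_q-1}{(q-1)T}$, $H_0=\mathrm{Id}$, $H_1=\frac{A(q,T)-\mathrm{Id}}{(q-1)T}$, $H_{n+1}=d_q(H_n)+\sigma_q(H_n)H_1$, and $Y_{A(q,T)}(x,y)=\sum_{n\ge0}H_n(y)\frac{(x-y)_{q,n}}{[n]^!_q}$ with $(x-y)_{q,n}=\prod_{i=0}^{n-1}(x-q^iy)$, $[n]^!_q=\prod_{i=1}^n\frac{q^i-1}{q-1}$. For differential equations: $Y_{G(1,T)}(x,y)=\sum_{n\ge0}G_{[n]}(y)\frac{(x-y)^n}{n!}$, $G_{[0]}=\mathrm{Id}$, $G_{[1]}=G(1,T)/T$, $G_{[n+1]}=G_{[n]}'+G_{[n]}G_{[1]}$.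 Taylor admissibility. Let $S\subseteq\mathcal{Q}_1(X)$ with $S^\circ\ne\emptyset$, and $r>0$. $\sigma\text{-}\mathrm{Mod}(\mathcal{H}_K(X))^{[r]}_S$ is the full subcategory of discrete $\sigma$-modules over $S$ such that: (1) $S\subseteq\mathrm{D}^-(1,r/\max(|c_0|,R_0))$; (2) there is a matrix $Y(x,y)$, convergent (analytic) on $\mathcal{U}_R$ for some $R$ with $r\le R\le r_X$; (3) $Y(x,y)$ is a simultaneous Taylor solution of all the equations, that is $Y=Y_{A(q,T)}$ for all $q\in S^\circ$ and $Y(qx,y)=A(q,x)Y(x,y)$ for all $q\in S$. For $(\sigma,\delta)$-modules one drops the assumption $S^\circ\neq\emptyset$ and requires (1), that $Y:=Y_{G(1,T)}(x,y)$ converges on $\mathcal{U}_R$ for some $r\le R\le r_X$, and that $Y(qx,y)=A(q,x)Y(x,y)$ for all $q\in S$; this gives $(\sigma,\delta)\text{-}\mathrm{Mod}(\mathcal{H}_K(X))^{[r]}_S$. Set $\sigma\text{-}\mathrm{Mod}(\mathcal{H}_K(X))^{\mathrm{adm}}_S:=\bigcup_r\sigma\text{-}\mathrm{Mod}(\mathcal{H}_K(X))^{[r]}_S$, the union over $r\le r_X$ with $S\subseteq\mathrm{D}^-(1,r/\max(|c_0|,R_0))$, and similarly for $(\sigma,\delta)$. When $S=\{q\}$ one writes $\sigma_q\text{-}\mathrm{Mod}$, $(\sigma_q,\delta_q)\text{-}\mathrm{Mod}$. Unions of categories over $r$ (with $\tau_q<r\le r_X$) are direct limits along restriction functors. *)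

(* Defs.v *)
From HB Require Import structures.
From mathcomp Require Import all_boot all_order all_algebra.
From mathcomp Require Import all_classical all_reals all_analysis.

Set Implicit Arguments.
Unset Strict Implicit.
Unset Printing Implicit Defensive.

Import Order.TTheory GRing.Theory Num.Theory.
Import numFieldNormedType.Exports.

Local Open Scope classical_set_scope.
Local Open Scope ring_scope.

Record category := Category {
  obj :> Type;
  mor : obj -> obj -> Type;
  idmor : forall A, mor A A;
  comp_mor : forall A B D, mor B D -> mor A B -> mor A D;
  comp_idl : forall A B (f : mor A B), comp_mor (idmor B) f = f;
  comp_idr : forall A B (f : mor A B), comp_mor f (idmor A) = f;
  comp_morA : forall A B D E (f : mor D E) (g : mor B D) (h : mor A B),
    comp_mor f (comp_mor g h) = comp_mor (comp_mor f g) h }.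

Record functor (A B : category) := Functor {
  fobj :> A -> B;
  fmor : forall a b, mor a b -> mor (fobj a) (fobj b);
  fmor_id : forall a, fmor (idmor a) = idmor (fobj a);
  fmor_comp : forall a b d (f : mor b d) (g : mor a b),
    fmor (comp_mor f g) = comp_mor (fmor f) (fmor g) }.

Section Functors.

Definition fid (A : category) : functor A A.
Proof. by exists id (fun _ _ f => f). Defined.

Definition fcomp (A B D : category) (G : functor B D) (F : functor A B) :
  functor A D.
Proof.
exists (fun a => G (F a)) (fun a b f => fmor G (fmor F f)).
- by move=> a; rewrite !fmor_id.
- by move=> a b d f g; rewrite !fmor_comp.
Defined.

Definition nat_iso (A B : category) (F G : functor A B) : Prop :=
  exists (eta : forall a, mor (F a) (G a)) (eps : forall a, mor (G a) (F a)),
  [/\ forall a b (f : mor a b),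
        comp_mor (eta b) (fmor F f) = comp_mor (fmor G f) (eta a),
      forall a, comp_mor (eps a) (eta a) = idmor (F a)
    & forall a, comp_mor (eta a) (eps a) = idmor (G a)].

Definition quasi_inverse (A B : category) (F : functor A B) (G : functor B A) :
  Prop :=
  nat_iso (fcomp G F) (fid A) /\ nat_iso (fcomp F G) (fid B).

Definition is_equivalence (A B : category) (F : functor A B) : Prop :=
  exists G, quasi_inverse F G.

Definition fullsub (A : category) (P : A -> Prop) : category.
Proof.
exists {a : A | P a} (fun a b => mor (sval a) (sval b)) (fun a => idmor (sval a))
  (fun _ _ _ f g => comp_mor f g).
- by move=> a b f; rewrite comp_idl.
- by move=> a b f; rewrite comp_idr.
- by move=> a b d e f g h; rewrite comp_morA.
Defined.

Definition frestrict (A B : category) (F : functor A B)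
  (P : A -> Prop) (Q : B -> Prop) (PQ : forall a, P a -> Q (F a)) :
  functor (fullsub P) (fullsub Q).
Proof.
exists (fun a : fullsub P => exist Q (F (sval a)) (PQ _ (proj2_sig a)) : fullsub Q)
  (fun a b f => fmor F f).
- by move=> a; exact: fmor_id.
- by move=> a b d f g; exact: fmor_comp.
Defined.

(** The four functors map the full subcategories [PA], [PB], [PD], [PE] to one
    another, the square
      B <-- top -- A
      |left        |right
      E <-- bot -- D
    of these subcategories commutes, and its four functors are equivalences. *)
Definition equivalence_square (A B D E : category)
    (top : functor A B) (left : functor B E)
    (right : functor A D) (bot : functor D E)
    (PA : A -> Prop) (PB : B -> Prop) (PD : D -> Prop) (PE : E -> Prop) :
    Prop :=
  exists (t : forall a, PA a -> PB (top a)) (l : forall b, PB b -> PE (left b))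
    (r : forall a, PA a -> PD (right a)) (b : forall d, PD d -> PE (bot d)),
  fcomp (frestrict l) (frestrict t) = fcomp (frestrict b) (frestrict r) /\
  [/\ is_equivalence (frestrict t), is_equivalence (frestrict l),
      is_equivalence (frestrict r) & is_equivalence (frestrict b)].

(** [F' o F^-1] is an equivalence from [PB] to [PB'], for every choice of the
    quasi-inverse [F^-1] of [F], and there is one. *)
Definition transport_equivalence (A B B' : category)
    (F : functor A B) (F' : functor A B')
    (PA : A -> Prop) (PB : B -> Prop) (PB' : B' -> Prop) : Prop :=
  exists (f : forall a, PA a -> PB (F a)) (f' : forall a, PA a -> PB' (F' a)),
  is_equivalence (frestrict f) /\
  forall G, quasi_inverse (frestrict f) G ->
    is_equivalence (fcomp (frestrict f') G).

End Functors.

Record ultrabs (R : realType) (F : fieldType) := Ultrabs {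
  uabs :> F -> R;
  uabs_ge0 : forall x, 0 <= uabs x;
  uabs_eq0 : forall x, uabs x = 0 -> x = 0;
  uabs0 : uabs 0 = 0;
  uabsM : forall x y, uabs (x * y) = uabs x * uabs y;
  uabs_ultra : forall x y, uabs (x + y) <= Num.max (uabs x) (uabs y) }.

Definition complete_abs (R : realType) (F : fieldType) (v : ultrabs R F) : Prop :=
  forall u : nat -> F,
  (forall e : R, 0 < e -> exists N : nat, forall m n : nat,
     (N <= m)%N -> (N <= n)%N -> v (u m - u n) < e) ->
  exists l, v (u n - l) @[n --> \oo] --> (0 : R).

Definition mixed_char (R : realType) (F : fieldType) (v : ultrabs R F) (p : nat) :
    Prop :=
  [/\ prime p, [pchar F] =i pred0 & v p%:R < 1].

Record alg_closure (R : realType) (K : fieldType) (v : ultrabs R K) := AlgClosure {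
  ac_field :> closedFieldType;
  ac_inj : {rmorphism K -> ac_field};
  ac_abs : ultrabs R ac_field;
  ac_algebraic : forall x, algebraicOver ac_inj x;
  ac_extends : forall x, ac_abs (ac_inj x) = v x }.

(** Index [0] is the closed disc [D+(c_0, R_0)]; the others are the holes. *)
Record affinoid (R : realType) (K : fieldType) (v : ultrabs R K) := Affinoid {
  holes : nat;
  center : 'I_holes.+1 -> K;
  rad : 'I_holes.+1 -> R;
  rad_gt0 : forall i, 0 < rad i;
  center_in : forall i, v (center i - center ord0) <= rad ord0 }.
Arguments center {R K v} a i.
Arguments rad {R K v} a i.
Arguments rad_gt0 {R K v} a i.

Section UltrabsTheory.
Variables (R : realType) (F : fieldType) (v : ultrabs R F).

Lemma uabs1 : v 1 = 1.
Proof.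
have v0 : v 1 != 0.
  by apply/eqP => /uabs_eq0 /eqP; rewrite oner_eq0.
by apply: (mulfI v0); rewrite -uabsM !mulr1.
Qed.

Lemma uabsN x : v (- x) = v x.
Proof.
suff h : v (-1) = 1 by rewrite -mulN1r uabsM h mul1r.
have : v (-1) ^+ 2 == 1 by rewrite expr2 -uabsM mulrNN mulr1 uabs1.
rewrite sqrf_eq1 => /orP[/eqP//|/eqP h].
by have := uabs_ge0 v (-1); rewrite h lerNr oppr0 ler10.
Qed.

Lemma uabsV x : v x^-1 = (v x)^-1.
Proof.
have [->|x0] := eqVneq x 0; first by rewrite invr0 uabs0 invr0.
have vx0 : v x != 0 by apply: contra_neq x0; exact: uabs_eq0.
by apply: (mulfI vx0); rewrite -uabsM !divff // uabs1.
Qed.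

Lemma uabsB x y : v (x - y) <= Num.max (v x) (v y).
Proof. by rewrite -(uabsN y) uabs_ultra. Qed.

End UltrabsTheory.

Section AnalyticElements.
Variables (R : realType) (K : fieldType) (v : ultrabs R K).
Variables (C : alg_closure v) (X : affinoid v).

Local Notation w := (ac_abs C).
Local Notation iota := (ac_inj C).
Local Notation "P ^L" := (map_poly iota P) (at level 2, format "P ^L").

Definition affinoid_mem : pred C := fun x =>
  (w (x - iota (center X ord0)) <= rad X ord0) &&
  [forall i : 'I_(holes X).+1,
     (i != ord0) ==> (rad X i <= w (x - iota (center X i)))].

(** X(K^alg) *)
Definition points := {x : C | affinoid_mem x}.

Definition analytic_element (f : points -> C) : Prop :=
  forall e : R, 0 < e -> exists P Q : {poly K},
    (forall x : points, Q^L.[val x] != 0) /\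
    (forall x : points, w (f x - P^L.[val x] / Q^L.[val x]) < e).

Lemma points_bounded (P : {poly K}) :
  exists2 B : R, 0 < B & forall x : points, w P^L.[val x] <= B.
Proof.
pose m := Num.max (rad X ord0) (w (iota (center X ord0))).
have xm (x : points) : w (val x) <= m.
  rewrite -(subrK (iota (center X ord0)) (val x)).
  apply: (le_trans (uabs_ultra _ _ _)); rewrite ge_max !le_max.
  by have /andP[-> _] := valP x; rewrite lexx orbT.
have m0 : 0 <= m by rewrite le_max ltW ?rad_gt0.
elim/poly_ind: P => [|P c [B B0 IH]].
  by exists 1 => // x; rewrite rmorph0 horner0 uabs0.
exists (Num.max (B * m) (v c) + 1).
  by rewrite ltr_wpDl // le_max uabs_ge0 orbT.
move=> x; rewrite rmorphD rmorphM /= map_polyX map_polyC /= !hornerE.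
apply: (le_trans (uabs_ultra _ _ _)); rewrite ler_wpDr // ge_max !le_max.
rewrite ac_extends lexx orbT andbT uabsM.
apply/orP; left; exact: ler_pM (uabs_ge0 _ _) (uabs_ge0 _ _) (IH x) (xm x).
Qed.

Lemma points_bounded_below (Q : {poly K}) :
  (forall x : points, Q^L.[val x] != 0) ->
  exists2 b : R, 0 < b & forall x : points, b <= w Q^L.[val x].
Proof.
have [s def_Q] := closed_field_poly_normal (Q^L).
have [Q0|Q0] := eqVneq (lead_coef Q^L) 0.
  move=> Qx; exists 1 => // x; have := Qx x.
  by rewrite def_Q Q0 scale0r horner0 eqxx.
rewrite def_Q => Qx.
have {Qx} sX z : z \in s -> ~~ affinoid_mem z.
  move=> zs; apply/negP => zX; have /eqP[] := Qx (exist _ z zX).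
  rewrite hornerZ horner_prod; apply/eqP; rewrite mulf_eq0 prodf_seq_eq0.
  by apply/orP; right; apply/hasP; exists z => //=; rewrite !hornerE subrr.
suff [b b0 bP] : exists2 b : R, 0 < b &
    forall x : points, b <= w (\prod_(z <- s) ('X - z%:P)).[val x].
  exists (w (lead_coef Q^L) * b) => [|x].
    rewrite mulr_gt0 // lt_neqAle uabs_ge0 andbT eq_sym.
    by apply: contra_neq Q0; exact: uabs_eq0.
  by rewrite hornerZ uabsM ler_wpM2l ?uabs_ge0.
elim: s sX {def_Q} => [|z s IH] sX.
  by exists 1 => // x; rewrite big_nil hornerE uabs1.
have {IH} [|b b0 bP] := IH; first by move=> y ys; rewrite sX // inE ys orbT.
have [d d0 dP] : exists2 d : R, 0 < d & forall x : points, d <= w (val x - z).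
  have := sX z; rewrite inE eqxx => /(_ isT).
  rewrite negb_and -ltNge negb_forall => /orP[zc|/existsP[i]].
    exists (rad X ord0) => [|x]; first exact: rad_gt0.
    rewrite leNgt; apply/negP => xz; move: zc; apply/negP; rewrite -leNgt.
    have -> : z - iota (center X ord0) =
      - (val x - z) + (val x - iota (center X ord0)) by rewrite opprB addrA subrK.
    apply: (le_trans (uabs_ultra _ _ _)).
    by rewrite uabsN ge_max (ltW xz); have /andP[-> _] := valP x.
  rewrite negb_imply -ltNge => /andP[i0 zi].
  exists (rad X i) => [|x]; first exact: rad_gt0.
  rewrite leNgt; apply/negP => xz.
  have /andP[_ /forallP/(_ i)] := valP x; rewrite i0 /= leNgt => /negP; apply.
  rewrite -(subrK z (val x)) -addrA.
  by apply: (le_lt_trans (uabs_ultra _ _ _)); rewrite gt_max xz.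
exists (d * b) => [|x]; first exact: mulr_gt0.
by rewrite big_cons hornerM uabsM ler_pM ?(ltW d0) ?(ltW b0) // !hornerE.
Qed.

Lemma rational_bounded (P Q : {poly K}) :
  (forall x : points, Q^L.[val x] != 0) ->
  exists2 B : R, 0 < B & forall x : points, w (P^L.[val x] / Q^L.[val x]) <= B.
Proof.
move=> /points_bounded_below[b b0 bP]; have [B B0 BP] := points_bounded P.
exists (B / b) => [|x]; first exact: divr_gt0.
rewrite uabsM uabsV ler_pM ?invr_ge0 ?uabs_ge0 // lef_pV2 ?posrE //.
exact: lt_le_trans (bP x).
Qed.

Lemma analytic_poly (P : {poly K}) :
  analytic_element (fun x : points => P^L.[val x]).
Proof.
move=> e e0; exists P, 1; split=> x; rewrite rmorph1 hornerE ?oner_eq0 //.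
by rewrite divr1 subrr uabs0.
Qed.

Definition analytic_pred : {pred (points -> C)} :=
  [pred f | `[< analytic_element f >]].

Lemma analytic_subring : subring_closed analytic_pred.
Proof.
split=> [|f g /asboolP fP /asboolP gP|f g /asboolP fP /asboolP gP]; apply/asboolP.
- move=> e e0; have [P [Q [h1 h2]]] := analytic_poly 1 e0; exists P, Q; split=> // x.
  by have := h2 x; rewrite rmorph1 hornerE.
- move=> e e0; have [P [Q [Q0 fPQ]]] := fP e e0.
  have [P' [Q' [Q'0 gPQ]]] := gP e e0; exists (P * Q' - P' * Q), (Q * Q').
  split=> x; first by rewrite rmorphM hornerM mulf_neq0.
  have -> : (P * Q' - P' * Q)^L.[val x] / (Q * Q')^L.[val x] =
      P^L.[val x] / Q^L.[val x] - P'^L.[val x] / Q'^L.[val x].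
    rewrite -[in RHS]mulNr addf_div ?Q0 ?Q'0 // mulNr.
    by rewrite !(rmorphB, rmorphM) /= !(hornerD, hornerN, hornerM).
  have -> : (f - g) x - (P^L.[val x] / Q^L.[val x] - P'^L.[val x] / Q'^L.[val x])
      = (f x - P^L.[val x] / Q^L.[val x]) - (g x - P'^L.[val x] / Q'^L.[val x]).
    by rewrite [(f - g) x]/(f x - g x) !opprD !opprK addrACA.
  by apply: (le_lt_trans (uabsB _ _ _)); rewrite gt_max fPQ gPQ.
- move=> e e0; have [F F0 fF] : exists2 F : R, 0 < F & forall x, w (f x) <= F.
    have [P [Q [Q0 fPQ]]] := fP 1 ltr01; have [B B0 BP] := rational_bounded P Q0.
    exists (Num.max 1 B) => [|x]; first by rewrite lt_max ltr01.
    rewrite -(subrK (P^L.[val x] / Q^L.[val x]) (f x)).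
    apply: (le_trans (uabs_ultra _ _ _)); rewrite ge_max !le_max BP orbT andbT.
    by rewrite ltW.
  have [P' [Q' [Q'0 gPQ]]] := gP (e / F) (divr_gt0 e0 F0).
  have [B B0 BP] := rational_bounded P' Q'0.
  have [P [Q [Q0 fPQ]]] := fP (e / B) (divr_gt0 e0 B0).
  exists (P * P'), (Q * Q'); split=> x; first by rewrite rmorphM hornerM mulf_neq0.
  have -> : (P * P')^L.[val x] / (Q * Q')^L.[val x] =
      (P^L.[val x] / Q^L.[val x]) * (P'^L.[val x] / Q'^L.[val x]).
    by rewrite mulf_div !rmorphM /= !hornerM.
  rewrite [(f * g) x]/(f x * g x).
  set a := _ / Q^L.[_]; set b := _ / Q'^L.[_].
  have -> : f x * g x - a * b = f x * (g x - b) + (f x - a) * b.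
    by rewrite mulrBr mulrBl addrA subrK.
  apply: (le_lt_trans (uabs_ultra _ _ _)); rewrite gt_max (uabsM _ (f x)) (uabsM _ (f x - a)); apply/andP; split.
    apply: (@le_lt_trans _ _ (F * w (g x - b))).
      by rewrite ler_wpM2r ?uabs_ge0.
    by rewrite mulrC -ltr_pdivlMr.
  apply: (@le_lt_trans _ _ (w (f x - a) * B)).
    by apply: ler_wpM2l; [exact: uabs_ge0|exact: BP].
  by rewrite -ltr_pdivlMr.
Qed.

HB.instance Definition _ :=
  GRing.isSubringClosed.Build (points -> C) analytic_pred analytic_subring.

(** [H_K(X)].  The completion of the rational functions without poles in
    [X(K^alg)] for the sup-norm is realized, as in Krasner's definition, by their
    uniform limits, as functions on [X(K^alg)]; these limits take values in [K^alg]
    because every [K(x)] is complete. *)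
Record anel := Anel { anel_fun :> points -> C; _ : anel_fun \in analytic_pred }.

HB.instance Definition _ := [isSub for anel_fun].
HB.instance Definition _ := [Choice of anel by <:].
HB.instance Definition _ := GRing.SubChoice_isSubComPzRing.Build _ _ anel
  (@GRing.subringClosedP _ _).

Definition anel_poly (P : {poly K}) : anel :=
  @Anel (fun x => P^L.[val x]) (asboolT (analytic_poly P)).

Definition supnorm (f : anel) : R := sup [set w (f x) | x in [set: points]].

(** [f(T) |-> f(qT)]; the default value [0] is not used when multiplication by
    [q] preserves [X(K^alg)], see [sigmaE]. *)
Definition sigma (q : K) (f : anel) : anel :=
  xget 0 [set g : anel | forall x : points,
    exists2 y : points, val y = iota q * val x & g x = f y].

Lemma sigmaE q f :
  (forall x : points, affinoid_mem (iota q * val x)) ->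
  forall x y : points, val y = iota q * val x -> sigma q f x = f y.
Proof.
move=> stable x y yx; rewrite /sigma; case: xgetP => [g _ /(_ x)[y' y'x ->]|no].
  by congr (f _); apply: val_inj; rewrite yx y'x.
pose qx (z : points) : points := exist (fun t => affinoid_mem t) _ (stable z).
have gA : analytic_element (fun z => f (qx z)).
  have /asboolP fA := valP f.
  move=> e e0; have [P [Q [Q0 fPQ]]] := fA e e0.
  exists (P \Po (q *: 'X)), (Q \Po (q *: 'X)).
  have E P' z : (P' \Po (q *: 'X))^L.[z] = P'^L.[iota q * z].
    by rewrite map_comp_poly /= horner_comp map_polyZ map_polyX /= hornerZ hornerX.
  by split=> z; rewrite !E; [exact: (Q0 (qx z))|exact: (fPQ (qx z))].
by exfalso; apply: (no (Anel (asboolT gA : _ \in analytic_pred))) => z; exists (qx z).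
Qed.

(** [d_q = (sigma_q - 1) / ((q - 1) T)] *)
Definition dq (q : K) (f : anel) : anel :=
  xget 0 [set g : anel | anel_poly ((q - 1) *: 'X) * g = sigma q f - f].

(** [d/dT]; every element of [H_K(X)] has a derivative in [H_K(X)], by the Cauchy
    estimates on the discs [D^-(x, r_X)]. *)
Definition deriv_anel (f : anel) : anel :=
  xget 0 [set g : anel | forall (x : points) (e : R), 0 < e ->
    exists2 d : R, 0 < d & forall y : points, 0 < w (val y - val x) < d ->
      w ((f y - f x) / (val y - val x) - g x) < e].

Definition delta1 (f : anel) : anel := anel_poly 'X * deriv_anel f.

Definition eval_mx m n (A : 'M[anel]_(m, n)) (x : points) : 'M[C]_(m, n) :=
  \matrix_(i, j) A i j x.

Definition series_cvg n (u : nat -> 'M[C]_n) (l : 'M[C]_n) : Prop :=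
  forall i j, w (\sum_(k < N) u k i j - l i j) @[N --> \oo] --> (0 : R).

(** [Y] is analytic on [U_rho = {(x, y) in X x X : |x - y| < rho}].  For
    [rho' < rho <= r_X], [{|x - y| <= rho'}] is the product of [X] with a closed
    disc of radius [rho'] in the variable [x - y]. *)
Definition analytic_on_U n (rho : R) (Y : points -> points -> 'M[C]_n) : Prop :=
  exists a : nat -> 'M[anel]_n,
  (forall rho' : R, 0 < rho' < rho -> forall i j,
     supnorm (a k i j) * rho' ^+ k @[k --> \oo] --> (0 : R)) /\
  (forall x y : points, w (val x - val y) < rho ->
     series_cvg (fun k => (val x - val y) ^+ k *: eval_mx (a k) y) (Y x y)).

(** [q_taylor H1 k = H_k]; it starts with [H_0 = Id] and [H_1 = H1]. *)
Fixpoint q_taylor n (q : K) (H1 : 'M[anel]_n) (k : nat) : 'M[anel]_n :=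
  if k is k'.+1 then
    map_mx (dq q) (q_taylor q H1 k') + map_mx (sigma q) (q_taylor q H1 k') *m H1
  else 1%:M.

Definition q_poch (q x y : C) (k : nat) : C := \prod_(i < k) (x - q ^+ i * y).

Definition q_fact (q : C) (k : nat) : C :=
  \prod_(1 <= i < k.+1) ((q ^+ i - 1) / (q - 1)).

(** [Y = Y_{A(q,T)}] on [U_rho].  When [0] is in [X], the series makes sense at
    [y = 0] only if [H_1] has no pole there, that is, if [H_1] has entries in
    [H_K(X)]. *)
Definition is_q_taylor_solution n (rho : R) (q : K) (A : 'M[anel]_n)
    (Y : points -> points -> 'M[C]_n) : Prop :=
  exists H1 : 'M[anel]_n,
  anel_poly ((q - 1) *: 'X) *: H1 = A - 1%:M /\
  (forall x y : points, w (val x - val y) < rho ->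
    series_cvg (fun k =>
      (q_poch (iota q) (val x) (val y) k / q_fact (iota q) k) *:
        eval_mx (q_taylor q H1 k) y) (Y x y)).

(** [d_taylor G1 k = G_[k]]; it starts with [G_[0] = Id] and [G_[1] = G1]. *)
Fixpoint d_taylor n (G1 : 'M[anel]_n) (k : nat) : 'M[anel]_n :=
  if k is k'.+1 then
    map_mx deriv_anel (d_taylor G1 k') + d_taylor G1 k' *m G1
  else 1%:M.

(** [Y = Y_{G(1,T)}] on [U_rho]. *)
Definition is_d_taylor_solution n (rho : R) (G : 'M[anel]_n)
    (Y : points -> points -> 'M[C]_n) : Prop :=
  exists G1 : 'M[anel]_n,
  anel_poly 'X *: G1 = G /\
  (forall x y : points, w (val x - val y) < rho ->
    series_cvg (fun k =>
      ((val x - val y) ^+ k / k`!%:R) *: eval_mx (d_taylor G1 k) y) (Y x y)).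

(** [Y(qx, y) = A(q, x) Y(x, y)] on [U_rho]; here [x'] is [qx]. *)
Definition q_solution n (rho : R) (q : K) (A : 'M[anel]_n)
    (Y : points -> points -> 'M[C]_n) : Prop :=
  forall x y x' : points, val x' = iota q * val x ->
  w (val x - val y) < rho -> Y x' y = eval_mx A x *m Y x y.

End AnalyticElements.

Section Radii.
Variables (R : realType) (K : fieldType) (v : ultrabs R K) (X : affinoid v).

(** [r_X] *)
Definition min_rad : R := \big[Num.min/rad X ord0]_i rad X i.

Definition max_norm : R := Num.max (v (center X ord0)) (rad X ord0).

(** [D^-(1, r / max(|c_0|, R_0))].  For [r <= r_X] it is contained in [Q_1(X)],
    since [|qx - x| < r_X] for [q] in it and [x] in [X]. *)
Definition disc1 (r : R) : set K := [set q | v (q - 1) < r / max_norm].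

Definition tau (q : K) : R := v (q - 1) * max_norm.

Lemma max_norm_gt0 : 0 < max_norm.
Proof. by rewrite lt_max rad_gt0 orbT. Qed.

Lemma disc1E r q : disc1 r q <-> tau q < r.
Proof. by rewrite /disc1 /= ltr_pdivlMr ?max_norm_gt0. Qed.

Lemma disc1_sub r r' : r' <= r -> disc1 r' `<=` disc1 r.
Proof. by move=> le_r q /disc1E h; apply/disc1E; apply: lt_le_trans le_r. Qed.

End Radii.

Section Generated.
Variable K : fieldType.

Inductive gen (S : set K) : set K :=
| gen_in q : S q -> gen S q
| gen_1 : gen S 1
| gen_mul q q' : gen S q -> gen S q' -> gen S (q * q')
| gen_inv q : gen S q -> gen S q^-1.

Lemma gen_sub (S S' : set K) : S' `<=` S -> gen S' `<=` gen S.
Proof. by move=> sub q; elim; eauto using gen, sub. Qed.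

Lemma sub_set1 (S : set K) q : S q -> [set q] `<=` S.
Proof. by move=> Sq _ ->. Qed.

Definition unity_root (q : K) : Prop := exists2 n : nat, (0 < n)%N & q ^+ n = 1.

Definition non_roots (S : set K) : set K := [set q | S q /\ ~ unity_root q].

End Generated.

Section Modules.
Variables (R : realType) (K : fieldType) (v : ultrabs R K).
Variables (C : alg_closure v) (X : affinoid v).

Local Notation H := (anel C X).

Definition is_basis (M : lmodType H) n (e : 'I_n -> M) : Prop :=
  forall m : M, exists! a : 'rV[H]_n, m = \sum_i a 0 i *: e i.

Definition finite_free (M : lmodType H) : Prop :=
  exists n (e : 'I_n -> M), is_basis e.

(** [m] has norm less than [eps] for the sup-norm in the basis [e]. *)
Definition norm_lt (M : lmodType H) n (e : 'I_n -> M) (m : M) (eps : R) : Prop :=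
  exists a : 'rV[H]_n,
    m = \sum_i a 0 i *: e i /\ forall i, supnorm (a 0 i) < eps.

Definition continuous_endo (M : lmodType H) (f : M -> M) : Prop :=
  forall n (e : 'I_n -> M), is_basis e ->
  forall (m : M) (eps : R), 0 < eps -> exists2 d : R, 0 < d &
    forall m' : M, norm_lt e (m' - m) d -> norm_lt e (f m' - f m) eps.

(** The elements of [<S>] act by automorphisms because of the group law.  They are
    [K]-linear by [smod_semilin], as [sigma q] fixes the constants. *)
Record smod (S : set K) := SMod {
  smod_car :> lmodType H;
  smod_free : finite_free smod_car;
  smod_op : forall q, gen S q -> smod_car -> smod_car;
  smod_cont : forall q (h : gen S q), continuous_endo (smod_op h);
  smod_add : forall q (h : gen S q) m m',
    smod_op h (m + m') = smod_op h m + smod_op h m';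
  smod_semilin : forall q (h : gen S q) f m,
    smod_op h (f *: m) = sigma q f *: smod_op h m;
  smod_op1 : forall (h : gen S 1) m, smod_op h m = m;
  smod_opM : forall q q' (h : gen S q) (h' : gen S q') (hh' : gen S (q * q')) m,
    smod_op hh' m = smod_op h (smod_op h' m) }.

Record sdmod (S : set K) := SDMod {
  sdmod_smod :> smod S;
  sdmod_delta : sdmod_smod -> sdmod_smod;
  sdmod_deltaD : forall m m', sdmod_delta (m + m') = sdmod_delta m + sdmod_delta m';
  sdmod_deltaZ : forall f m,
    sdmod_delta (f *: m) = delta1 f *: m + f *: sdmod_delta m }.

(** [A] is the matrix of [f] in the basis [e], with the convention
    [f(e_i) = \sum_j a_ij e_j]. *)
Definition is_matrix_of (M : lmodType H) n (e : 'I_n -> M) (f : M -> M)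
    (A : 'M[H]_n) : Prop :=
  forall i, f (e i) = \sum_j A i j *: e j.

Definition commutes_sigma (T S S' : set K) (M : smod S) (N : smod S')
    (f : M -> N) : Prop :=
  forall q, T q -> forall (h : gen S q) (h' : gen S' q) m,
    f (smod_op h m) = smod_op h' (f m).

Definition commutes_delta (S S' : set K) (M : sdmod S) (N : sdmod S')
    (f : M -> N) : Prop :=
  forall m, f (sdmod_delta m) = sdmod_delta (f m).

Section Restriction.
Variables (S S' : set K) (sub : S' `<=` S).

Definition smod_res (M : smod S) : smod S'.
Proof.
exists (smod_car M) (fun q h => smod_op (gen_sub sub h)).
- exact: smod_free.
- by move=> q h; exact: smod_cont.
- by move=> q h m m'; exact: smod_add.
- by move=> q h f m; exact: smod_semilin.
- by move=> h m; exact: smod_op1.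
- by move=> q q' h h' hh' m; exact: smod_opM.
Defined.

Definition sdmod_res (M : sdmod S) : sdmod S' :=
  @SDMod S' (smod_res M) (@sdmod_delta S M) (@sdmod_deltaD S M)
    (@sdmod_deltaZ S M).

End Restriction.

Lemma sval_inj T (P : T -> Prop) (f g : {x | P x}) : sval f = sval g -> f = g.
Proof. by move: f g => [f Pf] [g Pg] /= fg; exact: eq_exist. Qed.

Section Concrete.
Variables (O : Type) (car : O -> lmodType H).
Variable good : forall M N : O, (car M -> car N) -> Prop.
Hypothesis good_id : forall M, good (fun m : car M => m).
Hypothesis good_comp : forall M N P (f : car N -> car P) (g : car M -> car N),
  good f -> good g -> good (fun m => f (g m)).

Let hom_id (M : O) : linear (fun m : car M => m) /\ good (fun m : car M => m).
Proof. by split; [move=> ? ? ?|exact: good_id]. Qed.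

Let hom_comp (M N P : O) (f : car N -> car P) (g : car M -> car N) :
  linear f /\ good f -> linear g /\ good g ->
  linear (fun m => f (g m)) /\ good (fun m => f (g m)).
Proof.
move=> [lf mf] [lg mg]; split; last exact: good_comp.
by move=> a m m'; rewrite lg lf.
Qed.

Definition linear_cat : category.
Proof.
exists O (fun M N => {f : car M -> car N | linear f /\ good f})
  (fun M => exist _ (fun m => m) (hom_id M))
  (fun M N P f g =>
     exist _ (fun m => sval f (sval g m)) (hom_comp (svalP f) (svalP g))).
- by move=> M N f; exact: sval_inj.
- by move=> M N f; exact: sval_inj.
- by move=> M N P Q f g h; exact: sval_inj.
Defined.

End Concrete.

Section ConcreteFunctor.
Variables (O O' : Type) (car : O' -> lmodType H) (F : O -> O').
Variable good : forall M N : O, (car (F M) -> car (F N)) -> Prop.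
Variable good' : forall M N : O', (car M -> car N) -> Prop.
Hypothesis good_id : forall M, @good M M (fun m => m).
Hypothesis good_comp :
  forall M N P (f : car (F N) -> car (F P)) (g : car (F M) -> car (F N)),
  good f -> good g -> @good M P (fun m => f (g m)).
Hypothesis good'_id : forall M, good' (fun m : car M => m).
Hypothesis good'_comp : forall M N P (f : car N -> car P) (g : car M -> car N),
  good' f -> good' g -> good' (fun m => f (g m)).
Hypothesis good_good' : forall M N (f : car (F M) -> car (F N)),
  good f -> good' f.

Let hom_map M N (f : car (F M) -> car (F N)) :
  linear f /\ good f -> linear f /\ good' f.
Proof. by move=> [lf mf]; split=> //; exact: good_good'. Qed.

Definition linear_functor :
  functor (@linear_cat O (fun M => car (F M)) good good_id good_comp)
          (@linear_cat O' car good' good'_id good'_comp).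
Proof.
exists (F : linear_cat good_id good_comp -> linear_cat good'_id good'_comp)
  (fun M N f => exist _ (sval f) (hom_map (svalP f))).
- by move=> M; exact: sval_inj.
- by move=> M N P f g; exact: sval_inj.
Defined.

End ConcreteFunctor.

Section SigmaCat.
Variable S : set K.

Lemma smod_mor_id (M : smod S) : commutes_sigma S (fun m : M => m).
Proof. by move=> q Sq h h' m; rewrite (Prop_irrelevance h h'). Qed.

Lemma smod_mor_comp (M N P : smod S) (f : N -> P) (g : M -> N) :
  commutes_sigma S f -> commutes_sigma S g ->
  commutes_sigma S (fun m => f (g m)).
Proof.
by move=> cf cg q Sq h h' m; rewrite (cg q Sq h h) (cf q Sq h h').
Qed.

Definition smod_cat : category := linear_cat smod_mor_id smod_mor_comp.

Definition sdmod_mor (M N : sdmod S) (f : M -> N) : Prop :=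
  commutes_sigma S f /\ commutes_delta f.

Lemma sdmod_mor_id (M : sdmod S) : sdmod_mor (fun m : M => m).
Proof. by split=> //; exact: smod_mor_id. Qed.

Lemma sdmod_mor_comp (M N P : sdmod S) (f : N -> P) (g : M -> N) :
  sdmod_mor f -> sdmod_mor g -> sdmod_mor (fun m => f (g m)).
Proof.
move=> [cf df] [cg dg]; split; first exact: smod_mor_comp.
by move=> m; rewrite dg df.
Qed.

Definition sdmod_cat : category := linear_cat sdmod_mor_id sdmod_mor_comp.

Definition forget_delta : functor sdmod_cat smod_cat :=
  linear_functor sdmod_mor_id sdmod_mor_comp smod_mor_id smod_mor_comp
    (fun M N f (fP : sdmod_mor f) => proj1 fP).

End SigmaCat.

Section ResFunctor.
Variables (S S' : set K) (sub : S' `<=` S).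

Lemma res_mor (M N : smod S) (f : M -> N) :
  commutes_sigma S f ->
  @commutes_sigma S' S' S' (smod_res sub M) (smod_res sub N) f.
Proof. by move=> cf q S'q h h' m; exact/cf/sub. Qed.

Lemma sd_res_mor (M N : sdmod S) (f : M -> N) :
  sdmod_mor f -> @sdmod_mor S' (sdmod_res sub M) (sdmod_res sub N) f.
Proof. by move=> [cf df]; split; first exact: res_mor. Qed.

Definition res_sigma : functor (smod_cat S) (smod_cat S') :=
  @linear_functor _ _ (@smod_car S') (smod_res sub) _ _
    (@smod_mor_id S) (@smod_mor_comp S) _ _ res_mor.

Definition res_sigma_delta : functor (sdmod_cat S) (sdmod_cat S') :=
  @linear_functor _ _ (fun M : sdmod S' => M : lmodType H) (sdmod_res sub) _ _
    (@sdmod_mor_id S) (@sdmod_mor_comp S) _ _ sd_res_mor.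

End ResFunctor.

(** Direct limits over [r > tau_q].  An object is an object over [D_r] for some [r] with [tau_q < r <= r_X], and a
    morphism is a morphism between the restrictions to some smaller disc.  The
    restriction functors are injective on sets of morphisms, so that the direct limit
    of these sets is their union, in the set of linear maps. *)

Section Union.
Variable q : K.

Record usmod := USMod {
  us_rad : R;
  us_radP : tau X q < us_rad <= min_rad X;
  us_mod :> smod (disc1 X us_rad) }.

Record usdmod := USDMod {
  usd_rad : R;
  usd_radP : tau X q < usd_rad <= min_rad X;
  usd_mod :> sdmod (disc1 X usd_rad) }.

Definition usmod_mor (M N : usmod) (f : M -> N) : Prop :=
  exists2 r, tau X q < r <= Num.min (us_rad M) (us_rad N)
           & commutes_sigma (disc1 X r) f.

Definition usdmod_mor (M N : usdmod) (f : M -> N) : Prop :=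
  (exists2 r, tau X q < r <= Num.min (usd_rad M) (usd_rad N)
            & commutes_sigma (disc1 X r) f) /\ commutes_delta f.

Lemma commutes_sigma_comp (T1 T2 S1 S2 S3 : set K)
    (M : smod S1) (N : smod S2) (P : smod S3) (f : N -> P) (g : M -> N) :
  T1 `<=` T2 -> T1 `<=` S2 -> commutes_sigma T1 f -> commutes_sigma T2 g ->
  commutes_sigma T1 (fun m => f (g m)).
Proof.
move=> T12 T1S cf cg t Tt h h' m.
have h2 : gen S2 t by apply/gen_in/T1S.
by rewrite (cg t (T12 _ Tt) h h2) (cf t Tt h2 h').
Qed.

Lemma commutes_sigma_sub (T1 T2 S1 S2 : set K)
    (M : smod S1) (N : smod S2) (f : M -> N) :
  T1 `<=` T2 -> commutes_sigma T2 f -> commutes_sigma T1 f.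
Proof. by move=> T12 cf t /T12; exact: cf. Qed.

Lemma union_comp (a b c : R) (M : smod (disc1 X a)) (N : smod (disc1 X b))
    (P : smod (disc1 X c)) (f : N -> P) (g : M -> N) :
  (exists2 r, tau X q < r <= Num.min b c & commutes_sigma (disc1 X r) f) ->
  (exists2 r, tau X q < r <= Num.min a b & commutes_sigma (disc1 X r) g) ->
  exists2 r, tau X q < r <= Num.min a c
    & commutes_sigma (disc1 X r) (fun m => f (g m)).
Proof.
move=> [r /andP[r0]] + cf [s /andP[s0]] + cg.
rewrite !le_min => /andP[rb rc] /andP[sa sb]; exists (Num.min r s).
  by rewrite lt_min r0 s0 le_min !ge_min sa rc orbT.
apply: (@commutes_sigma_comp _ (disc1 X s)) cg.
- by apply: disc1_sub; rewrite ge_min lexx orbT.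
- by apply: disc1_sub; rewrite ge_min rb.
- by apply: commutes_sigma_sub cf; apply: disc1_sub; rewrite ge_min lexx.
Qed.

Lemma usmod_mor_id (M : usmod) : usmod_mor (fun m : M => m).
Proof.
exists (us_rad M); last exact: smod_mor_id.
by rewrite minxx lexx andbT; case/andP: (us_radP M).
Qed.

Lemma usmod_mor_comp (M N P : usmod) (f : N -> P) (g : M -> N) :
  usmod_mor f -> usmod_mor g -> usmod_mor (fun m => f (g m)).
Proof. exact: union_comp. Qed.

Definition usmod_cat : category := linear_cat usmod_mor_id usmod_mor_comp.

Lemma usdmod_mor_id (M : usdmod) : usdmod_mor (fun m : M => m).
Proof.
split=> //; exists (usd_rad M); last exact: smod_mor_id.
by rewrite minxx lexx andbT; case/andP: (usd_radP M).
Qed.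

Lemma usdmod_mor_comp (M N P : usdmod) (f : N -> P) (g : M -> N) :
  usdmod_mor f -> usdmod_mor g -> usdmod_mor (fun m => f (g m)).
Proof.
move=> [cf df] [cg dg]; split; first exact: union_comp cf cg.
by move=> m; rewrite dg df.
Qed.

Definition usdmod_cat : category := linear_cat usdmod_mor_id usdmod_mor_comp.

Definition union_forget_delta : functor usdmod_cat usmod_cat :=
  @linear_functor _ _ (fun M : usmod => M : lmodType H)
    (fun M : usdmod => USMod (usd_radP M) M) _ _
    usdmod_mor_id usdmod_mor_comp usmod_mor_id usmod_mor_comp
    (fun M N f (fP : usdmod_mor f) => proj1 fP).

Lemma union_sub r : tau X q < r <= min_rad X -> [set q] `<=` disc1 X r.
Proof. by move=> /andP[qr _]; apply: sub_set1; apply/disc1E. Qed.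

Definition usmod_res (M : usmod) : smod [set q] :=
  smod_res (union_sub (us_radP M)) M.

Definition usdmod_res (M : usdmod) : sdmod [set q] :=
  sdmod_res (union_sub (usd_radP M)) M.

Lemma usmod_res_mor (M N : usmod) (f : M -> N) :
  usmod_mor f -> @commutes_sigma [set q] _ _ (usmod_res M) (usmod_res N) f.
Proof. by move=> [r /andP[qr _] cf] _ -> h h' m; apply/cf/disc1E. Qed.

Lemma usdmod_res_mor (M N : usdmod) (f : M -> N) :
  usdmod_mor f -> @sdmod_mor [set q] (usdmod_res M) (usdmod_res N) f.
Proof.
move=> [[r /andP[qr _] cf] df]; split=> // _ -> h h' m.
by apply/cf/disc1E.
Qed.

Definition union_res_sigma : functor usmod_cat (smod_cat [set q]) :=
  @linear_functor _ _ (@smod_car [set q]) usmod_res _ _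
    usmod_mor_id usmod_mor_comp _ _ usmod_res_mor.

Definition union_res_sigma_delta : functor usdmod_cat (sdmod_cat [set q]) :=
  @linear_functor _ _ (fun M : sdmod [set q] => M : lmodType H) usdmod_res _ _
    usdmod_mor_id usdmod_mor_comp _ _ usdmod_res_mor.

End Union.

Section Taylor.
Variable S : set K.

Definition sigma_taylor (r : R) (M : smod S) : Prop :=
  S `<=` disc1 X r /\
  exists n (e : 'I_n -> M) (rho : R) (Y : points C X -> points C X -> 'M[C]_n),
  [/\ is_basis e, r <= rho <= min_rad X, analytic_on_U rho Y &
    forall q (h : gen S q) A, S q -> is_matrix_of e (smod_op h) A ->
      (~ unity_root q -> is_q_taylor_solution rho q A Y) /\
      q_solution rho q A Y].

Definition sigma_delta_taylor (r : R) (M : sdmod S) : Prop :=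
  S `<=` disc1 X r /\
  exists n (e : 'I_n -> M) (rho : R) (Y : points C X -> points C X -> 'M[C]_n),
  [/\ is_basis e, r <= rho <= min_rad X, analytic_on_U rho Y,
      forall G, is_matrix_of e (@sdmod_delta S M) G ->
        is_d_taylor_solution rho G Y
    & forall q (h : gen S q) A, S q -> is_matrix_of e (smod_op h) A ->
        q_solution rho q A Y].

Definition sigma_adm (M : smod S) : Prop :=
  exists2 r, 0 < r <= min_rad X & sigma_taylor r M.

Definition sigma_delta_adm (M : sdmod S) : Prop :=
  exists2 r, 0 < r <= min_rad X & sigma_delta_taylor r M.

End Taylor.

Definition union_sigma_adm q (M : usmod q) : Prop := sigma_adm (us_mod M).

Definition union_sigma_delta_adm q (M : usdmod q) : Prop :=
  sigma_delta_adm (usd_mod M).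

End Modules.

(* Main.v *)
(** The Taylor solution [Y] of a module, with [Y(x, x) = 1], is a cocycle:
    [Y(x, y) Y(y, z) = Y(x, z)] on [U_rho].  For the differential equation this is the
    uniqueness of the solutions of a linear system; for the [q]-difference equation both
    sides agree at the points [q^i y] for all [i >= 0], which accumulate at [y] when [q]
    is not a root of unity, so they agree by the identity theorem.

    Write [Y(x, y) = \sum_k a_k(y) (x - y)^k].  By the cocycle relation, [Y] is the
    solution of the equation [dY/dx = a_1 Y] and, for every [q] with [tau_q < rho], of
    the equation [Y(qx, y) = A(q, x) Y(x, y)] with [A(q, x) = Y(qx, x)], where
    [A(qq', x) = A(q, q'x) A(q', x)]; and it is the Taylor solution of each of them.
    So [Y] recovers, from the operator of a single [q] or from the connection, all the
    other operators.  A linear map with matrix [F] that commutes with [sigma_q] for one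
    [q] that is not a root of unity, or with the connection, satisfies
    [F(x) Y'(x, y) = Y(x, y) F(y)] for [x] near [y], hence commutes with all of them.  Therefore all the functors are full, faithful and essentially
    surjective. *)
Require Import Defs.
From mathcomp Require Import all_boot all_order all_algebra.
From mathcomp Require Import all_classical all_reals all_analysis.
From mathcomp Require Import cyclic separable cyclotomic.
From mathcomp Require Import ring lra zify.

Set Implicit Arguments.
Unset Strict Implicit.
Unset Printing Implicit Defensive.

Import Order.TTheory GRing.Theory Num.Theory.
Import numFieldNormedType.Exports.

Local Open Scope classical_set_scope.
Local Open Scope ring_scope.

(** [K^alg] need not be complete, so a Cauchy sequence may have no limit there. The remedy is that
    all values at [x] of elements of H_K(X) lie in one finite-dimensional [K]-space, K(x), which is
    complete; [kspan] records such spaces, and sums of series are treated as relations. Derivatives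
    and q-derivatives are chosen elements of H_K(X), so their existence has to be proved: uniform
    limits of rational functions are controlled by Cauchy estimates, obtained from averages over
    roots of unity of order prime to [p]. The point 0, when it lies in [X], is fixed by every [q],
    and its orbit carries no information: the cocycle and intertwining relations reach [y = 0]
    through a nearby point [x != 0], and the Taylor coefficients reach it by continuity. Finally,
    the passage between the series in [(x - y)^k] and the q-series is Newton interpolation at the
    nodes [q^k y]: on the orbit [Y] is a finite sum of q-Taylor terms, which determines the Newton
    coefficients. *)

Section Limits.
Variables (R : realType) (C : fieldType) (w : ultrabs R C).
Implicit Types (x y z : C) (B e : R) (f g : C -> C).

Lemma uabs_gt0 x : (0 < w x) = (x != 0).
Proof.
rewrite lt_neqAle uabs_ge0 andbT eq_sym; congr (~~ _).
by apply/eqP/eqP => [|->]; [exact: uabs_eq0|exact: uabs0].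
Qed.

Lemma uabs_prod (I : Type) (s : seq I) (P : pred I) (F : I -> C) :
  w (\prod_(i <- s | P i) F i) = \prod_(i <- s | P i) w (F i).
Proof. by apply: (big_morph w (uabsM w) (uabs1 w)). Qed.

Lemma uabsX x n : w (x ^+ n) = w x ^+ n.
Proof. by elim: n => [|n IH]; rewrite ?uabs1 // !exprS uabsM IH. Qed.

Lemma uabs_subC x y : w (x - y) = w (y - x).
Proof. by rewrite -uabsN opprB. Qed.

Lemma uabs_add_le x y B : w x <= B -> w y <= B -> w (x + y) <= B.
Proof. by move=> xB yB; rewrite (le_trans (uabs_ultra _ _ _)) // ge_max xB. Qed.

Lemma uabs_add_lt x y B : w x < B -> w y < B -> w (x + y) < B.
Proof. by move=> xB yB; rewrite (le_lt_trans (uabs_ultra _ _ _)) // gt_max xB. Qed.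

Lemma uabs_sub_le x y B : w x <= B -> w y <= B -> w (x - y) <= B.
Proof. by move=> xB yB; rewrite uabs_add_le // uabsN. Qed.

Lemma uabs_sub_lt x y B : w x < B -> w y < B -> w (x - y) < B.
Proof. by move=> xB yB; rewrite uabs_add_lt // uabsN. Qed.

Lemma uabs_trans_lt x y z B : w (x - y) < B -> w (y - z) < B -> w (x - z) < B.
Proof. by move=> xy yz; rewrite -(subrKA y) uabs_add_lt. Qed.

Lemma uabs_sum_le (I : Type) (s : seq I) (P : pred I) (F : I -> C) B :
  0 <= B -> (forall i, P i -> w (F i) <= B) -> w (\sum_(i <- s | P i) F i) <= B.
Proof.
move=> B0 FB; elim/big_rec: _ => [|i x Pi xB]; first by rewrite uabs0.
by rewrite uabs_add_le // FB.
Qed.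

Lemma uabs_nat n : w n%:R <= 1.
Proof.
elim: n => [|n IH]; first by rewrite uabs0.
by rewrite -natr1 uabs_add_le // uabs1.
Qed.

Lemma uabs_mulrn_le x n B : w x <= B -> w (x *+ n) <= B.
Proof.
move=> xB; rewrite -mulr_natl uabsM -[B]mul1r.
by rewrite ler_pM ?uabs_ge0 ?uabs_nat.
Qed.

(** One notion of limit for both filters in use, [\oo] for series and [dn0] for derivatives,
    measured in [R] through [w]. *)
Definition wlim (T : Type) (F : set_system T) (u : T -> C) (l : C) : Prop :=
  forall e, 0 < e -> F [set t | w (u t - l) < e].

Section Algebra.
Context {T : Type} {F : set_system T} {FF : Filter F}.
Implicit Types u : T -> C.

Lemma wlim_cst l : wlim F (fun=> l) l.
Proof. by move=> e e0; apply: filterE => t /=; rewrite subrr uabs0. Qed.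

Lemma wlim_near u u' l : F [set t | u t = u' t] -> wlim F u l -> wlim F u' l.
Proof.
move=> uu' ul e e0; apply: filterS2 uu' (ul e e0) => t /= -> //.
Qed.

Lemma wlim_ext u u' l : u =1 u' -> wlim F u l -> wlim F u' l.
Proof. by move=> uu'; apply: wlim_near; apply: filterE => t /=. Qed.

Lemma wlimD u u' l l' :
  wlim F u l -> wlim F u' l' -> wlim F (fun t => u t + u' t) (l + l').
Proof.
move=> ul u'l' e e0; apply: filterS2 (ul e e0) (u'l' e e0) => t /= h h'.
by rewrite opprD addrACA uabs_add_lt.
Qed.

Lemma wlimN u l : wlim F u l -> wlim F (fun t => - u t) (- l).
Proof.
by move=> ul e e0; apply: filterS (ul e e0) => t /=; rewrite -opprD uabsN.
Qed.

Lemma wlimB u u' l l' :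
  wlim F u l -> wlim F u' l' -> wlim F (fun t => u t - u' t) (l - l').
Proof. by move=> ul u'l'; apply: wlimD => //; exact: wlimN. Qed.

Lemma wlim_sum (I : Type) (s : seq I) (P : pred I) (u : I -> T -> C) (l : I -> C) :
  (forall i, P i -> wlim F (u i) (l i)) ->
  wlim F (fun t => \sum_(i <- s | P i) u i t) (\sum_(i <- s | P i) l i).
Proof.
move=> ul; elim: s => [|i s IH].
  by rewrite big_nil; apply: wlim_ext (wlim_cst 0) => t; rewrite big_nil.
rewrite big_cons; case: ifP => Pi.
  by apply: wlim_ext (wlimD (ul i Pi) IH) => t; rewrite big_cons Pi.
by apply: wlim_ext IH => t; rewrite big_cons Pi.
Qed.

Lemma wlimM u u' l l' :
  wlim F u l -> wlim F u' l' -> wlim F (fun t => u t * u' t) (l * l').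
Proof.
move=> ul u'l' e e0.
pose c := 1 + w l + w l'; have c0 : 0 < c by rewrite /c -addrA ltr_pwDl ?addr_ge0 ?uabs_ge0.
have h1 := ul _ (divr_gt0 e0 c0); have h2 := u'l' _ (divr_gt0 e0 c0).
have h3 := u'l' 1 ltr01; near=> t => /=.
have -> : u t * u' t - l * l' = (u t - l) * u' t + l * (u' t - l') by ring.
have u'c : w (u' t) <= c.
  rewrite -(subrK l' (u' t)); apply: le_trans (uabs_ultra _ _ _) _.
  have h : w (u' t - l') < 1 by near: t.
  have := uabs_ge0 w l; have := uabs_ge0 w l'.
  by rewrite ge_max /c => a b; apply/andP; split; lra.
have lc : w l <= c.
  have := uabs_ge0 w l; have := uabs_ge0 w l'; rewrite /c; lra.
apply: uabs_add_lt; rewrite uabsM.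
  apply: (@le_lt_trans _ _ (w (u t - l) * c)); first by rewrite ler_wpM2l ?uabs_ge0.
  by rewrite -ltr_pdivlMr //; near: t.
rewrite mulrC; apply: (@le_lt_trans _ _ (w (u' t - l') * c)).
  by rewrite ler_wpM2l ?uabs_ge0.
by rewrite -ltr_pdivlMr //; near: t.
Unshelve. all: by end_near. Qed.

Lemma wlimZ c u l : wlim F u l -> wlim F (fun t => c * u t) (c * l).
Proof. by move=> ul; apply: wlimM => //; exact: wlim_cst. Qed.

Lemma wlimV u l : l != 0 -> wlim F u l -> wlim F (fun t => (u t)^-1) l^-1.
Proof.
move=> l0 ul e e0; have wl0 : 0 < w l by rewrite uabs_gt0.
have h1 := ul _ wl0; have h2 := ul _ (mulr_gt0 e0 (mulr_gt0 wl0 wl0)).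
near=> t => /=.
have h : w (u t - l) < w l by near: t.
(* By the ultrametric inequality [|u t|] cannot drop below [|l|] once [|u t - l| < |l|]; this keeps
   the inverses bounded. *)
have utl : w l <= w (u t).
  rewrite leNgt; apply/negP => utl; have := ltxx (w l).
  by rewrite -{1}(subKr (u t) l) uabs_sub_lt.
have ut0 : u t != 0 by rewrite -uabs_gt0 (lt_le_trans wl0).
have -> : (u t)^-1 - l^-1 = - (u t - l) / (u t * l) by field; rewrite ?ut0 ?l0.
rewrite !(uabsM, uabsV, uabsN) ltr_pdivrMr ?mulr_gt0 ?uabs_gt0 //.
apply: (@lt_le_trans _ _ (e * (w l * w l))); first by near: t.
by rewrite ler_pM2l // ler_pM2r.
Unshelve. all: by end_near. Qed.

End Algebra.

Section Unicity.
Context {T : Type} {F : set_system T} {FF : ProperFilter F}.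

(** Closed balls contain the limits of proper filters; estimates on partial sums pass to sums
    through this. *)
Lemma wlim_le (u : T -> C) l c B :
  wlim F u l -> 0 <= B -> F [set t | w (u t - c) <= B] -> w (l - c) <= B.
Proof.
move=> ul B0 uB; apply/ler_addgt0Pr => e e0.
have [t [/= h1 h2]] := filter_ex (filterI (ul e e0) uB).
rewrite uabs_subC in h1; rewrite -(subrKA (u t)).
apply: uabs_add_le; first by rewrite (le_trans (ltW h1)) // lerDr.
by rewrite (le_trans h2) // lerDl ltW.
Qed.

Lemma wlim_uniq (u : T -> C) l l' : wlim F u l -> wlim F u l' -> l = l'.
Proof.
move=> ul ul'; apply/eqP; rewrite -subr_eq0 -[_ == 0]negbK -uabs_gt0 -leNgt.
apply/ler_addgt0Pr => e e0; rewrite add0r; apply: wlim_le ul (ltW e0) _.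
by apply: filterS (ul' e e0) => t /= /ltW.
Qed.

End Unicity.

Lemma wlim_seqP (u : nat -> C) l :
  wlim \oo u l <-> w (u n - l) @[n --> \oo] --> (0 : R).
Proof.
split=> [ul|/cvgrPdist_lt ul e e0].
  apply/cvgrPdist_lt => e e0; apply: filterS (ul e e0) => n /=.
  by rewrite sub0r normrN ger0_norm ?uabs_ge0.
by apply: filterS (ul e e0) => n /=; rewrite sub0r normrN ger0_norm ?uabs_ge0.
Qed.

Lemma wlim_seqE (u : nat -> C) l :
  wlim \oo u l <->
  forall e, 0 < e -> exists N : nat, forall n, (N <= n)%N -> w (u n - l) < e.
Proof.
split=> ul e e0.
  by have [N _ h] := ul e e0; exists N => // n; exact: h.
by have [N h] := ul e e0; exists N => // n; exact: h.
Qed.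

Lemma wlim_shift (u : nat -> C) l : wlim \oo u l -> wlim \oo (fun n => u n.+1) l.
Proof.
by move=> ul e e0; have [N _ h] := ul e e0; exists N => // n /= /leqW; exact: h.
Qed.

Lemma wlim_unshift (u : nat -> C) l : wlim \oo (fun n => u n.+1) l -> wlim \oo u l.
Proof.
by move=> ul e e0; have [N _ h] := ul e e0; exists N.+1 => // -[//|n]; exact: h.
Qed.

Definition wcauchy (u : nat -> C) : Prop := forall e, 0 < e ->
  exists N : nat, forall m n, (N <= m)%N -> (N <= n)%N -> w (u m - u n) < e.

Lemma wlim_cauchy u l : wlim \oo u l -> wcauchy u.
Proof.
move=> ul e e0; have [N _ h] := ul e e0; exists N => m n Nm Nn.
by apply: (uabs_trans_lt (h m Nm)); rewrite uabs_subC; exact: h.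
Qed.

(** A block of terms is no larger than its largest term, so that terms tending to 0 suffice. *)
Lemma wcauchy_series (u : nat -> C) : wlim \oo u 0 ->
  wcauchy (fun N => \sum_(k < N) u k).
Proof.
move=> /wlim_seqE u0 e e0; have [N h] := u0 _ (divr_gt0 e0 (ltr0n _ 2)); exists N.
have half : e / 2 < e by rewrite ltr_pdivrMr // ltr_pMr // ltr1n.
move=> m n; wlog nm : m n / (n <= m)%N => [hwlog Nm Nn|Nm Nn].
  have [/hwlog|/ltnW /hwlog] := leqP n m; first exact.
  by rewrite uabs_subC; apply.
rewrite -!(big_mkord predT u) (@big_cat_nat _ _ _ n) //= [X in X - _]addrC addrK.
apply: le_lt_trans half; rewrite big_nat_cond; apply: uabs_sum_le => [|k].
  by rewrite ltW // divr_gt0.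
by move=> /andP[/andP[nk _] _]; rewrite -[u k]subr0 ltW // h // (leq_trans Nn).
Qed.

(** The punctured neighbourhoods of 0. The filter is proper only if [w] takes arbitrarily small
    nonzero values, whence the hypothesis of [dn0_proper]. *)
Definition dn0 : set_system C :=
  [set A | exists2 d : R, 0 < d & forall h, 0 < w h < d -> A h].

Global Instance dn0_filter : Filter dn0.
Proof.
split=> [|A B [a a0 hA] [b b0 hB]|A B AB [a a0 hA]].
- by exists 1.
- exists (Num.min a b); first by rewrite lt_min a0.
  by move=> h; rewrite lt_min => /and3P[h0 ha hb]; split; [apply: hA|apply: hB]; apply/andP.
- by exists a => // h /hA; exact: AB.
Qed.

Lemma dn0_proper : (forall e, 0 < e -> exists h, 0 < w h < e) -> ProperFilter dn0.
Proof.
by move=> nt; split=> [[d /nt[h hd] /(_ h hd)//]|]; exact: dn0_filter.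
Qed.

Lemma dn0_lt e : 0 < e -> dn0 [set h | w h < e].
Proof. by exists e => // h /andP[]. Qed.

Lemma dn0_neq0 : dn0 [set h | h != 0].
Proof. by exists 1 => // h /andP[]; rewrite uabs_gt0. Qed.

Definition has_deriv (g : C -> C) (z d : C) : Prop :=
  wlim dn0 (fun h => (g (z + h) - g z) / h) d.

Lemma has_deriv_cont g z d : has_deriv g z d -> wlim dn0 (fun h => g (z + h)) (g z).
Proof.
move=> gd; have id0 : wlim dn0 (fun h => h) 0.
  by move=> e /dn0_lt; apply: filterS => h /=; rewrite subr0.
rewrite -[g z]add0r -(mulr0 d).
apply: wlim_near (wlimD (wlimM gd id0) (wlim_cst (g z))).
by apply: filterS dn0_neq0 => h /= h0; rewrite divfK // subrK.
Qed.

Lemma has_deriv_cst c z : has_deriv (fun=> c) z 0.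
Proof. by apply: wlim_ext (wlim_cst 0) => h; rewrite subrr mul0r. Qed.

Lemma has_derivD f g z d d' : has_deriv f z d -> has_deriv g z d' ->
  has_deriv (fun t => f t + g t) z (d + d').
Proof.
move=> fd gd; apply: wlim_ext (wlimD fd gd) => h.
by rewrite -mulrDl opprD addrACA.
Qed.

Lemma has_derivN f z d : has_deriv f z d -> has_deriv (fun t => - f t) z (- d).
Proof.
by move=> fd; apply: wlim_ext (wlimN fd) => h; rewrite -mulNr opprD.
Qed.

Lemma has_derivM f g z d d' : has_deriv f z d -> has_deriv g z d' ->
  has_deriv (fun t => f t * g t) z (d * g z + f z * d').
Proof.
move=> fd gd; have fc := has_deriv_cont fd.
refine (wlim_ext _ (wlimD (wlimM fd (wlim_cst (g z))) (wlimM fc gd))) => h.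
rewrite mulrAC [f (z + h) * _]mulrA -mulrDl; congr (_ / _); ring.
Qed.

Lemma has_derivV f z d : f z != 0 -> has_deriv f z d ->
  has_deriv (fun t => (f t)^-1) z (- d / f z ^+ 2).
Proof.
move=> fz0 fd; have fc := has_deriv_cont fd.
have wfz0 : 0 < w (f z) by rewrite uabs_gt0.
rewrite expr2.
refine (wlim_near _ (wlimM (wlimN fd) (wlimV (mulf_neq0 fz0 fz0) (wlimM fc (wlim_cst (f z)))))).
apply: filterS2 dn0_neq0 (fc _ wfz0) => h /= h0 hz.
have fh0 : f (z + h) != 0.
  by apply: contraTneq hz => ->; rewrite sub0r uabsN ltxx.
by field; rewrite ?h0 ?fz0 ?fh0.
Qed.

Lemma has_deriv_sum (I : Type) (s : seq I) (P : pred I) (f : I -> C -> C) (d : I -> C) z :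
  (forall i, P i -> has_deriv (f i) z (d i)) ->
  has_deriv (fun t => \sum_(i <- s | P i) f i t) z (\sum_(i <- s | P i) d i).
Proof.
rewrite /has_deriv => fd; refine (wlim_ext _ (wlim_sum _ fd)) => h.
by rewrite -sumrB big_distrl.
Qed.

Lemma has_deriv_near f g z d : f z = g z -> dn0 [set h | f (z + h) = g (z + h)] ->
  has_deriv f z d -> has_deriv g z d.
Proof.
move=> fz fg; apply: wlim_near; apply: filterS fg => h /= ->.
by rewrite fz.
Qed.

End Limits.

(** * Power series: products, differentiation, recentring, Cauchy estimates *)

Section PowerSeries.
Variables (R : realType) (C : fieldType) (w : ultrabs R C).
Implicit Types (x y z h s t : C) (B e rho : R) (f g : C -> C) (b c : nat -> C).

Lemma series_tail (u : nat -> C) N n B : 0 <= B -> (N <= n)%N ->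
  (forall k, (N <= k)%N -> w (u k) <= B) ->
  w (\sum_(k < n) u k - \sum_(k < N) u k) <= B.
Proof.
move=> B0 Nn uB.
rewrite -!(big_mkord predT u) (@big_cat_nat _ _ _ N) //= [X in X - _]addrC addrK.
by rewrite big_nat_cond; apply: uabs_sum_le => // k /andP[/andP[/uB]].
Qed.

Lemma wlim0_bounded (u : nat -> C) : wlim w \oo u 0 ->
  exists2 B, 0 < B & forall k, w (u k) <= B.
Proof.
move=> /wlim_seqE /(_ 1 ltr01)[N uN].
have S0 : 0 <= \sum_(k < N) w (u k) by apply: sumr_ge0 => k _; exact: uabs_ge0.
exists (1 + \sum_(k < N) w (u k)) => [|k]; first by rewrite ltr_pwDl.
have [/uN|kN] := leqP N k.
  by rewrite subr0 => /ltW; move/le_trans; apply; rewrite lerDl.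
rewrite (bigD1 (Ordinal kN)) //= addrCA lerDl addr_ge0 // sumr_ge0 // => i _.
exact: uabs_ge0.
Qed.

(** A relation and not a function: without completeness a series whose terms tend to 0 may have no
    sum. *)
Definition psum b z s : Prop := wlim w \oo (fun N => \sum_(k < N) b k * z ^+ k) s.

Definition ps rho g b : Prop := forall z, w z < rho -> psum b z (g z).

Definition an rho g : Prop := exists b, ps rho g b.

Lemma wlim_series_term (u : nat -> C) s :
  wlim w \oo (fun N => \sum_(k < N) u k) s -> wlim w \oo u 0.
Proof.
move=> us; rewrite -(subrr s); apply: wlim_ext (wlimB (wlim_shift us) us) => N.
by rewrite big_ord_recr /= addrAC subrr add0r.
Qed.

Lemma psum_small b z s : psum b z s ->
  forall e, 0 < e -> exists N, forall k, (N <= k)%N -> w (b k) * w z ^+ k < e.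
Proof.
move=> bs e e0; have /wlim_seqE := @wlim_series_term (fun k => b k * z ^+ k) s bs.
move=> /(_ e e0)[N hN]; exists N => k /hN.
by rewrite subr0 uabsM uabsX.
Qed.

Lemma psum_bound b z s : psum b z s ->
  exists2 B, 0 < B & forall k, w (b k) * w z ^+ k <= B.
Proof.
move=> bs; have /wlim0_bounded[B B0 hB] := @wlim_series_term (fun k => b k * z ^+ k) s bs; exists B => // k.
by have := hB k; rewrite uabsM uabsX.
Qed.

Lemma psum_tail b z s N B : psum b z s -> 0 <= B ->
  (forall k, (N <= k)%N -> w (b k * z ^+ k) <= B) ->
  w (s - \sum_(k < N) b k * z ^+ k) <= B.
Proof.
move=> bz B0 hB; apply: (wlim_le bz) => //; exists N => // n /= Nn.
exact: (series_tail (u := fun k => b k * z ^+ k)).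
Qed.

Lemma psum_uniq b z s s' : psum b z s -> psum b z s' -> s = s'.
Proof. exact: wlim_uniq. Qed.

Lemma psum_ext b c z s : b =1 c -> psum b z s -> psum c z s.
Proof.
by move=> bc; apply: wlim_ext => N; apply: eq_bigr => k _; rewrite bc.
Qed.

Lemma psumD b c z s t : psum b z s -> psum c z t ->
  psum (fun k => b k + c k) z (s + t).
Proof.
move=> bs ct; apply: wlim_ext (wlimD bs ct) => N.
by rewrite -big_split /=; apply: eq_bigr => k _; rewrite mulrDl.
Qed.

Lemma psumZ a b z s : psum b z s -> psum (fun k => a * b k) z (a * s).
Proof.
move=> bs; apply: wlim_ext (wlimZ a bs) => N.
by rewrite big_distrr /=; apply: eq_bigr => k _; rewrite mulrA.
Qed.

Lemma psumB b c z s t : psum b z s -> psum c z t ->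
  psum (fun k => b k - c k) z (s - t).
Proof.
move=> bs ct; rewrite -[- t]mulN1r.
by apply: psum_ext (psumD bs (psumZ (-1) ct)) => k; rewrite mulN1r.
Qed.

Lemma psum_poly b z N : (forall k, (N <= k)%N -> b k = 0) ->
  psum b z (\sum_(k < N) b k * z ^+ k).
Proof.
move=> b0 e e0; exists N => // n /= Nn; apply: le_lt_trans e0.
by apply: (@series_tail (fun k => b k * z ^+ k)) => // k /b0 ->; rewrite mul0r uabs0.
Qed.

Lemma psum_sum (I : Type) (r : seq I) (P : pred I) (b : I -> nat -> C) z (s : I -> C) :
  (forall i, P i -> psum (b i) z (s i)) ->
  psum (fun k => \sum_(i <- r | P i) b i k) z (\sum_(i <- r | P i) s i).
Proof.
move=> bs; apply: wlim_ext (wlim_sum r bs) => N.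
by rewrite exchange_big; apply: eq_bigr => k _; rewrite mulr_suml.
Qed.

Definition cprod b c (k : nat) : C := \sum_(i < k.+1) b i * c (k - i)%N.

Lemma wlim_series_conv (u v : nat -> C) s t :
  wlim w \oo (fun N => \sum_(k < N) u k) s ->
  wlim w \oo (fun N => \sum_(k < N) v k) t ->
  wlim w \oo (fun N => \sum_(k < N) cprod u v k) (s * t).
Proof.
move=> us vt; have u0 := wlim_series_term us; have v0 := wlim_series_term vt.
have [Bu Bu0 hu] := wlim0_bounded u0; have [Bv Bv0 hv] := wlim0_bounded v0.
suff h : wlim w \oo (fun N => (\sum_(k < N) u k) * (\sum_(k < N) v k)
    - \sum_(k < N) cprod u v k) 0.
  rewrite -[s * t]subr0; apply: wlim_ext (wlimB (wlimM us vt) h) => N.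
  by rewrite /= subKr.
apply/wlim_seqE => e e0.
have [Nu hNu] := (iffLR (wlim_seqE _ _ _) u0) _ (divr_gt0 (divr_gt0 e0 (ltr0n _ 2)) Bv0).
have [Nv hNv] := (iffLR (wlim_seqE _ _ _) v0) _ (divr_gt0 (divr_gt0 e0 (ltr0n _ 2)) Bu0).
exists (Nu + Nv)%N => N hN; rewrite subr0.
(* The product of the partial sums is the value at 1 of [pu * pv], whose coefficients below [N] are
   those of the Cauchy product. What remains are the coefficients of index at least [N], in which
   every term has [i >= Nu] or [k - i >= Nv]. *)
pose pu := \poly_(i < N) u i; pose pv := \poly_(i < N) v i.
have S q : (\poly_(i < N) q i).[1] = \sum_(i < N) q i :> C.
  by rewrite horner_poly; apply: eq_bigr => i _; rewrite expr1n mulr1.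
have le_e : e / 2 < e by rewrite ltr_pdivrMr // ltr_pMr // ltr1n.
apply: le_lt_trans le_e.
have -> : (\sum_(k < N) u k) * (\sum_(k < N) v k) = \sum_(k < N + N) (pu * pv)`_k.
  rewrite -!S -hornerM (@horner_coef_wide _ (N + N)).
    by apply: eq_bigr => i _; rewrite expr1n mulr1.
  apply: leq_trans (size_polyMleq _ _) _; apply: leq_trans (leq_pred _) _.
  by rewrite leq_add // size_poly.
have -> : \sum_(k < N) cprod u v k = \sum_(k < N) (pu * pv)`_k.
  apply: eq_bigr => k _; rewrite coefM; apply: eq_bigr => i _.
  rewrite !coef_poly (leq_ltn_trans (leq_subr _ _)) //.
  by rewrite (leq_trans (ltn_ord i)).
apply: (series_tail (u := fun k => (pu * pv)`_k)); rewrite ?leq_addr //.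
  by rewrite ltW // divr_gt0.
move=> k Nk; rewrite coefM; apply: uabs_sum_le => [|i _].
  by rewrite ltW // divr_gt0.
have cle q j : w (\poly_(i < N) q i)`_j <= w (q j).
  by rewrite coef_poly; case: ifP => // _; rewrite uabs0 uabs_ge0.
rewrite uabsM; apply: (@le_trans _ _ (w (u i) * w (v (k - i)%N))).
  by rewrite ler_pM ?uabs_ge0 // cle.
have [/hNu|iNu] := leqP Nu i.
  rewrite subr0 => /ltW ui; rewrite -(divfK (lt0r_neq0 Bv0) (e / 2)).
  by rewrite ler_pM ?uabs_ge0.
rewrite mulrC -(divfK (lt0r_neq0 Bu0) (e / 2)) ler_pM ?uabs_ge0 //.
have /hNv : (Nv <= k - i)%N.
  by move: hN iNu Nk; lia.
by rewrite subr0 => /ltW.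
Qed.

Lemma psumM b c z s t : psum b z s -> psum c z t -> psum (cprod b c) z (s * t).
Proof.
move=> bs ct; apply: wlim_ext (wlim_series_conv (u := fun k => b k * z ^+ k) (v := fun k => c k * z ^+ k) bs ct) => N.
apply: eq_bigr => k _; rewrite /cprod mulr_suml; apply: eq_bigr => i _.
by rewrite mulrACA -exprD subnKC // -ltnS ltn_ord.
Qed.

Lemma anD rho f g : an rho f -> an rho g -> an rho (fun z => f z + g z).
Proof.
move=> [b fb] [c gc]; exists (fun k => b k + c k) => z zr.
by apply: psumD; [exact: fb|exact: gc].
Qed.

Lemma anB rho f g : an rho f -> an rho g -> an rho (fun z => f z - g z).
Proof.
move=> [b fb] [c gc]; exists (fun k => b k - c k) => z zr.
by apply: psumB; [exact: fb|exact: gc].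
Qed.

Lemma anM rho f g : an rho f -> an rho g -> an rho (fun z => f z * g z).
Proof.
move=> [b fb] [c gc]; exists (cprod b c) => z zr.
by apply: psumM; [exact: fb|exact: gc].
Qed.

Lemma an_cst rho a : an rho (fun=> a).
Proof.
exists (fun k => if k is 0%N then a else 0) => z _.
have E : a = \sum_(k < 1) (if (k : nat) is 0%N then a else 0) * z ^+ k.
  by rewrite big_ord1 mulr1.
rewrite [X in psum _ _ X]E.
by apply: (@psum_poly (fun k => if k is 0%N then a else 0)); case.
Qed.

Lemma an_id rho : an rho (fun z => z).
Proof.
exists (fun k => (k == 1%N)%:R) => z _.
have {2}-> : z = \sum_(k < 2) ((k : nat) == 1%N)%:R * z ^+ k.
  by rewrite !big_ord_recl big_ord0 mul0r mul1r add0r addr0.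
by apply: (@psum_poly (fun k => (k == 1%N)%:R)); case=> [|[|k]].
Qed.

Lemma an_sum rho (I : Type) (r : seq I) (P : pred I) (f : I -> C -> C) :
  (forall i, P i -> an rho (f i)) -> an rho (fun z => \sum_(i <- r | P i) f i z).
Proof.
move=> fa; elim: r => [|i r IH].
  by have [b hb] := an_cst rho 0; exists b => z /hb; rewrite big_nil.
case: (boolP (P i)) => Pi; last first.
  by have [b hb] := IH; exists b => z /hb; rewrite big_cons (negPf Pi).
by have [b hb] := anD (fa i Pi) IH; exists b => z /hb; rewrite big_cons Pi.
Qed.

Lemma an_ext rho f g : (forall z, w z < rho -> f z = g z) -> an rho f -> an rho g.
Proof. by move=> fg [b fb]; exists b => z zr; rewrite -fg //; exact: fb. Qed.

(** Geometric series in [- z / x], convergent because [|z| < rho <= |x|]. It serves to expand the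
    inverse linear factors of rational functions. *)
Lemma an_inv rho x : 0 < rho -> rho <= w x -> an rho (fun z => (x + z)^-1).
Proof.
move=> rho0 rx; have wx0 := lt_le_trans rho0 rx.
have x0 : x != 0 by rewrite -(uabs_gt0 w).
exists (fun k => (-1) ^+ k / x ^+ k.+1) => z zr.
have zx : w z < w x := lt_le_trans zr rx.
have xz0 : x + z != 0.
  rewrite addr_eq0; apply: contraTneq zx => ->.
  by rewrite uabsN ltxx.
have S N : \sum_(k < N) (-1) ^+ k / x ^+ k.+1 * z ^+ k
    = (x + z)^-1 - (x + z)^-1 * (- z / x) ^+ N.
  elim: N => [|N IH]; first by rewrite big_ord0 expr0 mulr1 subrr.
  have xN0 : x ^+ N != 0 by rewrite expf_neq0.
  have E : (- z / x) ^+ N = (-1) ^+ N * z ^+ N / x ^+ N.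
    by rewrite exprMn exprVn -exprNn.
  rewrite big_ord_recr /= IH !exprS E.
  by field; rewrite ?x0 ?xz0 ?xN0.
have q1 : w z / w x < 1 by rewrite ltr_pdivrMr // mul1r.
have q0 : 0 <= w z / w x by rewrite divr_ge0 ?uabs_ge0.
rewrite -[(x + z)^-1]subr0; apply: wlim_ext (fun N => esym (S N)) _.
apply: wlimB; first exact: wlim_cst.
rewrite -(mulr0 (x + z)^-1); apply: wlimZ; apply/wlim_seqP.
have := @cvg_expr R (w z / w x); rewrite ger0_norm // => /(_ q1).
apply: cvg_trans; apply: near_eq_cvg; apply: filterE => n.
by rewrite subr0 uabsX uabsM uabsN uabsV.
Qed.

Hypothesis w_nontriv : forall e, 0 < e -> exists h, 0 < w h < e.

#[local] Instance dn0P : ProperFilter (dn0 w).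
Proof. exact: dn0_proper. Qed.

(** The first nonzero term dominates near [0]. *)
Lemma ps_ident rho g b : 0 < rho -> ps rho g b ->
  (forall e, 0 < e -> exists2 z, 0 < w z < e & g z = 0) -> forall k, b k = 0.
Proof.
move=> rho0 gb zer; elim/ltn_ind => k IH; apply/eqP/negPn/negP => bk0.
have [z0 /andP[r0 z0r] _] := zer rho rho0.
have [B B0 hB] := psum_bound (gb z0 z0r); set r := w z0 in r0 hB.
have bk : 0 < w (b k) by rewrite uabs_gt0.
have e0 : 0 < Num.min r (w (b k) * r ^+ k.+1 / B).
  by rewrite lt_min r0 divr_gt0 ?mulr_gt0 ?exprn_gt0.
have [z /andP[z_gt0]] := zer _ e0; rewrite lt_min => /andP[zr].
rewrite ltr_pdivlMr // => zlt gz.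
have q0 : 0 <= w z / r by rewrite divr_ge0 ?uabs_ge0 // ltW.
have q1 : w z / r <= 1 by rewrite ler_pdivrMr // mul1r ltW.
have : w (g z - \sum_(j < k.+1) b j * z ^+ j) <= B * (w z / r) ^+ k.+1.
  apply: psum_tail (gb z (lt_trans zr z0r)) _ _.
    by rewrite mulr_ge0 ?exprn_ge0 // ltW.
  move=> j kj; rewrite uabsM uabsX.
  have -> : w (b j) * w z ^+ j = w (b j) * r ^+ j * (w z / r) ^+ j.
    by rewrite -mulrA -exprMn mulrCA divff ?lt0r_neq0 // mulr1.
  have rj0 : 0 <= w (b j) * r ^+ j by rewrite mulr_ge0 ?uabs_ge0 ?exprn_ge0 ?ltW.
  by rewrite ler_pM ?exprn_ge0 ?ler_wiXn2l.
rewrite big_ord_recr big1 /= => [|j _]; last by rewrite IH // mul0r.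
rewrite gz sub0r add0r uabsN uabsM uabsX leNgt => /negP; apply.
rewrite expr_div_n mulrA ltr_pdivrMr ?exprn_gt0 // exprS.
have -> : B * (w z * w z ^+ k) = w z * B * w z ^+ k by ring.
have -> : w (b k) * w z ^+ k * r ^+ k.+1 = w (b k) * r ^+ k.+1 * w z ^+ k by ring.
by rewrite ltr_pM2r // exprn_gt0.
Qed.

Lemma ps_uniq rho g b c : 0 < rho -> ps rho g b -> ps rho g c -> b =1 c.
Proof.
move=> rho0 gb gc k; apply/eqP; rewrite -subr_eq0; apply/eqP.
apply: (@ps_ident rho (fun z => g z - g z) (fun k => b k - c k)) => // [z zr|e e0].
  by apply: psumB; [exact: gb|exact: gc].
by have [h he] := w_nontriv e0; exists h; rewrite ?subrr.
Qed.

Lemma psum0 b : psum b 0 (b 0%N).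
Proof.
apply/wlim_unshift; apply: wlim_ext (wlim_cst w (b 0%N)) => N.
by rewrite big_ord_recl mulr1 big1 ?addr0 // => k _; rewrite exprS mul0r mulr0.
Qed.

Lemma ps_coef0 rho g b : 0 < rho -> ps rho g b -> b 0%N = g 0.
Proof. by move=> r0 gb; apply: psum_uniq (psum0 b) (gb 0 _); rewrite uabs0. Qed.

Lemma an_ident0 rho g : 0 < rho -> an rho g ->
  (forall e, 0 < e -> exists2 z, 0 < w z < e & g z = 0) ->
  forall z, w z < rho -> g z = 0.
Proof.
move=> rho0 [b gb] zer z zr; have b0 := ps_ident rho0 gb zer.
have := @psum_poly b z 0 (fun k _ => b0 k); rewrite big_ord0.
exact: psum_uniq (gb z zr).
Qed.

(** The remainder bound is [|E| <= m^(k-2)], multiplied out so that it also covers [m = 0] and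
    [k < 2], where the construction gives [E = 0]. *)
Lemma exprD_taylor z h k : exists2 E,
  (z + h) ^+ k = z ^+ k + h * (z ^+ k.-1 *+ k) + h ^+ 2 * E
  & forall m, w z <= m -> w h <= m -> w E * m ^+ 2 <= m ^+ k.
Proof.
elim: k => [|k [E Ek hE]].
  exists 0; first by rewrite mulr0n !mulr0 !addr0.
  by move=> m _ _; rewrite uabs0 mul0r.
exists ((z + h) * E + z ^+ k.-1 *+ k) => [|m zm hm].
  rewrite exprS Ek /=; have -> : z ^+ k *+ k.+1 = z ^+ k + z * (z ^+ k.-1 *+ k).
    by case: k {Ek hE} => [|k]; rewrite ?mulr0 ?addr0 // mulrS mulrnAr -exprS.
  by rewrite !exprS; set a := z ^+ _ *+ _; set d := z ^+ k; ring.
have m0 : 0 <= m := le_trans (uabs_ge0 _ _) zm.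
have [->|m_neq0] := eqVneq m 0; first by rewrite expr0n mulr0 exprn_ge0.
have {}m0 : 0 < m by rewrite lt_neqAle eq_sym m_neq0.
rewrite -ler_pdivlMr ?exprn_gt0 //; apply: uabs_add_le.
  rewrite ler_pdivlMr ?exprn_gt0 // uabsM -mulrA [m ^+ k.+1]exprS.
  by rewrite ler_pM ?mulr_ge0 ?exprn_ge0 ?uabs_ge0 ?(ltW m0) ?uabs_add_le ?hE.
case: k {Ek hE} => [|k]; first by rewrite uabs0 divr_ge0 ?exprn_ge0 ?ltW.
rewrite ler_pdivlMr ?exprn_gt0 //= -[X in _ <= m ^+ X]addn2 exprD.
rewrite ler_wpM2r ?exprn_ge0 ?(ltW m0) //.
by apply: uabs_mulrn_le; rewrite uabsX lerXn2r ?nnegrE ?uabs_ge0 ?(ltW m0).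
Qed.

(** Difference quotients are compared with partial sums of the derived series, not with its sum,
    whose existence is not known beforehand; both directions of [ps_deriv] follow. *)
Lemma ps_diffquot rho g b z : 0 < rho -> ps rho g b -> w z < rho ->
  forall e, 0 < e -> exists N, forall n, (N <= n)%N ->
    dn0 w [set h | w ((g (z + h) - g z) / h - \sum_(k < n) b k * (z ^+ k.-1 *+ k)) <= e].
Proof.
move=> rho0 gb zr e e0; have [h0 /andP[h0_gt0 h0r]] := w_nontriv rho0.
(* [h0] keeps [m] positive when [z = 0]. As [m] is the absolute value of a point [t] of convergence,
   [|b k| m^k] is bounded and tends to 0. *)
pose m := Num.max (w z) (w h0).
have [t [wt tr]] : exists t, w t = m /\ w t < rho.
  by rewrite /m; case: leP => _; [exists h0|exists z].
have m0 : 0 < m by rewrite lt_max h0_gt0 orbT.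
have [B B0 hB] := psum_bound (gb t tr).
have [N hN] := psum_small (gb t tr) (mulr_gt0 e0 m0).
rewrite wt in hB hN tr; exists N => n Nn.
exists (Num.min m (e * m ^+ 2 / B)).
  by rewrite lt_min m0 divr_gt0 ?mulr_gt0 ?exprn_gt0.
move=> h /andP[h_gt0]; rewrite lt_min ltr_pdivlMr // => /andP[hm hB'] /=.
have hr : w h < rho := lt_trans hm tr.
have h_neq0 : h != 0 by rewrite -(uabs_gt0 w).
have zhr : w (z + h) < rho by rewrite uabs_add_lt.
pose proof (wlimM (wlimB (gb _ zhr) (gb _ zr)) (wlim_cst w h^-1)) as lim.
apply: wlim_le lim (ltW e0) _; exists n => // M /= nM.
rewrite -sumrB mulr_suml.
have -> : \sum_(k < n) b k * (z ^+ k.-1 *+ k) =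
    \sum_(k < M) (if (k < n)%N then b k * (z ^+ k.-1 *+ k) else 0).
  by rewrite -big_mkcond /= (big_ord_widen _ (fun k => b k * (z ^+ k.-1 *+ k)) nM).
rewrite -sumrB; apply: uabs_sum_le => [|k _]; first exact: ltW.
have [E -> hE] := exprD_taylor z h k.
have {}hE : w E * m ^+ 2 <= m ^+ k by rewrite hE ?(ltW hm) // le_max lexx.
have -> : (b k * (z ^+ k + h * (z ^+ k.-1 *+ k) + h ^+ 2 * E) - b k * z ^+ k) / h =
  b k * (z ^+ k.-1 *+ k + h * E) by field.
case: ltnP => kn.
  rewrite -mulrBr addrAC subrr add0r -[_ <= e](ler_pM2r (exprn_gt0 2 m0)).
  apply: le_trans (ltW hB'); rewrite !uabsM mulrA [w (b k) * _]mulrC -!mulrA.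
  rewrite ler_wpM2l ?uabs_ge0 //; apply: le_trans (hB k).
  by rewrite ler_wpM2l ?uabs_ge0.
rewrite subr0 -[_ <= e](ler_pM2r m0); apply: le_trans (ltW (hN k (leq_trans Nn kn))).
rewrite uabsM -mulrA ler_wpM2l ?uabs_ge0 // -ler_pdivlMr //.
apply: uabs_add_le; rewrite ler_pdivlMr //.
  move: kn {hE}; case: (nat_of_ord k) => [|k'] _; first by rewrite uabs0 mul0r exprn_ge0 // ltW.
  rewrite exprSr ler_wpM2r ?(ltW m0) //; apply: uabs_mulrn_le.
  by rewrite uabsX lerXn2r ?nnegrE ?uabs_ge0 ?(ltW m0) // le_max lexx.
apply: le_trans hE; rewrite uabsM mulrAC mulrC expr2.
by rewrite ler_wpM2l ?uabs_ge0 // ler_wpM2r ?(ltW m0) // ltW.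
Qed.

Lemma deriv_partial_sum b z n :
  \sum_(k < n.+1) b k * (z ^+ k.-1 *+ k) = \sum_(k < n) b k.+1 *+ k.+1 * z ^+ k.
Proof.
rewrite big_ord_recl mulr0n mulr0 add0r; apply: eq_bigr => k _.
by rewrite mulrnAr mulrnAl.
Qed.

Lemma ps_deriv rho g b z d : 0 < rho -> ps rho g b -> w z < rho ->
  has_deriv w g z d <-> psum (fun k => b k.+1 *+ k.+1) z d.
Proof.
move=> rho0 gb zr; split=> [gd|bd].
  apply/wlim_seqE => e e0; have e20 := divr_gt0 e0 (ltr0n R 2).
  have le_e : e / 2 < e by rewrite ltr_pdivrMr // ltr_pMr // ltr1n.
  have [N hN] := ps_diffquot rho0 gb zr e20; exists N => n Nn.
  apply: le_lt_trans le_e; rewrite -deriv_partial_sum uabs_subC.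
  by apply: wlim_le gd (ltW e20) _; exact: (hN _ (leqW Nn)).
move=> e e0; have e20 := divr_gt0 e0 (ltr0n R 2).
have le_e : e / 2 < e by rewrite ltr_pdivrMr // ltr_pMr // ltr1n.
have [N hN] := ps_diffquot rho0 gb zr e20.
have [M hM] := (iffLR (wlim_seqE _ _ _) bd) _ e0.
have := hN (maxn N M).+1 (leqW (leq_maxl _ _)); apply: filterS => h /= hh.
rewrite -(subrKA (\sum_(k < (maxn N M).+1) b k * (z ^+ k.-1 *+ k))).
rewrite uabs_add_lt // ?(le_lt_trans hh) // deriv_partial_sum.
by rewrite hM // leq_maxr.
Qed.

Lemma an_deriv rho g g' : 0 < rho -> (forall z, w z < rho -> has_deriv w g z (g' z)) ->
  forall b, ps rho g b -> ps rho g' (fun k => b k.+1 *+ k.+1).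
Proof. by move=> rho0 gd b gb z zr; apply/(ps_deriv _ rho0 gb zr)/gd. Qed.

(** The convergence of the new coefficients is a hypothesis because it is not automatic in a field
    that is not complete. The rest is an exchange of finite sums: the terms [k < n] cancel by the
    binomial formula, the others are at most [|b k| m^k] with [m = max(|s|, |t|)]. *)
Lemma ps_recenter rho g b s : ps rho g b -> w s < rho ->
  (forall j, exists l, wlim w \oo
     (fun M => \sum_(k < M) b k * (s ^+ (k - j) *+ 'C(k, j))) l) ->
  an rho (fun t => g (s + t)).
Proof.
move=> gb sr /choice[b' hb']; exists b' => t tr.
pose m := Num.max (w s) (w t).
have [u [wu ur]] : exists u, w u = m /\ w u < rho.
  by rewrite /m; case: leP => _; [exists t|exists s].
have str : w (s + t) < rho by rewrite uabs_add_lt.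
apply/wlim_seqE => e e0; have e20 := divr_gt0 e0 (ltr0n R 2).
have le_e : e / 2 < e by rewrite ltr_pdivrMr // ltr_pMr // ltr1n.
have [N hN] := psum_small (gb u ur) e20; rewrite wu in hN.
exists N => n Nn; apply: le_lt_trans le_e.
pose proof (wlimB (wlim_sum (index_enum 'I_n) (fun j (_ : true) => wlimM (hb' j)
  (wlim_cst w (t ^+ j)))) (gb _ str)) as lim.
rewrite -[X in w X]subr0; apply: wlim_le lim (ltW e20) _; exists n => // M /= nM.
under eq_bigr do rewrite mulr_suml.
rewrite exchange_big /= -sumrB subr0; apply: uabs_sum_le => [|k _]; first exact: ltW.
have -> : \sum_(i < n) b k * (s ^+ (k - i) *+ 'C(k, i)) * t ^+ i =
    b k * \sum_(i < n) s ^+ (k - i) * t ^+ i *+ 'C(k, i).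
  by rewrite mulr_sumr; apply: eq_bigr => i _; rewrite -mulrA mulrnAl.
rewrite -mulrBr exprDn; have [kn|nk] := ltnP k n.
  rewrite (big_ord_widen _ (fun i => s ^+ (k - i) * t ^+ i *+ 'C(k, i)) kn) /=.
  rewrite [X in X - _](bigID (fun i : 'I_n => (i < k.+1)%N)) /= addrAC subrr add0r.
  rewrite big1 ?mulr0 ?uabs0 ?(ltW e20) // => i; rewrite -leqNgt => ki.
  by rewrite bin_small.
apply: le_trans (ltW (hN k (leq_trans Nn nk))); rewrite uabsM.
have m0 : 0 <= m by rewrite le_max uabs_ge0.
rewrite ler_wpM2l ?uabs_ge0 //.
have bnd i : (i <= k)%N -> w (s ^+ (k - i) * t ^+ i *+ 'C(k, i)) <= m ^+ k.
  move=> ik; apply: uabs_mulrn_le; rewrite uabsM !uabsX -[in X in _ <= X](subnK ik) exprD.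
  by rewrite ler_pM ?exprn_ge0 ?uabs_ge0 // lerXn2r ?nnegrE ?uabs_ge0 // le_max lexx ?orbT.
apply: uabs_sub_le; apply: uabs_sum_le; rewrite ?exprn_ge0 // => i _; apply: bnd.
  exact: ltnW (leq_trans (ltn_ord i) nk).
by rewrite -ltnS.
Qed.

(** For [s != 0] and [k >= j] the term is at most [|b k s^k| / |s|^j]; for [s = 0] only the term
    [k = j] can survive. *)
Lemma psum_recenter_small b s z j : psum b s z ->
  wlim w \oo (fun k => b k * (s ^+ (k - j) *+ 'C(k, j))) 0.
Proof.
move=> bs; apply/wlim_seqE => e e0; have [->|s0] := eqVneq s 0.
  exists j.+1 => k jk; rewrite expr0n subn_eq0 leqNgt jk mul0rn mulr0 subrr.
  by rewrite uabs0.
have ws0 : 0 < w s ^+ j by rewrite exprn_gt0 // uabs_gt0.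
have [N hN] := psum_small bs (mulr_gt0 e0 ws0); exists (maxn N j) => k.
rewrite geq_max => /andP[/hN hk jk]; rewrite subr0 -(ltr_pM2r ws0).
apply: le_lt_trans hk; rewrite uabsM -mulrA ler_wpM2l ?uabs_ge0 //.
rewrite -[in X in _ <= X](subnK jk) exprD ler_wpM2r ?(ltW ws0) //.
by apply: uabs_mulrn_le; rewrite uabsX.
Qed.

Hypothesis w_prim_root : forall k, exists (m : nat) (zeta : C),
  [/\ (k < m)%N, m.-primitive_root zeta & w m%:R = 1].

(** Averaging over the [m]-th roots of unity kills the terms of exponent not
    congruent to [k] modulo [m]. *)
Lemma cauchy_estimate rho g b z B : 0 <= B -> ps rho g b -> w z < rho ->
  (forall u, w u = w z -> w (g u) <= B) -> forall k, w (b k * z ^+ k) <= B.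
Proof.
move=> B0 gb zr gB k; apply/ler_addgt0Pr => e e0.
have [N hN] := psum_small (gb z zr) e0.
have [m [zeta [km zetaP m1]]] := w_prim_root (maxn k N).
have [{}km Nm] : (k < m)%N /\ (N <= m)%N.
  by move: km; rewrite gtn_max => /andP[-> /ltnW].
have m0 : (0 < m)%N := leq_ltn_trans (leq0n _) km.
have wz1 : w zeta = 1.
  apply/eqP; rewrite -(pexpr_eq1 m0 (uabs_ge0 _ _)).
  by rewrite -uabsX (prim_expr_order zetaP) uabs1.
have wzX i : w (zeta ^+ i * z) = w z by rewrite uabsM uabsX wz1 expr1n mul1r.
pose G := \sum_(i < m) zeta ^+ (i * (m - k)) * g (zeta ^+ i * z).
have GB : w G <= B.
  apply: uabs_sum_le => // i _; rewrite uabsM uabsX wz1 expr1n mul1r gB //.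
have GL : wlim w \oo (fun M => \sum_(i < m) zeta ^+ (i * (m - k)) *
    \sum_(j < M) b j * (zeta ^+ i * z) ^+ j) G.
  by apply: wlim_sum => i _; apply: wlimZ; apply: gb; rewrite wzX.
pose D j := \sum_(i < m) (zeta ^+ (j + (m - k))) ^+ i.
have D0 j : ~~ (m %| j + (m - k))%N -> D j = 0.
  move=> jm; have z1 : zeta ^+ (j + (m - k)) != 1 by rewrite -(prim_order_dvd zetaP).
  apply/eqP; rewrite -(inj_eq (mulfI (_ : 1 - zeta ^+ (j + (m - k)) != 0))); last first.
    by rewrite subr_eq0 eq_sym.
  have := subrXX 1 (zeta ^+ (j + (m - k))) m.
  rewrite expr1n -exprM mulnC exprM (prim_expr_order zetaP) expr1n subrr mulr0 => ->.
  by apply/eqP; congr (_ * _); apply: eq_bigr => i _; rewrite expr1n mul1r.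
have Dk : D k = m%:R.
  rewrite /D subnKC ?(ltnW km) // (prim_expr_order zetaP).
  by under eq_bigr do rewrite expr1n; rewrite sumr_const card_ord.
have DB j : w (D j) <= 1.
  by apply: uabs_sum_le => // i _; rewrite !uabsX wz1 !expr1n.
have key : w (G - m%:R * (b k * z ^+ k)) <= e.
  apply: wlim_le GL (ltW e0) _; exists k.+1 => // M /= kM.
  under eq_bigr do rewrite mulr_sumr.
  rewrite exchange_big /= (bigD1 (Ordinal kM)) //= addrAC.
  have T j : \sum_(i < m) zeta ^+ (i * (m - k)) * (b j * (zeta ^+ i * z) ^+ j)
      = D j * (b j * z ^+ j).
    rewrite mulr_suml; apply: eq_bigr => i _; rewrite exprMn -!exprM.
    by rewrite mulnDl exprD [(j * i)%N]mulnC [((m - k) * i)%N]mulnC; ring.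
  rewrite T Dk subrr add0r; apply: uabs_sum_le => [|j jk]; first exact: ltW.
  rewrite T; have [jm|mj] := ltnP j m.
    rewrite D0 ?mul0r ?uabs0 ?ltW //; apply/negP => /dvdnP[a aP].
    have : j = k :> nat.
      case: a aP => [|[|a]] aP; [lia|lia|].
      have : (2 * m <= a.+2 * m)%N by rewrite leq_mul2r orbT.
      by rewrite -aP; lia.
    by move=> jk'; case/eqP: jk; apply: val_inj.
  rewrite uabsM -[e]mul1r ler_pM ?uabs_ge0 // uabsM uabsX ltW // hN //.
  exact: leq_trans Nm mj.
have -> : w (b k * z ^+ k) = w (m%:R * (b k * z ^+ k)) by rewrite [RHS]uabsM m1 mul1r.
rewrite -[m%:R * _]subr0 -(subrKA G) subr0 uabs_add_le //.
  by rewrite uabs_subC (le_trans key) // lerDr.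
by rewrite (le_trans GB) // lerDl ltW.
Qed.

End PowerSeries.

(** [X^m - 1] is separable as [m] is nonzero in [F], so it has [m] distinct roots, one of which is
    then primitive. *)
Lemma exists_prim_root (F : closedFieldType) m : (0 < m)%N -> m%:R != 0 :> F ->
  exists zeta : F, m.-primitive_root zeta.
Proof.
move=> m0 mF; have [s Ds] := closed_field_poly_normal ('X^m - 1 : {poly F}).
rewrite (monicP _) ?monicXnsubC // scale1r in Ds.
have s1 : all m.-unity_root s by apply/allP=> z; rewrite -root_prod_XsubC -Ds.
have sz : (m <= size s)%N.
  by rewrite -ltnS -(size_prod_XsubC s id) -Ds size_XnsubC.
have us : uniq s by rewrite -separable_prod_XsubC -Ds separable_Xn_sub_1.
by have /hasP[z _ zP] := has_prim_root m0 s1 us sz; exists z.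
Qed.

Lemma expr_lt_small (R : realType) (x e : R) : 0 <= x -> x < 1 -> 0 < e ->
  exists n, x ^+ n < e.
Proof.
move=> x0 x1 e0; have : `|x| < 1 by rewrite ger0_norm.
move=> /cvg_expr /cvgrPdist_lt /(_ e e0)[N _ /(_ N (leqnn N))] /=.
by rewrite sub0r normrN ger0_norm ?exprn_ge0 // => h; exists N.
Qed.

Lemma harmonic_lt_small (R : realType) (e : R) : 0 < e ->
  exists N, forall n, (N <= n)%N -> n.+1%:R^-1 < e.
Proof.
move=> e0; have /cvgrPdist_lt /(_ e e0)[N _ hN] := @cvg_harmonic R.
exists N => n /hN /=; rewrite sub0r normrN ger0_norm ?invr_ge0 //.
Qed.

(** * Values of [w] and finite-dimensional [K]-subspaces of [K^alg] *)

Section MixedChar.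
Variables (R : realType) (p : nat) (K : fieldType) (v : ultrabs R K).
Hypotheses (v_complete : complete_abs v) (v_mixed : mixed_char v p).
Variable C : alg_closure v.
Local Notation w := (ac_abs C).
Local Notation iota := (ac_inj C).
Local Notation "P ^L" := (map_poly iota P) (at level 2, format "P ^L").

Lemma natf_neq0_mixed n : (0 < n)%N -> n%:R != 0 :> C.
Proof.
move=> n0; case: v_mixed => _ /pcharf0P charK _.
by rewrite -(rmorph_nat iota) fmorph_eq0 charK -lt0n.
Qed.

Lemma uabs_char_gt0 : 0 < w p%:R.
Proof. by case: v_mixed => /prime_gt0 p0 _ _; rewrite uabs_gt0 natf_neq0_mixed. Qed.

Lemma uabs_char_lt1 : w p%:R < 1.
Proof. by case: v_mixed => _ _; rewrite -(rmorph_nat iota) ac_extends. Qed.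

Lemma ac_nontriv (e : R) : 0 < e -> exists h : C, 0 < w h < e.
Proof.
move=> e0; have [n hn] := expr_lt_small (ltW uabs_char_gt0) uabs_char_lt1 e0.
by exists (p%:R ^+ n); rewrite uabsX hn exprn_gt0 ?uabs_char_gt0.
Qed.

Lemma ac_prim_root k : exists (m : nat) (zeta : C),
  [/\ (k < m)%N, m.-primitive_root zeta & w m%:R = 1].
Proof.
have p0 : (0 < p)%N by case: v_mixed => /prime_gt0.
have km : (k < (k * p).+1)%N by rewrite ltnS leq_pmulr.
have [zeta zetaP] := exists_prim_root (ltn0Sn (k * p)) (natf_neq0_mixed (ltn0Sn (k * p))).
(* [k p + 1] exceeds [k] and has absolute value 1, because [|k p| < 1]. *)
exists (k * p).+1, zeta; split=> //.
have kp : w (k * p)%:R < 1.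
  rewrite natrM uabsM; apply: le_lt_trans uabs_char_lt1.
  by rewrite ler_piMl ?uabs_ge0 ?uabs_nat.
apply/eqP; rewrite eq_le uabs_nat leNgt; apply/negP => lt1.
have E : 1 = (k * p).+1%:R - (k * p)%:R :> C by rewrite -natr1 addrC addKr.
by have := ltxx (1 : R); rewrite -{1}(uabs1 w) E uabs_sub_lt.
Qed.

(** The powers of an [n]-th root [h0] of [p], with [n] large, form a geometric scale of ratio close
    to 1. *)
Lemma ac_value_dense (s t : R) : 0 <= s -> s < t -> exists h : C, s < w h < t.
Proof.
move=> s0 st; have t0 : 0 < t := le_lt_trans s0 st.
have c0 : 0 <= s / t by rewrite divr_ge0 // ltW.
have c1 : s / t < 1 by rewrite ltr_pdivrMr // mul1r.
(* [(s / t)^n < |p|] gives [s / t < |h0| < 1], so no step of the scale jumps over the interval from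
   [s] to [t]. *)
have [n hn] := expr_lt_small c0 c1 uabs_char_gt0.
have n0 : (0 < n)%N.
  by case: n hn => [|//]; rewrite expr0 ltNge (ltW uabs_char_lt1).
have /closed_rootP[h0] : size ('X^n - (p%:R : C)%:P) != 1%N.
  by rewrite size_XnsubC // eqSS -lt0n.
rewrite rootE !hornerE subr_eq0 => /eqP h0n.
have wh0 : w h0 ^+ n = w p%:R by rewrite -uabsX h0n.
have q0 : 0 < w h0.
  rewrite uabs_gt0; apply/eqP => h00; have := uabs_char_gt0.
  by rewrite -wh0 h00 uabs0 expr0n eqn0Ngt n0 ltxx.
have q1 : w h0 < 1.
  rewrite ltNge; apply/negP => /(@exprn_ege1 _ n).
  by rewrite wh0 leNgt uabs_char_lt1.
have cq : s / t < w h0.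
  rewrite ltNge; apply/negP => qc; have := hn; rewrite -wh0 ltNge.
  by rewrite lerXn2r ?nnegrE ?(ltW q0).
have tV0 : 0 < t^-1 by rewrite invr_gt0.
(* Dividing by [h0^j] starts the scale above [t]; the first power below [t] then has a
   predecessor. *)
have [j hj] := expr_lt_small (ltW q0) q1 tV0.
have [i hi] := expr_lt_small (ltW q0) q1 (mulr_gt0 t0 (exprn_gt0 j q0)).
have ex : exists m, w h0 ^+ m < t * w h0 ^+ j by exists i.
case: (ex_minnP ex) => m hm mmin.
have tj : t * w h0 ^+ j < 1 by rewrite mulrC -ltr_pdivlMr // div1r.
case: m hm mmin => [|m] hm mmin; first by move: hm; rewrite expr0 ltNge (ltW tj).
exists (h0 ^+ m.+1 / h0 ^+ j); rewrite uabsM uabsV !uabsX.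
rewrite ltr_pdivrMr ?exprn_gt0 // hm andbT ltr_pdivlMr ?exprn_gt0 //.
have : t * w h0 ^+ j <= w h0 ^+ m.
  by rewrite leNgt; apply/negP => /mmin; rewrite ltnn.
rewrite exprS => hm'; apply: lt_le_trans (_ : w h0 * (t * w h0 ^+ j) <= _).
  by rewrite mulrA ltr_pM2r ?exprn_gt0 // -ltr_pdivrMr.
by rewrite ler_pM2l.
Qed.

(** The [K]-span of the list, unfolded one generator at a time to suit induction on the number of
    generators. *)
Fixpoint kspan (L : seq C) (u : C) : Prop :=
  if L is e :: L' then exists c : K, kspan L' (u - iota c * e) else u = 0.

Lemma kspan0 L : kspan L 0.
Proof. by elim: L => //= e L IH; exists 0; rewrite rmorph0 mul0r subr0. Qed.

Lemma kspan_comb L a u x : kspan L u -> kspan L x -> kspan L (u + iota a * x).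
Proof.
elim: L u x => [|e L IH] u x /=; first by move=> -> ->; rewrite mulr0 addr0.
move=> [c hc] [d hd]; exists (c + a * d).
have -> : u + iota a * x - iota (c + a * d) * e =
  (u - iota c * e) + iota a * (x - iota d * e) by rewrite rmorphD rmorphM; ring.
exact: IH.
Qed.

Lemma kspanZ L a u : kspan L u -> kspan L (iota a * u).
Proof. by move=> h; rewrite -[_ * u]add0r; apply: kspan_comb => //; exact: kspan0. Qed.

Lemma kspanD L u x : kspan L u -> kspan L x -> kspan L (u + x).
Proof. by move=> hu /(kspan_comb 1 hu); rewrite rmorph1 mul1r. Qed.

Lemma kspanB L u x : kspan L u -> kspan L x -> kspan L (u - x).
Proof. by move=> hu /(kspan_comb (-1) hu); rewrite rmorphN1 mulN1r. Qed.

Lemma kspan_sum L (I : Type) (s : seq I) (P : pred I) (F : I -> C) :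
  (forall i, P i -> kspan L (F i)) -> kspan L (\sum_(i <- s | P i) F i).
Proof.
by move=> h; apply: (big_ind (kspan L)); [exact: kspan0|exact: kspanD|].
Qed.

Lemma kspan_behead e L u : kspan L u -> kspan (e :: L) u.
Proof. by move=> h; exists 0; rewrite rmorph0 mul0r subr0. Qed.

Lemma kspan_mem L e : e \in L -> kspan L e.
Proof.
elim: L => [//|d L IH]; rewrite inE => /orP[/eqP ->|/IH]; last exact: kspan_behead.
by exists 1; rewrite rmorph1 mul1r subrr; exact: kspan0.
Qed.

Lemma kspanMr L M u x : kspan L u -> (forall e, e \in L -> kspan M (e * x)) ->
  kspan M (u * x).
Proof.
elim: L u => [|e L IH] u /=; first by move=> -> _; rewrite mul0r; exact: kspan0.
move=> [c hc] hL; have -> : u * x = (u - iota c * e) * x + iota c * (e * x) by ring.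
apply: kspan_comb; last by apply: hL; rewrite mem_head.
by apply: IH hc _ => d dL; apply: hL; rewrite inE dL orbT.
Qed.

Lemma kspanM L M u x : kspan L u -> kspan M x ->
  kspan [seq a * b | a <- L, b <- M] (u * x).
Proof.
move=> hu hx; apply: kspanMr hu _ => e eL; rewrite mulrC; apply: kspanMr hx _ => d dM.
by apply: kspan_mem; rewrite mulrC; apply: allpairs_f.
Qed.

Lemma complete_wlim (c : nat -> K) : wcauchy v c -> exists l, wlim v \oo c l.
Proof. by move=> /v_complete[l hl]; exists l; apply/wlim_seqP. Qed.

(** Finite-dimensional [K]-subspaces of [K^alg] are complete: this replaces the
    completeness of [K^alg], which fails. *)
Lemma kspan_complete L (u : nat -> C) : (forall n, kspan L (u n)) -> wcauchy w u ->
  exists2 l, kspan L l & wlim w \oo u l.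
Proof.
elim: L u => [|e L IH] u uL uc.
  by exists 0 => // e e0; exists 0%N => // n _ /=; rewrite uL subrr uabs0.
have [Le|nLe] := pselect (kspan L e).
  have uL' n : kspan L (u n).
    by have [c hc] := uL n; rewrite -(subrK (iota c * e) (u n)); exact: kspan_comb.
  by have [l hl ul] := IH u uL' uc; exists l => //; exact: kspan_behead.
(* The span of [L] is complete by induction, so [e], lying outside, is at positive distance from it.
   This distance controls the coordinate along [e], which is therefore Cauchy in [K]. *)
have [d d0 hd] : exists2 d : R, 0 < d & forall x, kspan L x -> d <= w (x - e).
  apply: contrapT => nd.
  have /choice[x hx] n : exists x, kspan L x /\ w (x - e) < n.+1%:R^-1.
    have n0 : 0 < n.+1%:R^-1 :> R by rewrite invr_gt0.
    apply: contrapT => nx; apply: nd; exists n.+1%:R^-1 => // x xL.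
    by rewrite leNgt; apply/negP => xe; apply: nx; exists x.
  have xe : wlim w \oo x e.
    apply/wlim_seqE => eps eps0; have [N hN] := harmonic_lt_small eps0; exists N => n Nn.
    exact: lt_trans (hx n).2 (hN n Nn).
  have [l hl xl] := IH x (fun n => (hx n).1) (wlim_cauchy xe).
  by apply: nLe; rewrite (wlim_uniq xe xl).
have [c hc] := choice uL.
have cc : wcauchy v c.
  move=> eps eps0; have [N hN] := uc _ (mulr_gt0 eps0 d0); exists N => m n Nm Nn.
  have [->|cmn] := eqVneq (c m) (c n); first by rewrite subrr uabs0.
  rewrite -(ltr_pM2r d0); apply: le_lt_trans (hN m n Nm Nn).
  pose a := c m - c n; have a0 : a != 0 by rewrite subr_eq0.
  have ia0 : iota a != 0 by rewrite fmorph_eq0.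
  have := hd _ (kspanZ (- a^-1) (kspanB (hc m) (hc n))).
  have -> : iota (- a^-1) * (u m - iota (c m) * e - (u n - iota (c n) * e)) - e =
    - (u m - u n) / iota a.
    rewrite rmorphN fmorphV; have -> : iota (c m) = iota a + iota (c n).
      by rewrite -rmorphD subrK.
    by field.
  rewrite uabsM uabsN uabsV ac_extends ler_pdivlMr ?uabs_gt0 //.
  by rewrite mulrC.
have [lc hlc] := complete_wlim cc.
have ic : wlim w \oo (fun n => iota (c n)) (iota lc).
  by move=> eps eps0; apply: filterS (hlc eps eps0) => n /=; rewrite -rmorphB ac_extends.
have yc : wcauchy w (fun n => u n - iota (c n) * e).
  move=> eps eps0; have [N hN] := uc eps eps0.
  have [M hM] := wlim_cauchy (wlimM ic (wlim_cst w e)) eps0.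
  exists (maxn N M) => m n; rewrite !geq_max => /andP[Nm Mm] /andP[Nn Mn].
  have -> : u m - iota (c m) * e - (u n - iota (c n) * e) =
     (u m - u n) - (iota (c m) * e - iota (c n) * e) by ring.
  by apply: uabs_sub_lt; [exact: hN|exact: hM].
have [l hl yl] := IH _ hc yc.
exists (l + iota lc * e); first by exists lc; rewrite addrK.
apply: wlim_ext (wlimD yl (wlimM ic (wlim_cst w e))) => n /=.
by rewrite subrK.
Qed.

Lemma kspan_closed L u :
  (forall e, 0 < e -> exists2 y, kspan L y & w (u - y) < e) -> kspan L u.
Proof.
move=> hu; have /choice[y hy] n : exists y, kspan L y /\ w (u - y) < n.+1%:R^-1.
  have [|y h1 h2] := hu n.+1%:R^-1; first by rewrite invr_gt0.
  by exists y.
have yu : wlim w \oo y u.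
  apply/wlim_seqE => e e0; have [N hN] := harmonic_lt_small e0; exists N => n Nn.
  by rewrite uabs_subC; exact: lt_trans (hy n).2 (hN n Nn).
have [l hl yl] := kspan_complete (fun n => (hy n).1) (wlim_cauchy yu).
by rewrite (wlim_uniq yu yl).
Qed.

Lemma kspan_poly_eval (x : C) (P0 : {poly K}) : P0 != 0 -> root P0^L x ->
  forall P : {poly K}, kspan [seq x ^+ i | i <- index_iota 0 (size P0)] P^L.[x].
Proof.
move=> P00 /rootP rP0 P; rewrite {1}(divp_eq P P0) rmorphD rmorphM /= hornerD hornerM.
rewrite rP0 mulr0 add0r (@horner_coef_wide _ (size P0)); last first.
  by rewrite size_map_poly ltnW // ltn_modp.
apply: kspan_sum => i _; rewrite coef_map; apply: kspanZ; apply: kspan_mem.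
by apply: map_f; rewrite mem_index_iota /=.
Qed.

(** K(x) = K[x] is finite-dimensional over [K]; the point is that [L] depends on [x] alone. *)
Lemma kspan_rational (x : C) : exists L, forall P Q : {poly K}, Q^L.[x] != 0 ->
  kspan L (P^L.[x] / Q^L.[x]).
Proof.
have [P0 P00 rP0] := ac_algebraic x.
exists [seq x ^+ i | i <- index_iota 0 (size P0)] => P Q Qx.
(* [P0] may share factors with [Q]. Removing them keeps the root [x], at which [Q] does not vanish,
   and a Bezout relation then inverts Q(x) by a polynomial in [x]. *)
pose P1 := gdcop Q P0.
have rP1 : root P1^L x.
  by rewrite gdcop_map root_gdco ?map_poly_eq0 // rP0 /root Qx.
have /Bezout_coprimepP[[a b] /= /eqpP[[c d] /= /andP[c0 d0]]] : coprimep P1 Q.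
  exact: coprimep_gdco.
move=> E; have {}E : iota c * (b^L.[x] * Q^L.[x]) = iota d.
  have := congr1 (fun q => q^L.[x]) E.
  rewrite /= !map_polyZ rmorphD !rmorphM rmorph1 /= !hornerE (rootP rP1).
  by rewrite mulr0 add0r mulrA.
have ic0 : iota c != 0 by rewrite fmorph_eq0.
have id0 : iota d != 0 by rewrite fmorph_eq0.
have -> : P^L.[x] / Q^L.[x] = ((c / d) *: (P * b))^L.[x].
  rewrite map_polyZ hornerZ fmorph_div [(P * b)^L]rmorphM hornerM /=.
  have bx : b^L.[x] != 0.
    by apply: contra_neq id0 => b0; rewrite -E b0 mul0r mulr0.
  rewrite -E; move: Qx bx ic0; move: P^L.[x] Q^L.[x] b^L.[x] (iota c) => P' Q' b' c' *.
  by field; apply/and3P.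
exact: kspan_poly_eval.
Qed.

End MixedChar.

(** * Taylor expansions of analytic elements on the affinoid *)

Section AffinoidAnalysis.
Variables (R : realType) (p : nat) (K : fieldType) (v : ultrabs R K).
Hypotheses (v_complete : complete_abs v) (v_mixed : mixed_char v p).
Variables (C : alg_closure v) (X : affinoid v).
Local Notation w := (ac_abs C).
Local Notation iota := (ac_inj C).
Local Notation "P ^L" := (map_poly iota P) (at level 2, format "P ^L").
Local Notation rad := Defs.rad.
Local Notation center := Defs.center.
Local Notation points := (points C X).
Local Notation anel := (anel C X).
Local Notation rX := (min_rad X).
Implicit Types (f g : anel) (x y : points) (z h : C).

Let nt := ac_nontriv v_mixed C.
Let prim := ac_prim_root v_mixed C.
#[local] Instance dn0w : ProperFilter (dn0 w) := dn0_proper nt.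

Lemma min_rad_le i : rX <= rad X i.
Proof. exact: bigmin_le. Qed.

Lemma min_rad_gt0 : 0 < rX.
Proof. by apply: lt_bigmin => [|i _]; exact: rad_gt0. Qed.

Lemma min_rad_le_max_norm : rX <= max_norm X.
Proof. by rewrite (le_trans (min_rad_le ord0)) // le_max lexx orbT. Qed.

Lemma points_norm x : w (val x) <= max_norm X.
Proof.
rewrite -(subrK (iota (center X ord0)) (val x)); apply: le_trans (uabs_ultra _ _ _) _.
have /andP[x0 _] := valP x.
by rewrite ge_max !le_max x0 ac_extends lexx orbT.
Qed.

(** A hole has radius at least [r_X], so if it contained [x + z] it would contain [x]; the outer
    disc is stable under the same translations. *)
Lemma affinoid_mem_add x z : w z < rX -> affinoid_mem X (val x + z).
Proof.
move=> zr; have /andP[x0 /forallP xi] := valP x; apply/andP; split.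
  by rewrite addrAC uabs_add_le // (le_trans (ltW zr)) // min_rad_le.
apply/forallP => i; apply/implyP => i0; rewrite leNgt; apply/negP => lti.
have := implyP (xi i) i0; rewrite leNgt => /negP; apply.
have -> : val x - iota (center X i) = (val x + z - iota (center X i)) - z by ring.
by rewrite uabs_sub_lt // (lt_le_trans zr) // min_rad_le.
Qed.

(** The default [x] is returned only when [x + z] leaves [X], hence never for [|z| < r_X]; totality
    turns a function on [X] into one on [C]. *)
Definition pshift x z : points := insubd x (val x + z).

Lemma val_pshift x z : w z < rX -> val (pshift x z) = val x + z.
Proof. by move=> zr; rewrite insubdK //; exact: affinoid_mem_add. Qed.

Lemma pshift_sub x y : pshift x (val y - val x) = y.
Proof.
by apply: val_inj; rewrite /pshift addrC subrK insubdK //; exact: (valP y).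
Qed.

Lemma pshift0 x : pshift x 0 = x.
Proof. by rewrite -[X in pshift _ X](subrr (val x)) pshift_sub. Qed.

Lemma pshiftD x z h : w z < rX -> w h < rX -> pshift (pshift x z) h = pshift x (z + h).
Proof.
move=> zr hr; apply: val_inj; rewrite !val_pshift ?addrA //.
by rewrite uabs_add_lt.
Qed.

(** Differentiation in the chart [z |-> x + z], to which the results on power series apply;
    [pderivP] identifies it with the condition defining [deriv_anel]. *)
Definition pderiv (f : points -> C) x (d : C) : Prop :=
  has_deriv w (fun z => f (pshift x z)) 0 d.

Lemma pderivP (f : points -> C) x d : pderiv f x d <->
  forall e : R, 0 < e -> exists2 dl : R, 0 < dl & forall y,
    0 < w (val y - val x) < dl -> w ((f y - f x) / (val y - val x) - d) < e.
Proof.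
split=> fd e e0.
  have [dl dl0 hd] := fd e e0; exists dl => // y /hd /=.
  by rewrite add0r pshift_sub pshift0.
have [dl dl0 hd] := fd e e0; exists (Num.min dl rX).
  by rewrite lt_min dl0 min_rad_gt0.
move=> h /andP[h0]; rewrite lt_min => /andP[hdl hr] /=.
have E : val (pshift x h) - val x = h by rewrite val_pshift // addrAC subrr add0r.
by have := hd (pshift x h); rewrite E add0r pshift0; apply; rewrite h0.
Qed.

Lemma pderiv_uniq (f : points -> C) x d d' : pderiv f x d -> pderiv f x d' -> d = d'.
Proof. exact: wlim_uniq. Qed.

Lemma pderiv_shift (f : points -> C) y z d : w z < rX ->
  pderiv f (pshift y z) d <-> has_deriv w (fun t => f (pshift y t)) z d.
Proof.
move=> zr; have E : dn0 w [set h | f (pshift (pshift y z) (0 + h)) = f (pshift y (z + h))].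
  apply: filterS (dn0_lt w min_rad_gt0) => h /= hr.
  by rewrite add0r pshiftD.
split; rewrite /pderiv /has_deriv pshift0; apply: wlim_near.
  by apply: filterS E => h /= ->; rewrite ?add0r.
by apply: filterS E => h /= ->; rewrite ?add0r.
Qed.

Lemma pderiv_ps rho (f : points -> C) y b : 0 < rho ->
  ps w rho (fun z => f (pshift y z)) b -> pderiv f y (b 1%N).
Proof.
move=> rho0 fb; have r0 : w 0 < rho by rewrite uabs0.
apply/(ps_deriv nt _ rho0 fb r0).
by have := psum0 w (fun k => b k.+1 *+ k.+1); rewrite mulr1n.
Qed.

Lemma an_horner (P : {poly C}) a rho : an w rho (fun z => P.[a + z]).
Proof.
elim/poly_ind: P => [|P c IH].
  by apply: an_ext (an_cst w rho 0) => z _; rewrite horner0.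
have h := anD (anM IH (anD (an_cst w rho a) (an_id w rho))) (an_cst w rho c).
by apply: an_ext h => z _; rewrite !hornerE.
Qed.

(** [Q] splits, and each inverse linear factor is a geometric series, since a root at distance less
    than [r_X] from [y] would be a point of [X]. *)
Lemma an_hornerV (Q : {poly C}) y : (forall x, Q.[val x] != 0) ->
  an w rX (fun z => (Q.[val y + z])^-1).
Proof.
have [s ->] := closed_field_poly_normal Q.
move=> Q0; have l0 : lead_coef Q != 0.
  by apply: contraNneq (Q0 y) => ->; rewrite scale0r horner0.
have sX a : a \in s -> rX <= w (val y - a).
  move=> sa; rewrite leNgt; apply/negP => ya.
  have := Q0 (pshift y (a - val y)); rewrite val_pshift 1?uabs_subC // addrC subrK.
  rewrite hornerZ horner_prod mulf_eq0 negb_or l0 /= prodf_seq_neq0.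
  by move=> /allP /(_ a sa); rewrite !hornerE subrr eqxx.
clear Q0 l0.
have h : an w rX (fun z => (\prod_(a <- s) ('X - a%:P)).[val y + z]^-1).
  elim: s sX => [|a s IH] sX.
    by apply: an_ext (an_cst w rX 1) => z _; rewrite big_nil hornerE invr1.
  have h1 := an_inv min_rad_gt0 (sX a (mem_head _ _)).
  have h2 : an w rX (fun z => (\prod_(a <- s) ('X - a%:P)).[val y + z]^-1).
    by apply: IH => b bs; apply: sX; rewrite inE bs orbT.
  apply: an_ext (anM h1 h2) => z _; rewrite big_cons hornerM invfM !hornerE.
  by rewrite addrAC.
apply: an_ext (anM (an_cst w rX (lead_coef Q)^-1) h) => z _.
by rewrite hornerZ invfM.
Qed.

Definition ratf (P Q : {poly K}) x : C := P^L.[val x] / Q^L.[val x].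

Lemma an_ratf P Q y : (forall x, Q^L.[val x] != 0) ->
  an w rX (fun z => ratf P Q (pshift y z)).
Proof.
move=> Q0; apply: an_ext (anM (an_horner P^L (val y) rX) (an_hornerV y Q0)) => z zr.
by rewrite /ratf val_pshift.
Qed.

Lemma has_deriv_horner (P : {poly C}) z : has_deriv w (fun t => P.[t]) z P^`().[z].
Proof.
elim/poly_ind: P => [|P c IH].
  rewrite deriv0 horner0; apply: has_deriv_near (has_deriv_cst w 0 z).
    by rewrite horner0.
  by apply: filterE => h /=; rewrite horner0.
have id1 : has_deriv w (fun t => t) z 1.
  apply: wlim_near (wlim_cst w 1); apply: filterS (dn0_neq0 w) => h /= h0.
  by rewrite addrAC subrr add0r divff.
have := has_derivD (has_derivM IH id1) (has_deriv_cst w c z).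
rewrite derivD derivM derivC derivX !hornerE; apply: has_deriv_near.
  by rewrite !hornerE.
by apply: filterE => h /=; rewrite !hornerE.
Qed.

(** The quotient rule without reduction: denominators stay free of zeros on [X], and coefficients
    stay in [K], which keeps the Taylor coefficients at [x] in K(x). *)
Definition rat_deriv (PQ : {poly K} * {poly K}) : {poly K} * {poly K} :=
  (PQ.1^`() * PQ.2 - PQ.1 * PQ.2^`(), PQ.2 * PQ.2).

Lemma rat_deriv_neq0 PQ : (forall x, PQ.2^L.[val x] != 0) ->
  forall x, (rat_deriv PQ).2^L.[val x] != 0.
Proof. by move=> h x; rewrite /= rmorphM /= hornerM; apply: mulf_neq0; exact: h. Qed.

Lemma has_deriv_rat (P Q : {poly K}) z : Q^L.[z] != 0 ->
  has_deriv w (fun t => P^L.[t] / Q^L.[t]) z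
    ((rat_deriv (P, Q)).1^L.[z] / (rat_deriv (P, Q)).2^L.[z]).
Proof.
move=> Qz.
have := has_derivM (has_deriv_horner P^L z) (has_derivV Qz (has_deriv_horner Q^L z)).
rewrite !deriv_map /rat_deriv /= rmorphB !rmorphM /= hornerD hornerN !hornerM.
congr (has_deriv _ _ _ _).
move: Qz; move: P^L.[z] Q^L.[z] P^`()^L.[z] Q^`()^L.[z] => a b a' b' b0.
by field.
Qed.

Lemma pderiv_ratf P Q x : (forall x, Q^L.[val x] != 0) ->
  pderiv (ratf P Q) x (ratf (rat_deriv (P, Q)).1 (rat_deriv (P, Q)).2 x).
Proof.
move=> Q0; apply: wlim_near (has_deriv_rat P (Q0 x)).
apply: filterS (dn0_lt w min_rad_gt0) => h /= hr.
by rewrite /ratf !add0r pshift0 !val_pshift.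
Qed.

Lemma taylor_coef (F : nat -> points -> C) y b :
  (forall k x, pderiv (F k) x (F k.+1 x)) ->
  ps w rX (fun z => F 0%N (pshift y z)) b -> forall k, b k = F k y / k`!%:R.
Proof.
move=> FS Fb k; elim: k F b FS Fb => [|k IH] F b FS Fb.
  by rewrite (ps_coef0 min_rad_gt0 Fb) pshift0 divr1.
have h : ps w rX (fun z => F 1%N (pshift y z)) (fun k => b k.+1 *+ k.+1).
  by apply: (an_deriv nt min_rad_gt0 _ Fb) => z zr; apply/pderiv_shift/FS.
have := IH (fun k => F k.+1) _ (fun k => FS k.+1) h; rewrite -[_ *+ k.+1]mulr_natr => E.
have k1 := natf_neq0_mixed v_mixed C (ltn0Sn k).
by apply: (mulIf k1); rewrite E factS natrM invfM mulrA mulrAC divfK.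
Qed.

Definition rat_iter P Q k := iter k rat_deriv (P, Q).

Lemma ratf_ps P Q y : (forall x, Q^L.[val x] != 0) ->
  ps w rX (fun z => ratf P Q (pshift y z))
    (fun k => ratf (rat_iter P Q k).1 (rat_iter P Q k).2 y / k`!%:R).
Proof.
move=> Q0; have [b hb] := an_ratf P y Q0.
have Qk k : forall x, (rat_iter P Q k).2^L.[val x] != 0.
  by elim: k => // k IH; exact: rat_deriv_neq0.
have FS k x : pderiv (ratf (rat_iter P Q k).1 (rat_iter P Q k).2) x
    (ratf (rat_iter P Q k.+1).1 (rat_iter P Q k.+1).2 x).
  rewrite /rat_iter iterS -/(rat_iter P Q k); move: (Qk k).
  by case: (rat_iter P Q k) => A B /= h; exact: pderiv_ratf.
have := taylor_coef FS hb => E z zr.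
exact: psum_ext E (hb z zr).
Qed.

(** One finite-dimensional space for all rational functions and all orders [k], so that Cauchy
    sequences of such coefficients have limits by [kspan_complete]. *)
Lemma ratf_kspan x : exists L, forall P Q k, (forall x, Q^L.[val x] != 0) ->
  kspan L (ratf (rat_iter P Q k).1 (rat_iter P Q k).2 x / k`!%:R).
Proof.
have [L hL] := kspan_rational (val x); exists L => P Q k Q0.
have Qk : forall x, (rat_iter P Q k).2^L.[val x] != 0.
  by elim: k => // k IH; exact: rat_deriv_neq0.
have -> : k`!%:R^-1 = iota k`!%:R^-1 by rewrite fmorphV rmorph_nat.
by rewrite mulrC; apply: kspanZ; exact: hL.
Qed.

Lemma anelP f : analytic_element f.
Proof. exact/asboolP/(valP f). Qed.

Lemma anel_kspan x : exists L, forall f, kspan L (f x).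
Proof.
have [L hL] := ratf_kspan x; exists L => f; apply: (kspan_closed v_complete) => e e0.
have [P [Q [Q0 fPQ]]] := anelP f e0; exists (ratf P Q x) => //.
by have := hL P Q 0%N Q0; rewrite divr1.
Qed.

Lemma point_radius : exists z : C, 0 < w z < rX.
Proof. exact/nt/min_rad_gt0. Qed.

(** The Taylor coefficients of uniform limits converge by the Cauchy estimates. *)
Lemma anel_an f y : an w rX (fun z => f (pshift y z)).
Proof.
have /choice[F hF] n : exists PQ : {poly K} * {poly K},
    (forall x, PQ.2^L.[val x] != 0) /\ forall x, w (f x - ratf PQ.1 PQ.2 x) < n.+1%:R^-1.
  have [|P [Q [Q0 fPQ]]] := anelP f (_ : 0 < n.+1%:R^-1); first by rewrite invr_gt0.
  by exists (P, Q).
pose fn n := ratf (F n).1 (F n).2.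
pose bn n k := ratf (rat_iter (F n).1 (F n).2 k).1 (rat_iter (F n).1 (F n).2 k).2 y / k`!%:R.
have psn n : ps w rX (fun z => fn n (pshift y z)) (bn n) by apply: ratf_ps; case: (hF n).
have [L hL] := ratf_kspan y.
have bL n k : kspan L (bn n k) by apply: hL; case: (hF n).
have small e : 0 < e -> exists N, forall n, (N <= n)%N -> forall x, w (f x - fn n x) < e.
  move=> e0; have [N hN] := harmonic_lt_small e0; exists N => n Nn x.
  exact: lt_trans ((hF n).2 x) (hN n Nn).
(* The Cauchy estimate bounds all coefficients of a difference at once, so the convergence is
   uniform in [k]. *)
have diff e : 0 < e -> exists N, forall m n, (N <= m)%N -> (N <= n)%N ->
    forall k z, w z < rX -> w ((bn m k - bn n k) * z ^+ k) <= e.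
  move=> e0; have [N hN] := small e e0; exists N => m n Nm Nn k z zr.
  have h : ps w rX (fun z => fn m (pshift y z) - fn n (pshift y z)) (fun k => bn m k - bn n k).
    by move=> t tr; apply: psumB; exact: psn.
  apply: (cauchy_estimate prim (ltW e0) h zr) => u _.
  rewrite -(subrKA (f (pshift y u))) ltW // uabs_add_lt ?hN //.
  by rewrite uabs_subC hN.
have [z0 /andP[z0_gt0 z0r]] := point_radius.
have bc k : wcauchy w (fun n => bn n k).
  have z0k : 0 < w z0 ^+ k by rewrite exprn_gt0.
  move=> e e0; have [N hN] := diff _ (mulr_gt0 (divr_gt0 e0 (ltr0n _ 2)) z0k).
  exists N => m n Nm Nn; have := hN m n Nm Nn k z0 z0r.
  rewrite uabsM uabsX ler_pM2r // => /le_lt_trans; apply.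
  by rewrite ltr_pdivrMr // ltr_pMr // ltr1n.
have /choice[b hb] k : exists l, wlim w \oo (fun n => bn n k) l.
  by have [l _ hl] := kspan_complete v_complete (fun n => bL n k) (bc k); exists l.
exists b => z zr; apply/wlim_seqE => e e0; have e20 := divr_gt0 e0 (ltr0n R 2).
have le_e : e / 2 < e by rewrite ltr_pdivrMr // ltr_pMr // ltr1n.
have [N1 hN1] := diff _ e20; have [N2 hN2] := small _ e20.
pose n := maxn N1 N2; have n1 : (N1 <= n)%N := leq_maxl _ _.
have [M hM] := (iffLR (wlim_seqE _ _ _) (psn n z zr)) _ e20; exists M => N NM.
apply: le_lt_trans le_e.
have -> : \sum_(k < N) b k * z ^+ k - f (pshift y z) =
    \sum_(k < N) (b k - bn n k) * z ^+ k +
    ((\sum_(k < N) bn n k * z ^+ k - fn n (pshift y z)) - (f (pshift y z) - fn n (pshift y z))).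
  have -> : \sum_(k < N) (b k - bn n k) * z ^+ k =
      \sum_(k < N) b k * z ^+ k - \sum_(k < N) bn n k * z ^+ k.
    by rewrite -sumrB; apply: eq_bigr => k _; rewrite mulrBl.
  by ring.
apply: uabs_add_le; last first.
  by apply: uabs_sub_le; rewrite ltW ?hM ?hN2 // leq_maxr.
apply: uabs_sum_le => [|k _]; first exact: ltW.
rewrite mulrBl; apply: wlim_le (wlimM (hb k) (wlim_cst w (z ^+ k))) (ltW e20) _.
by exists N1 => // m /= N1m; rewrite -mulrBl; exact: hN1.
Qed.

Lemma unif_analytic (g : points -> C) :
  (forall e : R, 0 < e -> exists f, forall x, w (g x - f x) < e) -> analytic_element g.
Proof.
move=> hg e e0; have [f hf] := hg e e0; have [P [Q [Q0 fPQ]]] := anelP f e0.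
by exists P, Q; split=> // x; rewrite -(subrKA (f x)) uabs_add_lt.
Qed.

Lemma anel_of (g : points -> C) : analytic_element g -> exists f : anel, f =1 g.
Proof. by move=> gA; exists (Anel (asboolT gA : _ \in analytic_pred (C := C) (X := X))). Qed.

Lemma anel_eqP f g : f =1 g -> f = g.
Proof. by move=> fg; apply: val_inj; exact: funext. Qed.

(** The Cauchy estimate for the first coefficient makes the derivative of [f] a uniform limit of
    derivatives of rational functions. *)
Lemma exists_deriv f : exists g : anel, forall x, pderiv f x (g x).
Proof.
have /choice[b hb] y := anel_an f y.
have bd y : pderiv f y (b y 1%N) := pderiv_ps min_rad_gt0 (hb y).
suff /anel_of[g hg] : analytic_element (fun x => b x 1%N).
  by exists g => x; rewrite hg.
have [z0 /andP[z0_gt0 z0r]] := point_radius.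
move=> e e0; have e20 := divr_gt0 e0 (ltr0n R 2).
(* The factor [|z0|] compensates the loss in the Cauchy estimate at radius [|z0|]. *)
have [P [Q [Q0 fPQ]]] := anelP f (mulr_gt0 e20 z0_gt0).
exists (rat_deriv (P, Q)).1, (rat_deriv (P, Q)).2; split.
  exact: rat_deriv_neq0.
move=> x; have h : ps w rX (fun z => f (pshift x z) - ratf P Q (pshift x z))
    (fun k => b x k - ratf (rat_iter P Q k).1 (rat_iter P Q k).2 x / k`!%:R).
  by move=> t tr; apply: psumB; [exact: hb|exact: ratf_ps].
have := cauchy_estimate prim (ltW (mulr_gt0 e20 z0_gt0)) h z0r (fun u _ => ltW (fPQ _)) 1%N.
rewrite divr1 expr1 uabsM ler_pM2r // => /le_lt_trans; apply.
by rewrite ltr_pdivrMr // ltr_pMr // ltr1n.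
Qed.

Lemma deriv_anelP f x : pderiv f x (deriv_anel f x).
Proof.
apply/pderivP; rewrite /deriv_anel; case: xgetP => [g _ /= hg|no]; first exact: hg.
have [g hg] := exists_deriv f; exfalso; apply: (no g) => y.
exact/pderivP.
Qed.

Lemma deriv_anel_eq f g : (forall x, pderiv f x (g x)) -> deriv_anel f = g.
Proof.
by move=> fg; apply: anel_eqP => x; exact: pderiv_uniq (deriv_anelP f x) (fg x).
Qed.

Lemma anel_funD f g x : (f + g) x = f x + g x. Proof. by []. Qed.
Lemma anel_funB f g x : (f - g) x = f x - g x. Proof. by []. Qed.
Lemma anel_funM f g x : (f * g) x = f x * g x. Proof. by []. Qed.
Lemma anel_fun_sum (I : Type) (r : seq I) (P : pred I) (F : I -> anel) x :
  (\sum_(i <- r | P i) F i) x = \sum_(i <- r | P i) F i x.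
Proof. exact: (big_morph (fun f : anel => f x)). Qed.

Lemma deriv_anelD f g : deriv_anel (f + g) = deriv_anel f + deriv_anel g.
Proof.
by apply: deriv_anel_eq => x; apply: has_derivD; exact: deriv_anelP.
Qed.

Lemma deriv_anelM f g : deriv_anel (f * g) = deriv_anel f * g + f * deriv_anel g.
Proof.
apply: deriv_anel_eq => x.
have := has_derivM (deriv_anelP f x) (deriv_anelP g x).
by rewrite pshift0.
Qed.

Lemma deriv_anel0 : deriv_anel (0 : anel) = 0.
Proof. by apply: deriv_anel_eq => x; exact: has_deriv_cst. Qed.

Lemma deriv_anel1 : deriv_anel (1 : anel) = 0.
Proof. by apply: deriv_anel_eq => x; exact: has_deriv_cst. Qed.

(** The divided derivative as an element of H_K(X), not merely as a value at each point: [anU] asks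
    for coefficients of this kind. *)
Definition tcoef f k : anel := anel_poly C X (k`!%:R^-1)%:P * iter k (@deriv_anel _ _ _ C X) f.

Lemma tcoefE f k y : tcoef f k y = iter k (@deriv_anel _ _ _ C X) f y / k`!%:R.
Proof.
rewrite anel_funM /= map_polyC hornerC /= fmorphV rmorph_nat mulrC //.
Qed.

Lemma anel_taylor f y : ps w rX (fun z => f (pshift y z)) (fun k => tcoef f k y).
Proof.
have [b hb] := anel_an f y => z zr; apply: psum_ext (hb z zr) => k.
rewrite tcoefE; apply: (taylor_coef (F := fun k => iter k (@deriv_anel _ _ _ C X) f)) hb _.
by move=> j x; exact: deriv_anelP.
Qed.

Lemma anel_bounded f : exists2 B : R, 0 < B & forall x, w (f x) <= B.
Proof.
have [P [Q [Q0 fPQ]]] := anelP f ltr01; have [B B0 BP] := rational_bounded P Q0.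
exists (Num.max 1 B) => [|x]; first by rewrite lt_max ltr01.
rewrite -(subrK (ratf P Q x) (f x)); apply: uabs_add_le.
  by rewrite le_max ltW ?fPQ.
by rewrite le_max BP orbT.
Qed.

Lemma supnorm_ub f x : w (f x) <= supnorm f.
Proof.
have [B _ fB] := anel_bounded f; apply: ub_le_sup; last by exists x.
by exists B => _ [y _ <-].
Qed.

(** The condition [0 <= B] covers an empty [X], where the supremum is 0 by convention. *)
Lemma supnorm_le f (B : R) : 0 <= B -> (forall x, w (f x) <= B) -> supnorm f <= B.
Proof.
move=> B0 fB; have [[x0]|E] := pselect (inhabited points).
  by apply: ge_sup => [|_ [y _ <-]//]; exists (w (f x0)), x0.
rewrite /supnorm; have -> : [set w (f x) | x in [set: points]] = set0; last by rewrite sup0.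
by apply/seteqP; split=> // t [x _ _]; exfalso; apply: E.
Qed.

Lemma supnorm_ge0 f : 0 <= supnorm f.
Proof.
have [[x0]|E] := pselect (inhabited points).
  exact: le_trans (uabs_ge0 _ _) (supnorm_ub f x0).
rewrite /supnorm; have -> : [set w (f x) | x in [set: points]] = set0; last by rewrite sup0.
by apply/seteqP; split=> // t [x _ _]; exfalso; apply: E.
Qed.

Lemma tcoef_le f k y z : w z < rX -> w (tcoef f k y * z ^+ k) <= supnorm f.
Proof.
move=> zr; apply: (cauchy_estimate prim (supnorm_ge0 f) (anel_taylor f y) zr) => u _.
exact: supnorm_ub.
Qed.

(** [phi(x, y) = \sum_k a_k(y) (x - y)^k] is analytic on [U_rho]. *)
Definition anU rho (phi : points -> points -> C) (a : nat -> anel) : Prop :=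
  (forall rho' : R, 0 < rho' < rho ->
     exists2 B : R, 0 < B & forall k x, w (a k x) * rho' ^+ k <= B) /\
  forall y, ps w rho (fun z => phi (pshift y z) y) (fun k => a k y).

(** [rho'] need not be a value of [w], so the Cauchy estimate is applied at some [z] with
    [rho' < |z| < r_X]. *)
Lemma anel_anU f : anU rX (fun x _ => f x) (tcoef f).
Proof.
split=> [rho' /andP[rho0 rho'r]|y]; last exact: anel_taylor.
have [z /andP[rz zr]] := ac_value_dense v_mixed C (ltW rho0) rho'r.
exists (supnorm f + 1) => [|k x]; first by rewrite ltr_wpDl ?supnorm_ge0.
apply: le_trans (_ : supnorm f <= _); last by rewrite lerDl.
apply: le_trans (tcoef_le f k x zr); rewrite (uabsM w _ (z ^+ k)) uabsX ler_wpM2l ?uabs_ge0 //.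
by rewrite lerXn2r ?nnegrE ?uabs_ge0 ?ltW.
Qed.

End AffinoidAnalysis.

(** * The action of [q], division by [(q - 1) T], and uniqueness for q-difference systems *)

Section QDifference.
Variables (R : realType) (p : nat) (K : fieldType) (v : ultrabs R K).
Hypotheses (v_complete : complete_abs v) (v_mixed : mixed_char v p).
Variables (C : alg_closure v) (X : affinoid v).
Local Notation w := (ac_abs C).
Local Notation iota := (ac_inj C).
Local Notation points := (points C X).
Local Notation anel := (anel C X).
Local Notation rX := (min_rad X).
Implicit Types (f g : anel) (x y : points) (z h : C) (q : K).

Let nt := ac_nontriv v_mixed C.

Lemma tau_ge0 q : 0 <= tau X q.
Proof. by rewrite mulr_ge0 ?uabs_ge0 // ltW // max_norm_gt0. Qed.

Lemma q1_points q x : w (iota (q - 1) * val x) <= tau X q.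
Proof.
by rewrite uabsM ac_extends ler_wpM2l ?uabs_ge0 // points_norm.
Qed.

(** [q x] as the translate of [x] by [(q - 1) x], whose absolute value is at most [tau X q]. *)
Definition qpt q x : points := pshift x (iota (q - 1) * val x).

Lemma val_qpt q x : tau X q < rX -> val (qpt q x) = iota q * val x.
Proof.
move=> qr; rewrite val_pshift ?(le_lt_trans (q1_points q x)) //.
by rewrite rmorphB rmorph1 mulrBl mul1r addrC subrK.
Qed.

Lemma qpt_eq q x y : tau X q < rX -> val y = iota q * val x -> y = qpt q x.
Proof. by move=> qr yx; apply: val_inj; rewrite val_qpt. Qed.

Lemma qpt_dist q x : tau X q < rX -> w (val (qpt q x) - val x) <= tau X q.
Proof.
move=> qr; rewrite val_qpt // -[X in _ - X]mul1r -mulrBl -(rmorph1 iota) -rmorphB.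
exact: q1_points.
Qed.

Lemma tau_lt1 q : tau X q < rX -> v (q - 1) < 1.
Proof.
move=> qr; rewrite -(ltr_pM2r (max_norm_gt0 X)) mul1r.
exact: lt_le_trans qr (min_rad_le_max_norm X).
Qed.

Lemma sigma_qpt q f x : tau X q < rX -> sigma q f x = f (qpt q x).
Proof.
move=> qr; apply: sigmaE; last exact: val_qpt.
by move=> y; rewrite -val_qpt //; exact: (valP (qpt q y)).
Qed.

Lemma sigmaD q f g : tau X q < rX -> sigma q (f + g) = sigma q f + sigma q g.
Proof. by move=> qr; apply: anel_eqP => x; rewrite anel_funD !sigma_qpt. Qed.

Lemma sigmaM q f g : tau X q < rX -> sigma q (f * g) = sigma q f * sigma q g.
Proof. by move=> qr; apply: anel_eqP => x; rewrite anel_funM !sigma_qpt. Qed.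

(** The quotient is the sum of the [a_(k+1) d^k], a uniform limit of elements of H_K(X), so the
    division succeeds even where [d] vanishes. With [d = (q - 1) T] this yields both the
    q-derivative and the matrix [H_1] of a cocycle. *)
Lemma anU_quot rho (phi : points -> points -> C) (a : nat -> anel) (d : anel) (t0 : R) :
  rho <= rX -> anU rho phi a -> 0 <= t0 < rho -> (forall x, w (d x) <= t0) ->
  exists h : anel, forall x, d x * h x = phi (pshift x (d x)) x - a 0%N x.
Proof.
move=> rhoX [abd aps] /andP[t00 t0r] dt.
(* At a zero of [d] the value is the constant term of that series. *)
pose h x := if d x == 0 then a 1%N x else (phi (pshift x (d x)) x - a 0%N x) / d x.
suff /anel_of[f hf] : analytic_element h.
  exists f => x; rewrite hf /h; case: eqVneq => [d0|d0]; last by rewrite mulrC divfK.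
  have r0 : w 0 < rho by rewrite uabs0 (le_lt_trans t00).
  rewrite d0 mul0r.
  by rewrite (psum_uniq (aps x 0 r0) (psum0 w (fun k => a k x))) subrr.
(* A radius strictly between [t0] and [rho] makes the tail decay like [(t0 / r')^N], uniformly in
   [x]. *)
pose r' := (t0 + rho) / 2.
have tr' : t0 < r' by rewrite midf_lt.
have r'r : r' < rho by rewrite midf_lt.
have r'0 : 0 < r' := le_lt_trans t00 tr'.
have [B B0 hB] := abd r' (introT andP (conj r'0 r'r)).
have c0 : 0 <= t0 / r' by rewrite divr_ge0 // ltW.
have c1 : t0 / r' < 1 by rewrite ltr_pdivrMr // mul1r.
apply: unif_analytic => e e0.
have [N hN] := expr_lt_small c0 c1 (divr_gt0 (mulr_gt0 e0 r'0) B0).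
exists (\sum_(k < N.+1) a k.+1 * d ^+ k) => x.
have powE k : (d ^+ k) x = d x ^+ k.
  by elim: k => [|k IH]; rewrite ?expr0 // !exprS anel_funM IH.
have SE : (\sum_(k < N.+1) a k.+1 * d ^+ k) x = \sum_(k < N.+1) a k.+1 x * d x ^+ k.
  by rewrite anel_fun_sum; apply: eq_bigr => k _; rewrite anel_funM powE.
rewrite SE /h; case: eqVneq => [d0|d0].
  rewrite d0 big_ord_recl expr0 mulr1 big1 ?addr0 ?subrr ?uabs0 // => k _.
  by rewrite exprS mul0r mulr0.
have wd : 0 < w (d x) by rewrite uabs_gt0.
have dr : w (d x) < rho := le_lt_trans (dt x) t0r.
rewrite -(ltr_pM2l wd) -uabsM mulrBr [d x * (_ / _)]mulrC divfK // mulr_sumr.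
have -> : phi (pshift x (d x)) x - a 0%N x - \sum_(i < N.+1) d x * (a i.+1 x * d x ^+ i) =
    phi (pshift x (d x)) x - \sum_(k < N.+2) a k x * d x ^+ k.
  rewrite [in RHS]big_ord_recl expr0 mulr1 opprD addrA; congr (_ - _ - _).
  by apply: eq_bigr => k _; rewrite exprS mulrCA.
have bnd : B / r' * (t0 / r') ^+ N < e.
  rewrite mulrAC ltr_pdivrMr // mulrC -ltr_pdivlMr //.
apply: le_lt_trans (_ : w (d x) * (B / r' * (t0 / r') ^+ N) < _); last by rewrite ltr_pM2l.
have q0 : 0 <= (t0 / r') ^+ N by rewrite exprn_ge0.
apply: psum_tail (aps x _ dr) _ _ => [|k Nk].
  by rewrite !mulr_ge0 ?uabs_ge0 // ?invr_ge0 ltW.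
case: k Nk => [//|k]; rewrite ltnS => Nk.
rewrite uabsM uabsX exprS mulrCA ler_wpM2l ?uabs_ge0 //.
apply: le_trans (_ : w (a k.+1 x) * t0 ^+ k <= _).
  by rewrite ler_wpM2l ?uabs_ge0 // lerXn2r ?nnegrE ?uabs_ge0.
have -> : w (a k.+1 x) * t0 ^+ k = w (a k.+1 x) * r' ^+ k.+1 / r' * (t0 / r') ^+ k.
  rewrite [(t0 / r') ^+ k]expr_div_n [r' ^+ k.+1]exprS.
  have F (b t P s : R) : P != 0 -> s != 0 -> b * t = b * (s * P) / s * (t / P).
    by move=> *; field; apply/andP.
  by apply: F; rewrite ?expf_neq0 ?lt0r_neq0.
apply: ler_pM.
- apply: divr_ge0; last exact: ltW.
  by apply: mulr_ge0; [exact: uabs_ge0|rewrite exprn_ge0 // ltW].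
- by rewrite exprn_ge0.
- by rewrite ler_pM2r ?invr_gt0.
by apply: ler_wiXn2l; [exact: c0|exact: ltW|exact: ltnW].
Qed.

Definition qd q : anel := anel_poly C X ((q - 1) *: 'X).

Lemma qdE q x : qd q x = iota (q - 1) * val x.
Proof. by rewrite /qd /= map_polyZ map_polyX hornerZ hornerX. Qed.

Lemma qd_le q x : w (qd q x) <= tau X q.
Proof. by rewrite qdE; exact: q1_points. Qed.

Lemma anU_qquot rho (phi : points -> points -> C) (a : nat -> anel) q :
  rho <= rX -> anU rho phi a -> tau X q < rho ->
  exists h : anel, forall x, qd q x * h x = phi (qpt q x) x - a 0%N x.
Proof.
move=> rhoX phia qr.
have [|h hh] := anU_quot rhoX phia (t0 := tau X q) _ (qd_le q).
  by rewrite tau_ge0.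
by exists h => x; rewrite hh qdE.
Qed.

Lemma dqE q f : tau X q < rX -> qd q * dq q f = sigma q f - f.
Proof.
move=> qr; rewrite /dq; case: xgetP => [g _ //|no].
have [h hh] := anU_qquot (lexx _) (anel_anU v_complete v_mixed f) qr.
exfalso; apply: (no h); apply: anel_eqP => x.
rewrite anel_funM anel_funB sigma_qpt // hh.
by rewrite tcoefE divr1.
Qed.

(** Away from 0 one divides. At [x = 0] the identity theorem applies: [f - g] vanishes at all nearby
    nonzero points. *)
Lemma mulX_inj (c : K) f g : c != 0 ->
  anel_poly C X (c *: 'X) * f = anel_poly C X (c *: 'X) * g -> f = g.
Proof.
move=> c0 E; have E' x : val x != 0 -> f x = g x.
  move=> x0; have ic0 : iota c != 0 by rewrite fmorph_eq0.
  apply: (mulfI (mulf_neq0 ic0 x0)).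
  have := congr1 (fun h : anel => h x) E.
  by rewrite !anel_funM /= map_polyZ map_polyX hornerZ hornerX.
apply: anel_eqP => x; have [x0|] := eqVneq (val x) 0; last exact: E'.
apply/eqP; rewrite -subr_eq0 -anel_funB; apply/eqP.
have -> : (f - g) x = (f - g) (pshift x 0) by rewrite pshift0.
apply: (an_ident0 (min_rad_gt0 X) (anel_an v_complete v_mixed (f - g) x)) => [e e0|]; last first.
  by rewrite uabs0 min_rad_gt0.
have m0 : 0 < Num.min e rX by rewrite lt_min e0 min_rad_gt0.
have [h /andP[h0]] := nt m0; rewrite lt_min => /andP[he hr]; exists h; first by rewrite h0.
rewrite anel_funB E' ?subrr // val_pshift // x0 add0r.
by rewrite -(uabs_gt0 w).
Qed.

(** In the expansion of [(1 + u)^p] the inner binomial coefficients are divisible by [p], and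
    [|u^p| <= |u|^2]. *)
Lemma uabs_expp_sub1 q : v (q - 1) < 1 ->
  v (q ^+ p - 1) <= v (q - 1) * Num.max (v p%:R) (v (q - 1)).
Proof.
move=> q1; set u := q - 1; have -> : q = 1 + u by rewrite addrC subrK.
have u1 i : (0 < i)%N -> v (u ^+ i) <= v u.
  by case: i => // i _; rewrite uabsX exprS ler_piMr ?uabs_ge0 // exprn_ile1 ?uabs_ge0 ?ltW.
case: v_mixed => p_prime _ _.
rewrite exprDn big_ord_recl /= subn0 expr1n mulr1 bin0 addrAC subrr add0r.
have m0 : 0 <= Num.max (v p%:R) (v u) by rewrite le_max uabs_ge0.
apply: uabs_sum_le => [|i _]; first by rewrite mulr_ge0 ?uabs_ge0.
rewrite expr1n mul1r /bump /= add1n -mulr_natl uabsM mulrC.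
have [ip|pi] := ltnP i.+1 p.
  rewrite ler_pM ?uabs_ge0 ?u1 // le_max; apply/orP; left.
  have /dvdnP[k ->] : (p %| 'C(p, i.+1))%N by rewrite prime_dvd_bin.
  by rewrite natrM uabsM ler_piMl ?uabs_ge0 ?uabs_nat.
have -> : i.+1 = p by apply/eqP; rewrite eqn_leq pi ltn_ord.
rewrite -(ltn_predK (prime_gt1 p_prime)) exprS uabsM -mulrA ler_wpM2l ?uabs_ge0 //.
rewrite le_max; apply/orP; right; apply: le_trans (_ : v (u ^+ p.-1) <= _).
  by rewrite ler_piMr ?uabs_ge0 ?uabs_nat.
by apply: u1; move: (prime_gt1 p_prime); case: (p) => [|[]].
Qed.

(** Raising to the power [p] contracts the distance to 1 by the factor [c < 1]. *)
Lemma qpow_small q (e : R) : v (q - 1) < 1 -> 0 < e ->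
  exists n, v (q ^+ (p ^ n)%N - 1) < e.
Proof.
move=> q1 e0; pose c := Num.max (v p%:R) (v (q - 1)).
have c1 : c < 1 by rewrite gt_max q1; case: v_mixed => _ _ ->.
have c0 : 0 <= c by rewrite le_max uabs_ge0.
have [n hn] := expr_lt_small c0 c1 e0; exists n; apply: le_lt_trans hn.
elim: n => [|n IH]; first by rewrite expn0 expr1 expr0 ltW.
(* This bound keeps the contraction factor of [uabs_expp_sub1] at most [c] at every stage. *)
suff H : v (q ^+ (p ^ n)%N - 1) <= c.
  rewrite expnSr exprM exprSr; apply: le_trans (uabs_expp_sub1 (le_lt_trans H c1)) _.
  apply: ler_pM IH _; [exact: uabs_ge0|by rewrite le_max uabs_ge0|].
  by rewrite ge_max H le_max lexx.
elim: n {IH} => [|n IH]; first by rewrite expn0 expr1 le_max lexx orbT.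
rewrite expnSr exprM; apply: le_trans (uabs_expp_sub1 (le_lt_trans IH c1)) _.
rewrite mulrC; apply: le_trans (_ : 1 * c <= _); last by rewrite mul1r.
apply: ler_pM; rewrite ?uabs_ge0 //; first by rewrite le_max uabs_ge0.
rewrite ge_max.
by case: v_mixed => _ _ /ltW ->; rewrite ltW // (le_lt_trans IH).
Qed.

Lemma uabs_expr_sub1 q i : v (q - 1) < 1 -> v (q ^+ i - 1) <= v (q - 1).
Proof.
move=> q1; have vq : v q <= 1.
  by rewrite -(subrK 1 q) uabs_add_le ?uabs1 // ltW.
rewrite subrX1 uabsM ler_piMr ?uabs_ge0 //.
by apply: uabs_sum_le => // j _; rewrite uabsX exprn_ile1 ?uabs_ge0.
Qed.

Lemma iter_qpt q y i : tau X q < rX -> val (iter i (qpt q) y) = iota q ^+ i * val y.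
Proof.
move=> qr; elim: i => [|i IH]; first by rewrite mul1r.
by rewrite iterS val_qpt // IH exprS mulrA.
Qed.

Lemma iter_qpt_dist q y i : tau X q < rX ->
  w (val (iter i (qpt q) y) - val y) <= tau X q.
Proof.
move=> qr; rewrite iter_qpt // -[X in _ - X]mul1r -mulrBl -rmorphXn -(rmorph1 iota) -rmorphB.
rewrite uabsM ac_extends ler_pM ?uabs_ge0 ?uabs_expr_sub1 ?tau_lt1 //.
exact: points_norm.
Qed.

(** A solution of a linear [q]-difference system vanishing at [y] vanishes at the
    points [q^i y], which accumulate at [y] if [q] is not a root of unity. *)
Lemma q_uniq m n rho q (A : points -> 'M[C]_m) (W : points -> 'M[C]_(m, n)) y :
  rho <= rX -> tau X q < rho -> ~ unity_root q -> val y != 0 ->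
  (forall i j, an w rho (fun z => W (pshift y z) i j)) ->
  (forall x, w (val x - val y) < rho -> W (qpt q x) = A x *m W x) ->
  W y = 0 -> forall x, w (val x - val y) < rho -> W x = 0.
Proof.
move=> rhoX qr qN y0 Wan Wq Wy x xy; have qrX := lt_le_trans qr rhoX.
have Wi k : W (iter k (qpt q) y) = 0.
  elim: k => [//|k IH]; rewrite iterS Wq ?IH ?mulmx0 //.
  exact: le_lt_trans (iter_qpt_dist y k qrX) qr.
apply/matrixP => i j; rewrite mxE -(pshift_sub y x).
have rho0 := le_lt_trans (tau_ge0 q) qr.
apply: (an_ident0 rho0 (Wan i j) _ xy) => e e0.
have wy0 : 0 < w (val y) by rewrite uabs_gt0.
have [k hk] := qpow_small (tau_lt1 qrX) (divr_gt0 e0 wy0).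
(* Among the exponents the powers [p^k] suffice. The displacement is nonzero because [val y != 0]
   and [q] is not a root of unity. *)
exists (val (iter (p ^ k) (qpt q) y) - val y); last by rewrite pshift_sub Wi mxE.
rewrite iter_qpt // -[X in _ - X]mul1r -mulrBl -rmorphXn -(rmorph1 iota) -rmorphB.
rewrite uabsM ac_extends -ltr_pdivlMr // hk andbT mulr_gt0 // uabs_gt0 subr_eq0.
apply/eqP => q1; apply: qN; exists (p ^ k)%N => //.
by rewrite expn_gt0; case: v_mixed => /prime_gt0 ->.
Qed.

(** Expands [phi(., y)] about [x] instead of [y]. The new coefficients are series with terms in the
    product of the finite-dimensional spaces attached to [y] and to [s = x - y], so they
    converge. *)
Lemma anU_recenter rho (phi : points -> points -> C) a x y : rho <= rX ->
  anU rho phi a -> w (val x - val y) < rho ->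
  an w rho (fun z => phi (pshift x z) y).
Proof.
move=> rhoX [_ aps] xy; set s := val x - val y.
have E z : w z < rho -> phi (pshift y (s + z)) y = phi (pshift x z) y.
  by move=> zr; rewrite -pshiftD ?pshift_sub // (lt_le_trans _ rhoX).
apply: an_ext E _; apply: (ps_recenter (aps y) xy) => j.
have [L hL] := anel_kspan v_complete y.
have [M hM] := kspan_rational s.
have tL k : kspan [seq a * b | a <- L, b <- M] (a k y * (s ^+ (k - j) *+ 'C(k, j))).
  apply: kspanM; first exact: hL.
  have := hM (('X ^+ (k - j)) *+ 'C(k, j)) 1; rewrite rmorph1 hornerE oner_eq0 => /(_ isT).
  by rewrite rmorphMn /= map_polyXn hornerMn hornerXn divr1.
have tc := wcauchy_series (psum_recenter_small j (aps y s xy)).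
have [|l _ hl] := kspan_complete v_complete (L := [seq a * b | a <- L, b <- M]) _ tc; last by exists l.
by move=> N; apply: kspan_sum => k _; exact: tL.
Qed.

End QDifference.

(** * Newton interpolation of a power series *)

Section Newton.
Variables (R : realType) (C : fieldType) (w : ultrabs R C).
Variables (beta : nat -> C) (s : C).
Hypothesis beta_le : forall i, w (beta i) <= w s.
Implicit Types (z : C) (b c : nat -> C).

Definition newton_poly z k : C := \prod_(i < k) (z - beta i).

(** The complete homogeneous symmetric polynomials of degree [n - k] in [beta 0, ..., beta k]; they
    expand [z^n] in the Newton basis, see [ncoef_expr]. *)
Fixpoint ncoef n k : C :=
  if n is n'.+1 then (if k is k'.+1 then ncoef n' k' else 0) + beta k * ncoef n' k
  else (k == 0%N)%:R.

Lemma ncoef_small n k : (n < k)%N -> ncoef n k = 0.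
Proof.
elim: n k => [|n IH] [|k] //= nk.
by rewrite IH // IH ?mulr0 ?addr0 // ltnW.
Qed.

Lemma ncoef_diag n : ncoef n n = 1.
Proof. by elim: n => //= n IH; rewrite IH ncoef_small // mulr0 addr0. Qed.

Lemma ncoef_le n k : (k <= n)%N -> w (ncoef n k) <= w s ^+ (n - k).
Proof.
elim: n k => [|n IH] [|k] //=; rewrite ?uabs1 //.
  move=> _; rewrite add0r uabsM subn0 exprS.
  by have := IH 0%N isT; rewrite subn0 => ?; rewrite ler_pM ?uabs_ge0.
rewrite ltnS => kn; apply: uabs_add_le; first by rewrite subSS IH.
rewrite subSS; have [lt_kn|nk] := ltnP k n; last first.
  by rewrite ncoef_small ?mulr0 ?uabs0 ?exprn_ge0 ?uabs_ge0.
by rewrite uabsM -(subnSK lt_kn) exprS ler_pM ?uabs_ge0 ?IH.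
Qed.

Lemma ncoef_expr z n : z ^+ n = \sum_(k < n.+1) ncoef n k * newton_poly z k.
Proof.
elim: n => [|n IH]; first by rewrite big_ord1 /newton_poly big_ord0 mulr1.
have zP k : z * newton_poly z k = newton_poly z k.+1 + beta k * newton_poly z k.
  by rewrite {2}/newton_poly big_ord_recr /= -/(newton_poly z k); ring.
rewrite exprS IH mulr_sumr.
have -> : \sum_(i < n.+1) z * (ncoef n i * newton_poly z i) =
    \sum_(i < n.+1) ncoef n i * newton_poly z i.+1 +
    \sum_(i < n.+1) beta i * ncoef n i * newton_poly z i.
  by rewrite -big_split /=; apply: eq_bigr => i _; rewrite mulrCA zP; ring.
under [RHS]eq_bigr do rewrite /= mulrDl.
rewrite big_split /= [X in _ = X + _]big_ord_recl /= mul0r add0r.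
congr (_ + _); rewrite [in RHS]big_ord_recr /= (ncoef_small (ltnSn n)).
by rewrite mulr0 mul0r addr0.
Qed.

Lemma newton_poly_vanish i k : (i < k)%N -> newton_poly (beta i) k = 0.
Proof.
by move=> ik; rewrite /newton_poly (bigD1 (Ordinal ik)) //= subrr mul0r.
Qed.

Lemma newton_poly_le z k m : w z <= m -> w s <= m -> w (newton_poly z k) <= m ^+ k.
Proof.
move=> zm sm; have m0 := le_trans (uabs_ge0 w z) zm.
rewrite uabs_prod; elim: k => [|k IH]; first by rewrite big_ord0.
rewrite big_ord_recr /= exprSr ler_pM ?uabs_ge0 ?prodr_ge0 // => [i _|].
  exact: uabs_ge0.
by rewrite uabs_sub_le // (le_trans (beta_le k)).
Qed.

Variables (rho : R) (f : C -> C) (b c : nat -> C).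
Hypotheses (fb : ps w rho f b) (s_lt : w s < rho).
Hypothesis newton_poly_neq0 : forall k, newton_poly (beta k) k != 0.
Hypothesis fc : forall k, f (beta k) = \sum_(j < k.+1) c j * newton_poly (beta k) j.

Let nC M k := \sum_(n < M) b n * ncoef n k.

Lemma newton_partial z M :
  \sum_(n < M) b n * z ^+ n = \sum_(k < M) nC M k * newton_poly z k.
Proof.
under [RHS]eq_bigr do rewrite mulr_suml.
rewrite exchange_big; apply: eq_bigr => n _ /=.
rewrite ncoef_expr mulr_sumr.
rewrite (big_ord_widen M (fun k => b n * (ncoef n k * newton_poly z k)) (ltn_ord n)).
rewrite big_mkcond; apply: eq_bigr => k _ /=; case: ltnP => kn; first by rewrite mulrA.
by rewrite ncoef_small ?mulr0 ?mul0r.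
Qed.

(** At the node [beta k] all Newton polynomials of index above [k] vanish, so the coefficient of
    index [k] is solved from the preceding ones. The triangular system [fc] exhibits the limit
    inside [C]. *)
Lemma newton_coef_lim k : wlim w \oo (fun M => nC M k) (c k).
Proof.
elim/ltn_ind: k => k IH.
have bk : w (beta k) < rho := le_lt_trans (beta_le k) s_lt.
have Pk := newton_poly_neq0 k.
have -> : c k = (f (beta k) - \sum_(j < k) c j * newton_poly (beta k) j) * (newton_poly (beta k) k)^-1.
  by rewrite fc big_ord_recr /= addrAC subrr add0r mulfK.
have h : wlim w \oo (fun M => \sum_(j < k) nC M j * newton_poly (beta k) j)
    (\sum_(j < k) c j * newton_poly (beta k) j).
  by apply: wlim_sum => j _; apply: wlimM (IH j (ltn_ord j)) (wlim_cst _ _).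
apply: wlim_near (wlimM (wlimB (fb bk) h) (wlim_cst w _)).
exists k.+1 => // M /= kM; rewrite newton_partial.
rewrite -(big_mkord predT (fun j => nC M j * newton_poly (beta k) j)).
rewrite (@big_cat_nat _ _ _ k.+1) //= big_nat_recr //= big_mkord.
rewrite [X in _ + X - _]big_nat_cond [X in _ + X - _]big1 => [|j /andP[/andP[kj _] _]]; last first.
  by rewrite newton_poly_vanish ?mulr0.
by rewrite addr0 addrAC subrr add0r mulfK.
Qed.

(** With [m = max(|z|, |s|)], both [ncoef n k * newton_poly z k], for [k <= n], and [z^n] are at
    most [m^n]. Truncation at [N] is exact on the terms [n < N], and the error is at most the
    largest [|b n| m^n] with [n >= N]. *)
Lemma newton_series z : w z < rho ->
  wlim w \oo (fun N => \sum_(k < N) c k * newton_poly z k) (f z).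
Proof.
move=> zr; pose m := Num.max (w z) (w s).
have [u [wu ur]] : exists u, w u = m /\ w u < rho.
  by rewrite /m; case: leP => _; [exists s|exists z].
have zm : w z <= m by rewrite le_max lexx.
have sm : w s <= m by rewrite le_max lexx orbT.
have m0 := le_trans (uabs_ge0 w z) zm.
apply/wlim_seqE => e e0; have e20 := divr_gt0 e0 (ltr0n R 2).
have le_e : e / 2 < e by rewrite ltr_pdivrMr // ltr_pMr // ltr1n.
have [N0 hN0] := psum_small (fb ur) e20; rewrite wu in hN0.
exists N0 => N N0N; apply: le_lt_trans le_e; rewrite -[X in w X]subr0.
have h : wlim w \oo (fun M => \sum_(k < N) nC M k * newton_poly z k)
    (\sum_(k < N) c k * newton_poly z k).
  by apply: wlim_sum => j _; apply: wlimM (newton_coef_lim j) (wlim_cst _ _).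
apply: wlim_le (wlimB h (fb zr)) (ltW e20) _; exists N => // M /= NM.
under eq_bigr do rewrite mulr_suml.
rewrite exchange_big /= -sumrB subr0; apply: uabs_sum_le => [|n _]; first exact: ltW.
have -> : \sum_(i < N) b n * ncoef n i * newton_poly z i - b n * z ^+ n =
    b n * (\sum_(i < N) ncoef n i * newton_poly z i - z ^+ n).
  by rewrite mulrBr mulr_sumr; congr (_ - _); apply: eq_bigr => i _; rewrite mulrA.
have [nN|Nn] := ltnP n N.
  rewrite ncoef_expr (big_ord_widen N (fun k => ncoef n k * newton_poly z k) nN).
  rewrite (bigID (fun i : 'I_N => (i < n.+1)%N)) /= [X in _ + X - _]big1.
    by rewrite addr0 subrr mulr0 uabs0 ltW.
  by move=> i; rewrite -leqNgt => ni; rewrite ncoef_small ?mul0r.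
apply: le_trans (ltW (hN0 n (leq_trans N0N Nn))).
rewrite uabsM ler_wpM2l ?uabs_ge0 //; apply: uabs_sub_le; last first.
  by rewrite uabsX lerXn2r ?nnegrE ?uabs_ge0.
apply: uabs_sum_le => [|i _]; first by rewrite exprn_ge0.
have le_in : (i <= n)%N := ltnW (leq_trans (ltn_ord i) Nn).
rewrite uabsM -[X in _ <= m ^+ X](subnK le_in) exprD.
rewrite ler_pM ?uabs_ge0 ?newton_poly_le // (le_trans (ncoef_le le_in)) //.
by rewrite lerXn2r ?nnegrE ?uabs_ge0.
Qed.

(** [c k - b k] is the limit of the partial sums of [b n * ncoef n k] over [n > k]. The bound
    becomes small with [s], which is used near the point 0. *)
Lemma newton_coef_dist k (B : R) : 0 <= B ->
  (forall n, (k < n)%N -> w (b n) * w s ^+ (n - k) <= B) -> w (c k - b k) <= B.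
Proof.
move=> B0 hB; apply: (wlim_le (newton_coef_lim k) B0); exists k.+1 => // M /= kM.
rewrite /nC (bigD1 (Ordinal kM)) //= ncoef_diag mulr1 addrAC subrr add0r.
apply: uabs_sum_le => // n nk.
have [nk'|kn|E] := ltngtP n k; last by case/eqP: nk; apply: val_inj.
  by rewrite ncoef_small ?mulr0 ?uabs0.
apply: le_trans (hB n kn); rewrite uabsM ler_wpM2l ?uabs_ge0 //.
exact/ncoef_le/ltnW.
Qed.

End Newton.

(** Pascal's rule in the form required by an induction of Leibniz type, where one more derivation
    raises either index of [U]. *)
Lemma pascal_sum (V : zmodType) (U : nat -> nat -> V) n :
  \sum_(j < n.+1) (U j.+1 (n - j)%N + U j (n - j).+1) *+ 'C(n, j) =
  \sum_(j < n.+2) U j (n.+1 - j)%N *+ 'C(n.+1, j).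
Proof.
under eq_bigr do rewrite mulrnDl.
rewrite big_split /= [RHS]big_ord_recl /= bin0 mulr1n subn0.
have -> : \sum_(j < n.+1) U j (n - j).+1 *+ 'C(n, j) =
    U 0%N n.+1 + \sum_(j < n.+1) U j.+1 (n - j)%N *+ 'C(n, j.+1).
  rewrite big_ord_recl bin0 mulr1n subn0; congr (_ + _).
  rewrite [in RHS]big_ord_recr /= bin_small // mulr0n addr0.
  apply: eq_bigr => j _; rewrite /bump /= add1n; congr (U _ _ *+ _).
  by rewrite subnSK.
rewrite addrCA; congr (_ + _); rewrite -big_split /=; apply: eq_bigr => j _.
by rewrite /bump /= add1n subSS binS mulrnDr addrC.
Qed.

Lemma cvg0_bounded (R : realType) (u : nat -> R) : u k @[k --> \oo] --> (0 : R) ->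
  exists2 B, 0 < B & forall k, u k <= B.
Proof.
move=> /cvgrPdist_lt /(_ 1 ltr01)[N _ uN].
have S0 : 0 <= \sum_(k < N) `|u k| by apply: sumr_ge0 => k _; exact: normr_ge0.
exists (1 + \sum_(k < N) `|u k|) => [|k]; first by rewrite ltr_pwDl.
apply: le_trans (ler_norm _) _; have [/uN|kN] := leqP N k.
  by rewrite /= sub0r normrN => /ltW; move/le_trans; apply; rewrite lerDl.
by rewrite (bigD1 (Ordinal kN)) //= addrCA lerDl addr_ge0 // sumr_ge0.
Qed.

(** * Cocycles, linear differential equations and their Taylor solutions *)

Section Cocycles.
Variables (R : realType) (p : nat) (K : fieldType) (v : ultrabs R K).
Hypotheses (v_complete : complete_abs v) (v_mixed : mixed_char v p).
Variables (C : alg_closure v) (X : affinoid v).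
Local Notation w := (ac_abs C).
Local Notation points := (points C X).
Local Notation anel := (anel C X).
Local Notation rX := (min_rad X).
Local Notation D := (@deriv_anel R K v C X).
Implicit Types (f g : anel) (x y : points) (h : C) (q : K).

Let nt := ac_nontriv v_mixed C.

Lemma anel_funMn f k x : (f *+ k) x = f x *+ k.
Proof. by elim: k => [|k IH]; rewrite ?mulr0n // !mulrS anel_funD IH. Qed.

Lemma eval_mxE m n (A : 'M[anel]_(m, n)) x i j : eval_mx A x i j = A i j x.
Proof. by rewrite mxE. Qed.

Lemma eval_mxM m n k (A : 'M[anel]_(m, n)) (B : 'M[anel]_(n, k)) x :
  eval_mx (A *m B) x = eval_mx A x *m eval_mx B x.
Proof.
apply/matrixP => i j; rewrite !mxE anel_fun_sum; apply: eq_bigr => l _.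
by rewrite !mxE.
Qed.

Lemma eval_mxD m n (A B : 'M[anel]_(m, n)) x :
  eval_mx (A + B) x = eval_mx A x + eval_mx B x.
Proof. by apply/matrixP => i j; rewrite !mxE. Qed.

Lemma eval_mxB m n (A B : 'M[anel]_(m, n)) x :
  eval_mx (A - B) x = eval_mx A x - eval_mx B x.
Proof. by apply/matrixP => i j; rewrite !mxE. Qed.

Lemma eval_mxZ m n f (A : 'M[anel]_(m, n)) x :
  eval_mx (f *: A) x = f x *: eval_mx A x.
Proof. by apply/matrixP => i j; rewrite !mxE. Qed.

Lemma eval_mx1 n x : eval_mx (1%:M : 'M[anel]_n) x = 1%:M.
Proof. by apply/matrixP => i j; rewrite !mxE; case: eqP. Qed.

Lemma eval_mx_inj m n (A B : 'M[anel]_(m, n)) :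
  (forall x, eval_mx A x = eval_mx B x) -> A = B.
Proof.
move=> AB; apply/matrixP => i j; apply: anel_eqP => x.
by rewrite -!eval_mxE AB.
Qed.

Lemma eval_mx_sigma m n (A : 'M[anel]_(m, n)) q x : tau X q < rX ->
  eval_mx (map_mx (sigma q) A) x = eval_mx A (qpt q x).
Proof. by move=> qr; apply/matrixP => i j; rewrite !mxE sigma_qpt. Qed.

Definition anUm n rho (Y : points -> points -> 'M[C]_n) (a : nat -> 'M[anel]_n) : Prop :=
  forall i j, anU rho (fun x y => Y x y i j) (fun k => a k i j).

Definition cocycle n (rho : R) (Y : points -> points -> 'M[C]_n) : Prop :=
  (forall x, Y x x = 1%:M) /\
  forall x y z : points, w (val x - val y) < rho -> w (val y - val z) < rho ->
    Y x z = Y x y *m Y y z.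

(** Sup-norms become pointwise bounds uniform in [x], and convergence to 0 becomes boundedness;
    taken over all radii below [rho] the two conditions carry the same information. *)
Lemma analytic_anUm n rho (Y : points -> points -> 'M[C]_n) : rho <= rX ->
  analytic_on_U rho Y -> exists a, anUm rho Y a.
Proof.
move=> rhoX [a [abd aps]]; exists a => i j; split=> [rho' rr|y z zr].
  have [B B0 hB] := cvg0_bounded (abd rho' rr i j); exists B => // k x.
  apply: le_trans (hB k); rewrite ler_wpM2r ?supnorm_ub //.
  by case/andP: rr => r0 _; rewrite exprn_ge0 // ltW.
have E : val (pshift y z) - val y = z.
  by rewrite val_pshift 1?addrAC ?subrr ?add0r // (lt_le_trans zr).
have := aps (pshift y z) y; rewrite E => /(_ zr i j) /wlim_seqP.
apply: wlim_ext => N; apply: eq_bigr => k _.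
by rewrite !mxE mulrC.
Qed.

Section Solutions.
Variables (n : nat) (rho : R) (Y : points -> points -> 'M[C]_n) (a : nat -> 'M[anel]_n).
Hypotheses (rhoX : rho <= rX) (Ya : anUm rho Y a).

Lemma anUm_an y i j : an w rho (fun z => Y (pshift y z) y i j).
Proof. by exists (fun k => a k i j y); case: (Ya i j). Qed.

Lemma anUm_recenter x y i j : w (val x - val y) < rho ->
  an w rho (fun z => Y (pshift x z) y i j).
Proof. exact: (anU_recenter v_complete rhoX (Ya i j)). Qed.

Lemma an_cocycle_defect y (z : points) i j : w (val y - val z) < rho ->
  an w rho (fun t => (Y (pshift y t) z - Y (pshift y t) y *m Y y z) i j).
Proof.
move=> yz.
have h := anB (anUm_recenter i j yz) (an_sum (index_enum 'I_n)
  (fun l (_ : true) => anM (anUm_an y i l) (an_cst w rho (Y y z l j)))).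
by apply: an_ext h => t _; rewrite !mxE.
Qed.

Hypothesis Y1 : forall x, Y x x = 1%:M.

Lemma cocycle_q q (A : points -> 'M[C]_n) : ~ unity_root q -> tau X q < rho ->
  (forall x y, w (val x - val y) < rho -> Y (qpt q x) y = A x *m Y x y) ->
  cocycle rho Y.
Proof.
move=> qN qr Yq; split=> //; have qrX := lt_le_trans qr rhoX.
have rho0 := le_lt_trans (tau_ge0 X q) qr.
have c1 x y (z : points) : val y != 0 -> w (val x - val y) < rho -> w (val y - val z) < rho ->
    Y x z = Y x y *m Y y z.
  move=> y0 xy yz; apply/eqP; rewrite -subr_eq0; apply/eqP.
  pose W x := Y x z - Y x y *m Y y z.
  apply: (q_uniq v_mixed (A := A) (W := W) rhoX qr qN y0) xy => [i j|t ty|].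
  - exact: an_cocycle_defect.
  - rewrite /W !Yq ?(uabs_trans_lt ty) //.
    by rewrite mulmxBr mulmxA.
  - by rewrite subrr uabs0.
  - by rewrite /W Y1 mul1mx subrr.
(* Invertibility of [Y] as soon as one of the two points is nonzero. *)
have c2 x y : (val x != 0) || (val y != 0) -> w (val x - val y) < rho ->
    Y x y *m Y y x = 1%:M.
  move=> /orP[x0|y0] xy; last by rewrite -c1 // uabs_subC.
  by apply: mulmx1C; rewrite -c1 // uabs_subC.
(* The orbit of [y = 0] is constant, so uniqueness says nothing there. Instead
   [Y(y, z) = Y(y, x) Y(x, z)], known for [x != 0], is multiplied by [Y(x, y)], the inverse of
   [Y(y, x)]. *)
move=> x y z xy yz; have [y0|y0] := eqVneq (val y) 0; last exact: c1.
have [x0|x0] := eqVneq (val x) 0.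
  by have -> : x = y by [apply: val_inj; rewrite x0 y0]; rewrite Y1 mul1mx.
have yx : w (val y - val x) < rho by rewrite uabs_subC.
rewrite (c1 y x z x0 yx (uabs_trans_lt xy yz)).
by rewrite mulmxA c2 ?x0 // mul1mx.
Qed.

End Solutions.

(** Comparison of coefficients in [W' = G W]. The recursion gives both the uniqueness of solutions
    and the identification of the Taylor matrices. *)
Lemma ode_coef m n rho (W : points -> 'M[C]_(m, n)) (G : 'M[anel]_m) y
    (b : 'I_m -> 'I_n -> nat -> C) : 0 < rho -> rho <= rX ->
  (forall i j, ps w rho (fun z => W (pshift y z) i j) (b i j)) ->
  (forall x, w (val x - val y) < rho -> forall i j,
     pderiv (fun t => W t i j) x ((eval_mx G x *m W x) i j)) ->
  forall i j k, b i j k.+1 *+ k.+1 =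
    \sum_l cprod (fun k => tcoef (G i l) k y) (b l j) k.
Proof.
move=> rho0 rhoX Wb Wd i j k.
have h1 : ps w rho (fun z => (eval_mx G (pshift y z) *m W (pshift y z)) i j)
    (fun k => b i j k.+1 *+ k.+1).
  apply: (an_deriv nt rho0 _ (Wb i j)) => z zr.
  apply/(pderiv_shift (fun t => W t i j) y _ (lt_le_trans zr rhoX)).
  apply: Wd; rewrite val_pshift ?(lt_le_trans zr) //.
  by rewrite addrAC subrr add0r.
have h2 : ps w rho (fun z => (eval_mx G (pshift y z) *m W (pshift y z)) i j)
    (fun k => \sum_l cprod (fun k => tcoef (G i l) k y) (b l j) k).
  move=> z zr; rewrite mxE; apply: psum_sum => l _; rewrite eval_mxE.
  apply: psumM; last exact: Wb.
  by apply: (anel_taylor v_complete v_mixed); exact: lt_le_trans rhoX.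
exact: (ps_uniq nt rho0 h1 h2 k).
Qed.

Lemma ode_uniq m n rho (W : points -> 'M[C]_(m, n)) (G : 'M[anel]_m) y :
  0 < rho -> rho <= rX ->
  (forall i j, an w rho (fun z => W (pshift y z) i j)) ->
  (forall x, w (val x - val y) < rho -> forall i j,
     pderiv (fun t => W t i j) x ((eval_mx G x *m W x) i j)) ->
  W y = 0 -> forall x, w (val x - val y) < rho -> W x = 0.
Proof.
move=> rho0 rhoX Wan Wd Wy x xy.
have /choice[b hb] ij : exists b, ps w rho (fun z => W (pshift y z) ij.1 ij.2) b.
  exact: Wan.
pose b' i j := b (i, j).
have hb' i j : ps w rho (fun z => W (pshift y z) i j) (b' i j) := hb (i, j).
have rec := ode_coef rho0 rhoX hb' Wd.
have b0 k : forall i j, b' i j k = 0.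
  elim/ltn_ind: k => -[|k] IH i j.
    by rewrite (ps_coef0 rho0 (hb' i j)) pshift0 Wy mxE.
  apply: (mulIf (natf_neq0_mixed v_mixed C (ltn0Sn k))).
  rewrite mul0r mulr_natr rec big1 // => l _; rewrite /cprod big1 // => s _.
  by rewrite IH ?mulr0 // ltnS leq_subr.
apply/matrixP => i j; rewrite mxE -(pshift_sub y x).
have h := psum_poly w (b := b' i j) (val x - val y) (N := 0) (fun k _ => b0 k i j).
by rewrite (psum_uniq (hb' i j _ xy) h) big_ord0.
Qed.

Section Cocycle.
Variables (n : nat) (rho : R) (Y : points -> points -> 'M[C]_n) (a : nat -> 'M[anel]_n).
Hypotheses (rho0 : 0 < rho) (rhoX : rho <= rX) (Ya : anUm rho Y a).

Lemma cocycle_d (G : 'M[anel]_n) : (forall x, Y x x = 1%:M) ->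
  (forall x (z : points), w (val x - val z) < rho -> forall i j,
    pderiv (fun t => Y t z i j) x ((eval_mx G x *m Y x z) i j)) ->
  cocycle rho Y.
Proof.
move=> Y1 Yd; split=> // x y z xy yz; apply/eqP; rewrite -subr_eq0; apply/eqP.
pose W x := Y x z - Y x y *m Y y z.
apply: (ode_uniq (W := W) (G := G) rho0 rhoX) xy => [i j|t ty i j|].
- exact: an_cocycle_defect.
- have tz := uabs_trans_lt ty yz.
  have := has_derivD (Yd t z tz i j) (has_derivN (has_deriv_sum (index_enum 'I_n)
    (fun l (_ : true) => has_derivM (Yd t y ty i l) (has_deriv_cst w (Y y z l j) 0)))).
  rewrite /W mulmxBr mulmxA.
  have -> : (eval_mx G t *m Y t z) i j + - (\sum_l ((eval_mx G t *m Y t y) i l * Y y z l j +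
      Y (pshift t 0) y i l * 0)) =
      (eval_mx G t *m Y t z - eval_mx G t *m Y t y *m Y y z) i j.
    rewrite !mxE; congr (_ - _); apply: eq_bigr => l _.
    by rewrite mulr0 addr0.
  apply: has_deriv_near; first by rewrite /= !mxE.
  by apply: filterE => h /=; rewrite !mxE.
- by rewrite /W Y1 mul1mx subrr.
Qed.

Hypothesis Yc : cocycle rho Y.

Lemma cocycle_coef0 y i j : a 0%N i j y = (i == j)%:R.
Proof.
have [_ /(_ y) h] := Ya i j.
by rewrite (ps_coef0 rho0 h) pshift0 Yc.1 mxE.
Qed.

(** Near [x] one has [Y(t, z) = Y(t, x) Y(x, z)], and the first factor has derivative [a_1(x)] at
    [t = x]. *)
Lemma cocycle_deriv x (z : points) i j : w (val x - val z) < rho ->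
  pderiv (fun t => Y t z i j) x ((eval_mx (a 1%N) x *m Y x z) i j).
Proof.
move=> xz; rewrite mxE.
have d l : pderiv (fun t => Y t x i l) x (a 1%N i l x).
  by have [_ /(_ x) h] := Ya i l; exact: (pderiv_ps (f := fun t => Y t x i l) v_mixed rho0 h).
have := has_deriv_sum (index_enum 'I_n)
    (fun l (_ : true) => has_derivM (d l) (has_deriv_cst w (Y x z l j) 0)).
have -> : \sum_i0 (a 1%N i i0 x * Y x z i0 j + Y (pshift x 0) x i i0 * 0) =
   \sum_i0 eval_mx (a 1%N) x i i0 * Y x z i0 j.
  by apply: eq_bigr => l _; rewrite mulr0 addr0 eval_mxE.
apply: has_deriv_near; first by rewrite pshift0 [in RHS](Yc.2 x x z) ?subrr ?uabs0 // mxE.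
apply: filterS (dn0_lt w rho0) => h /= hr.
rewrite [in RHS](Yc.2 _ x z) ?mxE // add0r val_pshift ?(lt_le_trans hr) //.
by rewrite addrAC subrr add0r.
Qed.

End Cocycle.

Section DTaylor.
Variables (n : nat) (G : 'M[anel]_n).

Lemma map_derivD (A B : 'M[anel]_n) : map_mx D (A + B) = map_mx D A + map_mx D B.
Proof. by apply/matrixP => i j; rewrite !mxE (deriv_anelD v_complete v_mixed). Qed.

Lemma map_derivM (A B : 'M[anel]_n) :
  map_mx D (A *m B) = map_mx D A *m B + A *m map_mx D B.
Proof.
apply/matrixP => i j; rewrite !mxE.
rewrite (big_morph D (deriv_anelD v_complete v_mixed (C := C) (X := X)) (deriv_anel0 v_complete v_mixed _ _)).
by rewrite -big_split /=; apply: eq_bigr => l _; rewrite (deriv_anelM v_complete v_mixed) !mxE.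
Qed.

Lemma map_deriv0 : map_mx D (0 : 'M[anel]_n) = 0.
Proof. by apply/matrixP => i j; rewrite !mxE (deriv_anel0 v_complete v_mixed). Qed.

Lemma map_deriv_sum (I : Type) (r : seq I) (P : pred I) (F : I -> 'M[anel]_n) :
  map_mx D (\sum_(i <- r | P i) F i) = \sum_(i <- r | P i) map_mx D (F i).
Proof. exact: (big_morph _ map_derivD map_deriv0). Qed.

Lemma map_derivMn (A : 'M[anel]_n) k : map_mx D (A *+ k) = map_mx D A *+ k.
Proof.
by elim: k => [|k IH]; rewrite ?mulr0n ?map_deriv0 // !mulrS map_derivD IH.
Qed.

Lemma mulmxMnl (A B : 'M[anel]_n) k : A *+ k *m B = (A *m B) *+ k.
Proof. by elim: k => [|k IH]; rewrite ?mulr0n ?mul0mx // !mulrS mulmxDl IH. Qed.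

(** [G_[k+1] = G_[k]' + G_[k] G_[1]] is equivalent, by the Leibniz rule, to the
    recursion given by the equation [Y' = G_[1] Y]. *)
Lemma d_taylor_left k : d_taylor G k.+1 =
  \sum_(j < k.+1) (iter j (map_mx D) G *m d_taylor G (k - j)) *+ 'C(k, j).
Proof.
elim: k => [|k IH].
  rewrite big_ord1 /= mulmx1 mul1mx mulr1n.
  have -> : map_mx D (1%:M : 'M[anel]_n) = 0; last by rewrite add0r.
  apply/matrixP => i j; rewrite !mxE; case: (i == j).
    by rewrite mulr1n (deriv_anel1 v_complete v_mixed).
  by rewrite mulr0n (deriv_anel0 v_complete v_mixed).
rewrite [LHS]/= -/(d_taylor G k.+1) [in LHS]IH map_deriv_sum mulmx_suml -big_split /=.
rewrite -(pascal_sum (fun j m => iter j (map_mx D) G *m d_taylor G m)).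
apply: eq_bigr => j _.
rewrite map_derivMn map_derivM mulmxMnl -mulrnDl; congr (_ *+ _).
by rewrite -addrA -mulmxA -mulmxDr.
Qed.


Lemma iter_map_deriv j i l : iter j (map_mx D) G i l = iter j D (G i l).
Proof. by elim: j => //= j IH; rewrite mxE IH. Qed.

Definition d_coef y k i j : C := d_taylor G k i j y / k`!%:R.

(** After division of [d_taylor_left] by [k!] the binomial coefficient becomes [1 / (s! (k-s)!)] and
    the sum a Cauchy product, as in [ode_coef]. *)
Lemma d_coef_rec y k i j : d_coef y k.+1 i j *+ k.+1 =
  \sum_l cprod (fun k => tcoef (G i l) k y) (fun k => d_coef y k l j) k.
Proof.
have k1 := natf_neq0_mixed v_mixed C (ltn0Sn k).
have fk t := natf_neq0_mixed v_mixed C (fact_gt0 t).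
rewrite /d_coef -[_ *+ k.+1]mulr_natr factS natrM invfM mulrA mulrAC divfK //.
rewrite d_taylor_left summxE anel_fun_sum mulr_suml exchange_big /=.
apply: eq_bigr => s _; rewrite /d_coef.
have sk : (s <= k)%N by rewrite -ltnS.
have -> : ((iter s (map_mx D) G *m d_taylor G (k - s)) *+ 'C(k, s)) i j y =
    (\sum_l iter s D (G i l) y * d_taylor G (k - s) l j y) * 'C(k, s)%:R.
  rewrite mulmxnE anel_funMn mxE anel_fun_sum -[LHS]mulr_natr.
  by congr (_ * _); apply: eq_bigr => l _; rewrite anel_funM iter_map_deriv.
rewrite -mulrA mulr_suml; apply: eq_bigr => l _.
rewrite -[X in _ = X * _]/(tcoef (G i l) s y) tcoefE.
have E : 'C(k, s)%:R / k`!%:R = (s`!%:R)^-1 * ((k - s)`!%:R)^-1 :> C.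
  rewrite -(bin_fact sk) !natrM.
  have := fk s; have := fk (k - s)%N.
  have : 'C(k, s)%:R != 0 :> C by rewrite (natf_neq0_mixed v_mixed) // bin_gt0.
  by move: (_%:R) (_%:R) (_%:R) => a b c *; field; apply/and3P.
by rewrite E; ring.
Qed.

End DTaylor.

Section FromD.
Variables (n : nat) (rho : R) (Y : points -> points -> 'M[C]_n) (a : nat -> 'M[anel]_n).
Hypotheses (rho0 : 0 < rho) (rhoX : rho <= rX) (Ya : anUm rho Y a).
Variable G1 : 'M[anel]_n.

Definition d_series := forall x y, w (val x - val y) < rho ->
  series_cvg (fun k => ((val x - val y) ^+ k / k`!%:R) *: eval_mx (d_taylor G1 k) y) (Y x y).

Lemma d_seriesP : d_series <->
  forall y i j, ps w rho (fun h => Y (pshift y h) y i j) (fun k => d_coef G1 y k i j).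
Proof.
have T x y k i j : (((val x - val y) ^+ k / k`!%:R) *: eval_mx (d_taylor G1 k) y) i j =
    d_coef G1 y k i j * (val x - val y) ^+ k.
  by rewrite !mxE /d_coef; ring.
split=> [hd y i j h hr|hd x y xy i j].
  have E : val (pshift y h) - val y = h.
    by rewrite val_pshift 1?addrAC ?subrr ?add0r // (lt_le_trans hr).
  have := hd (pshift y h) y; rewrite E => /(_ hr i j) /wlim_seqP.
  by apply: wlim_ext => N; apply: eq_bigr => k _; rewrite -[in LHS]E T E.
apply/wlim_seqP; have := hd y i j _ xy; rewrite pshift_sub.
by apply: wlim_ext => N; apply: eq_bigr => k _; rewrite T.
Qed.

(** Termwise differentiation with [d_coef_rec] gives [Y' = G1 Y], so that [cocycle_d] applies. *)
Lemma d_series_cocycle : d_series -> cocycle rho Y.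
Proof.
move=> /d_seriesP hd.
have Y1 x : Y x x = 1%:M.
  apply/matrixP => i j; rewrite -{1}(pshift0 x) -(ps_coef0 rho0 (hd x i j)).
  by rewrite /d_coef divr1 !mxE; case: (i == j); rewrite ?mulr1n ?mulr0n.
apply: (cocycle_d rho0 rhoX Ya (G := G1)) => // x y xy i j.
rewrite -(pshift_sub y x); apply/(pderiv_shift (fun t => Y t y i j) y).
  exact: lt_le_trans rhoX.
apply/(ps_deriv nt _ rho0 (hd y i j) xy).
rewrite mxE; apply: psum_ext (fun k => esym (d_coef_rec G1 y k i j)) _.
apply: psum_sum => l _; rewrite eval_mxE; apply: psumM; last exact: hd.
by apply: (anel_taylor v_complete v_mixed); exact: lt_le_trans rhoX.
Qed.

Lemma d_series_coef1 : d_series -> a 1%N = G1.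
Proof.
move=> /d_seriesP hd; apply/matrixP => i j; apply: anel_eqP => y.
have [_ /(_ y) h] := Ya i j; rewrite (ps_uniq nt rho0 h (hd y i j) 1%N).
rewrite /d_coef divr1 /=.
have -> : map_mx D (1%:M : 'M[anel]_n) = 0; last by rewrite add0r mul1mx.
apply/matrixP => k l; rewrite !mxE; case: (k == l).
  by rewrite mulr1n (deriv_anel1 v_complete v_mixed).
by rewrite mulr0n (deriv_anel0 v_complete v_mixed).
Qed.

(** The coefficients [a k] and [d_coef] obey the same recursion and both start with the identity. *)
Lemma cocycle_d_series : cocycle rho Y -> G1 = a 1%N -> d_series.
Proof.
move=> Yc G1E; apply/d_seriesP => y i j h hr; rewrite G1E.
have hb i' j' : ps w rho (fun h => Y (pshift y h) y i' j') (fun k => a k i' j' y).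
  by case: (Ya i' j').
have Yd x : w (val x - val y) < rho -> forall i j,
    pderiv (fun t => Y t y i j) x ((eval_mx (a 1%N) x *m Y x y) i j).
  by move=> xy i' j'; exact: (cocycle_deriv rho0 rhoX Ya Yc).
have rec := ode_coef (W := fun x => Y x y) rho0 rhoX hb Yd.
suff E k : forall i j, a k i j y = d_coef (a 1%N) y k i j.
  by apply: psum_ext (hb i j h hr) => k; rewrite E.
elim/ltn_ind: k => -[|k] IH i' j'.
  rewrite (cocycle_coef0 rho0 Ya Yc) /d_coef divr1 mxE.
  by case: (i' == j').
apply: (mulIf (natf_neq0_mixed v_mixed C (ltn0Sn k))).
rewrite !mulr_natr rec d_coef_rec; apply: eq_bigr => l _; apply: eq_bigr => s _.
by congr (_ * _); rewrite IH // ltnS leq_subr.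
Qed.

End FromD.
End Cocycles.

(** * q-Pochhammer symbols and q-factorials *)

Section QPoch.
Variables (R : realType) (K : fieldType) (v : ultrabs R K) (C : alg_closure v).
Implicit Types (q x y : C).

Lemma q_poch_recr q x y k : q_poch q x y k.+1 = q_poch q x y k * (x - q ^+ k * y).
Proof. by rewrite /q_poch big_ord_recr. Qed.

Lemma q_poch_mul q x y k : q_poch q (q * x) (q * y) k = q ^+ k * q_poch q x y k.
Proof.
elim: k => [|k IH]; first by rewrite /q_poch !big_ord0 mulr1.
by rewrite !q_poch_recr IH exprS; ring.
Qed.

Lemma q_poch_shift q x y k :
  q_poch q (q * x) y k.+1 = (q * x - y) * q ^+ k * q_poch q x y k.
Proof.
elim: k => [|k IH]; first by rewrite q_poch_recr /q_poch !big_ord0; ring.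
by rewrite q_poch_recr IH q_poch_recr exprS; ring.
Qed.

Lemma q_fact_recr q k : q_fact q k.+1 = q_fact q k * ((q ^+ k.+1 - 1) / (q - 1)).
Proof. by rewrite /q_fact big_nat_recr. Qed.

Lemma q_fact_neq0 q k : ~ unity_root q -> q_fact q k != 0.
Proof.
move=> qN; have q1 i : (0 < i)%N -> q ^+ i - 1 != 0.
  by move=> i0; rewrite subr_eq0; apply/eqP => qi; apply: qN; exists i.
elim: k => [|k IH]; first by rewrite /q_fact big_geq ?oner_eq0.
by rewrite q_fact_recr !mulf_neq0 ?invr_eq0 ?q1 // -[q]expr1 q1.
Qed.

(** This lets the base point of a q-expansion move from [q y] back to [y]: in [q_orbit] the two
    terms on the right match those produced by [q_taylor_eval]. *)
Lemma q_newton_rec q x y k : ~ unity_root q ->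
  q_poch q (q * x) y k.+1 / q_fact q k.+1 =
  q ^+ k.+1 * (q_poch q x y k.+1 / q_fact q k.+1) +
  (q - 1) * y * (q ^+ k * (q_poch q x y k / q_fact q k)).
Proof.
move=> qN; have q1 i : (0 < i)%N -> q ^+ i - 1 != 0.
  by move=> i0; rewrite subr_eq0; apply/eqP => qi; apply: qN; exists i.
have fk := q_fact_neq0 k qN; have h1 := q1 1%N isT; have h2 := q1 k.+1 isT.
rewrite q_poch_shift q_poch_recr q_fact_recr; rewrite expr1 in h1.
rewrite exprS in h2 *.
move: (q_poch q x y k) (q_fact q k) (q ^+ k) fk h2 => P F Q F0 Q0.
by field; apply/and3P.
Qed.

Lemma unity_root_iota (q : K) : unity_root (ac_inj C q) -> unity_root q.
Proof.
move=> [n n0 qn]; exists n => //; apply: (fmorph_inj (ac_inj C)).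
by rewrite rmorphXn qn rmorph1.
Qed.

End QPoch.

(** * The q-Taylor expansion of a cocycle *)

Section QTaylor.
Variables (R : realType) (p : nat) (K : fieldType) (v : ultrabs R K).
Hypotheses (v_complete : complete_abs v) (v_mixed : mixed_char v p).
Variables (C : alg_closure v) (X : affinoid v).
Local Notation w := (ac_abs C).
Local Notation iota := (ac_inj C).
Local Notation points := (points C X).
Local Notation anel := (anel C X).
Local Notation rX := (min_rad X).
Implicit Types (f g : anel) (x y : points) (h : C).

Let nt := ac_nontriv v_mixed C.
#[local] Instance dn0w' : ProperFilter (dn0 w) := dn0_proper nt.

Lemma anel_cont f y : wlim w (dn0 w) (fun h => f (pshift y h)) (f y).
Proof.
have := has_deriv_cont (deriv_anelP v_complete v_mixed f y); rewrite pshift0.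
by apply: wlim_ext => h; rewrite add0r.
Qed.

Variables (n : nat) (rho : R) (Y : points -> points -> 'M[C]_n) (a : nat -> 'M[anel]_n).
Hypotheses (rho0 : 0 < rho) (rhoX : rho <= rX) (Ya : anUm rho Y a).
Hypothesis Yc : cocycle rho Y.

(** Division of [Y(qx, x) - Y(x, x)] by [(q - 1) x] through [anU_quot] shows at once that the matrix
    of [sigma_q] has entries in H_K(X) and that [H_1] has no pole at 0. *)
Lemma cocycle_qmatrix q : tau X q < rho -> exists H1 : 'M[anel]_n,
  forall x, eval_mx (1%:M + qd C X q *: H1) x = Y (qpt q x) x.
Proof.
move=> qr.
have /choice[h hh] ij : exists h : anel, forall x,
    qd C X q x * h x = Y (qpt q x) x ij.1 ij.2 - a 0%N ij.1 ij.2 x.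
  exact: (anU_qquot rhoX (Ya ij.1 ij.2) qr).
exists (\matrix_(i, j) h (i, j)) => x; apply/matrixP => i j.
rewrite eval_mxD eval_mxZ eval_mx1 !mxE hh /= (cocycle_coef0 rho0 Ya Yc).
by rewrite addrC subrK.
Qed.

Lemma cocycle_qsol q (A : 'M[anel]_n) : tau X q < rho ->
  (forall x, eval_mx A x = Y (qpt q x) x) -> q_solution rho q A Y.
Proof.
move=> qr AE x y x' x'x xy; have qrX := lt_le_trans qr rhoX.
rewrite (qpt_eq qrX x'x) AE; apply: Yc.2 => //.
exact: le_lt_trans (qpt_dist x qrX) qr.
Qed.

Variables (q : K) (A H1 : 'M[anel]_n).
Hypotheses (qr : tau X q < rho) (qN : ~ unity_root q).
Hypothesis AE : forall x, eval_mx A x = Y (qpt q x) x.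
Hypothesis H1E : qd C X q *: H1 = A - 1%:M.

Let qrX : tau X q < rX := lt_le_trans qr rhoX.
Local Notation qi := (iota q).
Local Notation H := (q_taylor q H1).

Let qiN : ~ unity_root qi.
Proof. by move/unity_root_iota. Qed.

(** Since [(q - 1) T d_q = sigma_q - 1] and [(q - 1) T H_1 = A - 1], the recursion loses its
    denominators. *)
Lemma q_taylor_rec k : qd C X q *: H k.+1 = map_mx (sigma q) (H k) *m A - H k.
Proof.
rewrite /= scalerDr scalemxAr H1E mulmxBr mulmx1.
have -> : qd C X q *: map_mx (dq q) (H k) = map_mx (sigma q) (H k) - H k.
  by apply/matrixP => i j; rewrite !mxE (dqE v_complete v_mixed).
by rewrite addrC addrA subrK.
Qed.

Lemma q_taylor_eval k y : eval_mx (H k) (qpt q y) *m eval_mx A y =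
  eval_mx (H k) y + (iota (q - 1) * val y) *: eval_mx (H k.+1) y.
Proof.
rewrite -qdE -eval_mxZ q_taylor_rec eval_mxB eval_mxM eval_mx_sigma //.
by rewrite addrC subrK.
Qed.

Definition q_newton (x y : C) k := q_poch qi x y k / q_fact qi k.

(** Induction through [Y(q^(k+1) y, y) = Y(q^(k+1) y, q y) A(y)], the hypothesis being applied at
    the base point [q y]. The sum stops at [k] because the symbols of higher index vanish at
    [q^k y]. *)
Lemma q_orbit k y : Y (iter k (qpt q) y) y =
  \sum_(j < k.+1) q_newton (val (iter k (qpt q) y)) (val y) j *: eval_mx (H j) y.
Proof.
elim: k y => [|k IH] y.
  rewrite big_ord1 /= Yc.1 eval_mx1 /q_newton /q_poch /q_fact big_ord0.
  by rewrite big_geq // divr1 scale1r.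
have yq : w (val (qpt q y) - val y) < rho := le_lt_trans (qpt_dist y qrX) qr.
have xq : w (val (iter k.+1 (qpt q) y) - val (qpt q y)) < rho.
  by rewrite iterSr; apply: le_lt_trans qr; exact: iter_qpt_dist.
rewrite (Yc.2 _ _ _ xq yq) -AE iterSr IH.
set x := val (iter k (qpt q) y).
have xk : x = qi ^+ k * val y by rewrite /x iter_qpt.
have xS : val (iter k (qpt q) (qpt q y)) = qi * x.
  by rewrite -iterSr iterS val_qpt.
rewrite xS val_qpt // mulmx_suml.
(* [x = q^k y] is a zero of the symbol of index [k + 1], so both sums below can run over the same
   range. *)
have newton0 : q_newton x (val y) k.+1 = 0.
  by rewrite /q_newton q_poch_recr xk subrr mulr0 mul0r.
pose d := iota (q - 1) * val y.
transitivity (\sum_(i < k.+1) (qi ^+ i * q_newton x (val y) i) *: eval_mx (H i) y +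
   \sum_(i < k.+1) (d * (qi ^+ i * q_newton x (val y) i)) *: eval_mx (H i.+1) y).
  rewrite -big_split /=; apply: eq_bigr => i _.
  rewrite -scalemxAl q_taylor_eval scalerDr scalerA /q_newton q_poch_mul -mulrA.
  by congr (_ + _ *: _); rewrite mulrC.
rewrite [RHS]big_ord_recl [X in X + _ = _]big_ord_recl -addrA; congr (_ + _).
  by rewrite /= /q_newton /q_poch !big_ord0 expr0 mul1r.
have -> : \sum_(i < k) (qi ^+ (lift ord0 i) * q_newton x (val y) (lift ord0 i)) *: eval_mx (H (lift ord0 i)) y =
  \sum_(i < k.+1) (qi ^+ i.+1 * q_newton x (val y) i.+1) *: eval_mx (H i.+1) y.
  by rewrite [RHS]big_ord_recr /= newton0 mulr0 scale0r addr0.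
rewrite -big_split /=; apply: eq_bigr => i _; rewrite -scalerDl; congr (_ *: _).
rewrite /q_newton /bump /= add1n q_newton_rec //.
by rewrite /d rmorphB rmorph1.
Qed.

Section Nonzero.
Variables (y : points) (i j : 'I_n).
Hypothesis y0 : val y != 0.

(** The interpolation nodes are the displacements of [q^k y] from [y]: at most [|s| <= tau_q < rho],
    and distinct because [y != 0] and [q] is not a root of unity. *)
Let beta k := (qi ^+ k - 1) * val y.
Let s := (qi - 1) * val y.
Let c k := H k i j y / q_fact qi k.

Let beta_le k : w (beta k) <= w s.
Proof.
rewrite /beta /s !uabsM ler_wpM2r ?uabs_ge0 //.
have := uabs_expr_sub1 k (tau_lt1 qrX).
by rewrite -!(ac_extends C) !rmorphB rmorphXn rmorph1.
Qed.

Let s_lt : w s < rho.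
Proof. by rewrite /s -(rmorph1 iota) -rmorphB; apply: le_lt_trans qr; exact: q1_points. Qed.

Let npolyE (x : C) k : newton_poly beta (x - val y) k = q_poch qi x (val y) k.
Proof.
apply: eq_bigr => l _; rewrite /beta mulrBl mul1r.
by rewrite opprB addrA subrK.
Qed.

Let orbitE k : beta k + val y = val (iter k (qpt q) y).
Proof. by rewrite iter_qpt // /beta mulrBl mul1r subrK. Qed.

Let betaE k : beta k = val (iter k (qpt q) y) - val y.
Proof. by rewrite -orbitE addrK. Qed.

Let newton_poly_neq0 k : newton_poly beta (beta k) k != 0.
Proof.
apply/prodf_neq0 => l _; rewrite /beta -mulrBl mulf_neq0 //.
rewrite opprB addrA subrK subr_eq0; apply/eqP => E.
have qi0 : qi != 0.
  apply/eqP => q0; have := tau_lt1 qrX; rewrite -(ac_extends C) rmorphB rmorph1 q0.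
  by rewrite sub0r uabsN uabs1 ltxx.
apply: qiN; exists (k - l)%N; first by rewrite subn_gt0.
apply: (mulIf (expf_neq0 l qi0)); rewrite mul1r -exprD subnK //.
exact/ltnW/ltn_ord.
Qed.

Let Yps : ps w rho (fun h => Y (pshift y h) y i j) (fun k => a k i j y).
Proof. by case: (Ya i j). Qed.

Let Yorbit k : Y (pshift y (beta k)) y i j = \sum_(l < k.+1) c l * newton_poly beta (beta k) l.
Proof.
rewrite betaE pshift_sub q_orbit summxE; apply: eq_bigr => l _.
by rewrite mxE eval_mxE npolyE /q_newton /c; ring.
Qed.

Lemma q_taylor_nonzero x : w (val x - val y) < rho ->
  wlim w \oo (fun N => \sum_(k < N) c k * q_poch qi (val x) (val y) k) (Y x y i j).
Proof.
move=> xy; have := newton_series beta_le Yps s_lt newton_poly_neq0 Yorbit xy.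
rewrite pshift_sub; apply: wlim_ext => N; apply: eq_bigr => k _.
by rewrite npolyE.
Qed.

Lemma q_taylor_coef_dist k (B : R) : 0 <= B ->
  (forall m, (k < m)%N -> w (a m i j y) * w ((qi - 1) * val y) ^+ (m - k) <= B) ->
  w (H k i j y / q_fact qi k - a k i j y) <= B.
Proof. exact: (newton_coef_dist beta_le Yps s_lt newton_poly_neq0 Yorbit). Qed.

End Nonzero.

(** At a point [y = 0] the coefficients are compared by continuity. *)
Lemma q_taylor_zero y i j k : val y = 0 -> H k i j y / q_fact qi k = a k i j y.
Proof.
move=> y0; apply/eqP; rewrite -subr_eq0; apply/eqP.
have lim1 : wlim w (dn0 w) (fun h => H k i j (pshift y h) / q_fact qi k - a k i j (pshift y h))
    (H k i j y / q_fact qi k - a k i j y).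
  exact: (wlimB (wlimM (anel_cont _ y) (wlim_cst w _)) (anel_cont _ y)).
apply: (wlim_uniq lim1) => e e0.
pose r' := rho / 2; have r'0 : 0 < r' by rewrite divr_gt0.
have r'r : r' < rho by rewrite ltr_pdivrMr // ltr_pMr // ltr1n.
have [abd _] := Ya i j.
have [B B0 hB] := abd r' (introT andP (conj r'0 r'r)).
have r'k : 0 < r' ^+ k by rewrite exprn_gt0.
(* For [|h| < r'] and [m > k] one has [|a_m| |h|^(m-k) <= |a_m| r'^m |h| / r'^(k+1) <= B |h| /
   r'^(k+1)], and this is to be less than [e]. *)
exists (Num.min r' (e * r' ^+ k.+1 / B)).
  by rewrite lt_min r'0 divr_gt0 ?mulr_gt0 ?exprn_gt0.
move=> h /andP[h0]; rewrite lt_min => /andP[hr' hB'] /=; rewrite subr0.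
have hrX : w h < rX := lt_le_trans (lt_trans hr' r'r) rhoX.
have vh : val (pshift y h) = h by rewrite val_pshift // y0 add0r.
have sh : w ((qi - 1) * h) <= w h.
  rewrite uabsM ler_piMl ?uabs_ge0 // -(rmorph1 iota) -rmorphB ac_extends.
  exact: ltW (tau_lt1 qrX).
apply: le_lt_trans (_ : B * w h / r' ^+ k.+1 < e); last first.
  by rewrite ltr_pdivrMr ?exprn_gt0 // mulrC -ltr_pdivlMr.
have h_neq0 : h != 0 by rewrite -(uabs_gt0 w).
apply: q_taylor_coef_dist => [||m km]; first by rewrite vh.
  by rewrite divr_ge0 ?mulr_ge0 ?uabs_ge0 ?exprn_ge0 // ltW.
rewrite vh ler_pdivlMr ?exprn_gt0 //.
rewrite -(subnSK km) exprS; apply: le_trans (_ : w (a m i j (pshift y h)) * (w h * r' ^+ (m - k.+1)) * r' ^+ k.+1 <= _).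
  rewrite ler_wpM2r ?exprn_ge0 ?(ltW r'0) // ler_wpM2l ?uabs_ge0 //.
  rewrite ler_pM ?uabs_ge0 ?exprn_ge0 ?uabs_ge0 // lerXn2r ?nnegrE ?uabs_ge0 ?(ltW r'0) //.
  exact: le_trans sh (ltW hr').
have -> : w (a m i j (pshift y h)) * (w h * r' ^+ (m - k.+1)) * r' ^+ k.+1 =
    w (a m i j (pshift y h)) * r' ^+ m * w h.
  have -> : r' ^+ m = r' ^+ (m - k.+1) * r' ^+ k.+1 by rewrite -exprD subnK.
  by move: (w _) (w h) (r' ^+ _) (r' ^+ _) => *; ring.
by rewrite ler_wpM2r ?uabs_ge0.
Qed.

Lemma cocycle_q_taylor : is_q_taylor_solution rho q A Y.
Proof.
exists H1; split=> // x y xy i j; apply/wlim_seqP.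
have T k : ((q_poch qi (val x) (val y) k / q_fact qi k) *: eval_mx (H k) y) i j =
    H k i j y / q_fact qi k * q_poch qi (val x) (val y) k.
  by rewrite !mxE; ring.
have [y0|y0] := eqVneq (val y) 0; last first.
  apply: wlim_ext (q_taylor_nonzero i j y0 xy) => N.
  by apply: eq_bigr => k _; rewrite T.
(* At [y = 0] the q-Pochhammer symbols are the powers [x^k], so the q-series is the power series of
   [Y] itself. *)
have [_ /(_ y _ xy)] := Ya i j; rewrite pshift_sub y0.
apply: wlim_ext => N; apply: eq_bigr => k _; rewrite -[in RHS]y0 T q_taylor_zero //.
congr (_ * _); rewrite y0 /q_poch subr0.
under eq_bigr do rewrite mulr0 subr0.
by rewrite prodr_const card_ord.
Qed.

End QTaylor.

(** * Matrices of semilinear maps and connections on free modules *)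

Section FreeModules.
Variables (R : realType) (p : nat) (K : fieldType) (v : ultrabs R K).
Hypotheses (v_complete : complete_abs v) (v_mixed : mixed_char v p).
Variables (C : alg_closure v) (X : affinoid v).
Local Notation w := (ac_abs C).
Local Notation points := (points C X).
Local Notation anel := (anel C X).
Local Notation rX := (min_rad X).
Local Notation D := (@deriv_anel R K v C X).
Local Notation TX := (anel_poly C X 'X).
Implicit Types (f g : anel) (x y : points) (q : K).

(** Coordinates are row vectors: with the convention [f(e_i) = \sum_j a_ij e_j] matrices act on the
    right. *)
Definition lincomb (M : lmodType anel) n (e : 'I_n -> M) (a : 'rV[anel]_n) : M :=
  \sum_i a 0 i *: e i.

Section Lincomb.
Variables (M : lmodType anel) (n : nat) (e : 'I_n -> M).
Implicit Types a b : 'rV[anel]_n.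

Lemma lincombD a b : lincomb e (a + b) = lincomb e a + lincomb e b.
Proof.
by rewrite -big_split /=; apply: eq_bigr => i _; rewrite mxE scalerDl.
Qed.

Lemma lincombZ c a : lincomb e (c *: a) = c *: lincomb e a.
Proof.
by rewrite /lincomb scaler_sumr; apply: eq_bigr => i _; rewrite mxE scalerA.
Qed.

Lemma lincomb0 : lincomb e 0 = 0.
Proof. by rewrite /lincomb big1 // => i _; rewrite mxE scale0r. Qed.

Lemma lincomb_sum (I : Type) (r : seq I) (P : pred I) (F : I -> 'rV[anel]_n) :
  lincomb e (\sum_(i <- r | P i) F i) = \sum_(i <- r | P i) lincomb e (F i).
Proof. exact: (big_morph _ lincombD lincomb0). Qed.

Lemma lincomb_row m (A : 'M[anel]_(m, n)) i : lincomb e (row i A) = \sum_j A i j *: e j.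
Proof. by apply: eq_bigr => j _; rewrite mxE. Qed.

Lemma lincomb_delta i : lincomb e (delta_mx 0 i) = e i.
Proof.
rewrite /lincomb (bigD1 i) //= big1 => [|j ji]; last first.
  by rewrite mxE (negPf ji) andbF scale0r.
by rewrite mxE !eqxx scale1r addr0.
Qed.

Hypothesis eB : is_basis e.

Lemma lincomb_inj : injective (lincomb e).
Proof.
move=> a b ab; have [c [_ cu]] := eB (lincomb e a).
by rewrite -(cu a) // -(cu b).
Qed.

Definition basis_coord (m : M) : 'rV[anel]_n :=
  xget 0 [set a : 'rV[anel]_n | m = lincomb e a].

Lemma basis_coordK m : lincomb e (basis_coord m) = m.
Proof.
rewrite /basis_coord; case: xgetP => [a _ //|no].
by have [a [ma _]] := eB m; case: (no a).
Qed.

Lemma basis_coord_lincomb a : basis_coord (lincomb e a) = a.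
Proof. by apply: lincomb_inj; rewrite basis_coordK. Qed.

Lemma basis_coordD m m' : basis_coord (m + m') = basis_coord m + basis_coord m'.
Proof. by apply: lincomb_inj; rewrite lincombD !basis_coordK. Qed.

Lemma basis_coordZ c m : basis_coord (c *: m) = c *: basis_coord m.
Proof. by apply: lincomb_inj; rewrite lincombZ !basis_coordK. Qed.

Lemma basis_coord_basis i : basis_coord (e i) = delta_mx 0 i.
Proof. by rewrite -[in LHS](lincomb_delta i) basis_coord_lincomb. Qed.

End Lincomb.

Definition is_mx (M N : lmodType anel) m n (e : 'I_m -> M) (e' : 'I_n -> N)
    (phi : M -> N) (A : 'M[anel]_(m, n)) : Prop :=
  forall i, phi (e i) = lincomb e' (row i A).

Lemma is_matrix_ofE (M : lmodType anel) n (e : 'I_n -> M) (phi : M -> M) A :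
  is_matrix_of e phi A <-> is_mx e e phi A.
Proof. by split=> h i; rewrite h lincomb_row. Qed.

Section Matrices.
Variables (M N : lmodType anel) (m n : nat) (e : 'I_m -> M) (e' : 'I_n -> N).
Hypotheses (eB : is_basis e) (eB' : is_basis e').

Lemma exists_mx (phi : M -> N) : exists A, is_mx e e' phi A.
Proof.
exists (\matrix_(i, j) basis_coord e' (phi (e i)) 0 j) => i.
rewrite -{1}(basis_coordK eB' (phi (e i))); congr lincomb.
by apply/rowP => j; rewrite !mxE.
Qed.

Lemma is_mx_uniq (phi : M -> N) A B : is_mx e e' phi A -> is_mx e e' phi B -> A = B.
Proof.
by move=> hA hB; apply/row_matrixP => i; apply: (lincomb_inj eB'); rewrite -hA -hB.
Qed.

Lemma mx_semilinear (s : anel -> anel) (phi : M -> N) A a :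
  (forall m m', phi (m + m') = phi m + phi m') ->
  (forall c m, phi (c *: m) = s c *: phi m) -> is_mx e e' phi A ->
  phi (lincomb e a) = lincomb e' (map_mx s a *m A).
Proof.
move=> phiD phiZ hA; have phi0 : phi 0 = 0.
  by apply: (addrI (phi 0)); rewrite -phiD !addr0.
rewrite /lincomb (big_morph phi phiD phi0) -/(lincomb e' _).
rewrite mulmx_sum_row lincomb_sum; apply: eq_bigr => i _.
by rewrite phiZ hA lincombZ mxE.
Qed.

End Matrices.

Lemma linear_add (M N : lmodType anel) (phi : M -> N) : linear phi ->
  forall m m', phi (m + m') = phi m + phi m'.
Proof. by move=> lphi m m'; have := lphi 1 m m'; rewrite !scale1r. Qed.

Lemma linear_scale (M N : lmodType anel) (phi : M -> N) : linear phi ->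
  forall c m, phi (c *: m) = c *: phi m.
Proof.
move=> lphi c m; have phiD := linear_add lphi; have phi0 : phi 0 = 0.
  by apply: (addrI (phi 0)); rewrite -phiD !addr0.
by have := lphi c m 0; rewrite phi0 !addr0.
Qed.

Lemma mx_linear (M N : lmodType anel) m n (e : 'I_m -> M) (e' : 'I_n -> N)
    (phi : M -> N) A a : linear phi -> is_mx e e' phi A ->
  phi (lincomb e a) = lincomb e' (a *m A).
Proof.
move=> lphi hA; rewrite (mx_semilinear (s := id) a (linear_add lphi) (linear_scale lphi) hA).
by congr (lincomb _ (_ *m _)); apply/matrixP => i j; rewrite mxE.
Qed.

Lemma map_sigmaM q m n k (A : 'M[anel]_(m, n)) (B : 'M[anel]_(n, k)) : tau X q < rX ->
  map_mx (sigma q) (A *m B) = map_mx (sigma q) A *m map_mx (sigma q) B.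
Proof.
move=> qr; apply: eval_mx_inj => x.
by rewrite eval_mxM !eval_mx_sigma // eval_mxM.
Qed.

Lemma mx_bounded m n (A : 'M[anel]_(m, n)) :
  exists2 B : R, 0 < B & forall i j x, w (A i j x) <= B.
Proof.
have /choice[B hB] ij : exists B : R, 0 < B /\ forall x, w (A ij.1 ij.2 x) <= B.
  by have [B B0 hB] := anel_bounded (A ij.1 ij.2); exists B.
have S0 (P : pred ('I_m * 'I_n)) : 0 <= \sum_(ij | P ij) B ij.
  by apply: sumr_ge0 => ij _; case: (hB ij) => /ltW.
exists (1 + \sum_ij B ij) => [|i j x]; first by rewrite ltr_pwDl.
apply: le_trans ((hB (i, j)).2 x) _.
by rewrite (bigD1 (i, j)) //= addrCA lerDl addr_ge0.
Qed.

(** Continuity is automatic: [sigma q] only moves the point of evaluation, so it does not increase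
    the sup-norm, and the matrix of [phi] is bounded. The factor 1/2 restores a strict inequality
    after taking the supremum. *)
Lemma semilinear_continuous (M : lmodType anel) (phi : M -> M) q : tau X q < rX ->
  (forall m m', phi (m + m') = phi m + phi m') ->
  (forall c m, phi (c *: m) = sigma q c *: phi m) -> continuous_endo phi.
Proof.
move=> qr phiD phiZ n e eB m eps eps0; have [A hA] := exists_mx e eB phi.
have [B B0 hB] := mx_bounded A.
have d0 : 0 < eps / 2 / B by rewrite !divr_gt0.
exists (eps / 2 / B) => // m' [a [ma ha]].
exists (map_mx (sigma q) a *m A); split.
  have -> : phi m' - phi m = phi (m' - m).
    by apply/eqP; rewrite subr_eq -phiD subrK.
  by rewrite ma; exact: mx_semilinear phiD phiZ hA.
move=> j; apply: le_lt_trans (_ : eps / 2 < _); last first.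
  by rewrite ltr_pdivrMr // ltr_pMr // ltr1n.
apply: supnorm_le => [|x]; first by rewrite divr_ge0 // ltW.
rewrite mxE anel_fun_sum; apply: uabs_sum_le => [|i _]; first by rewrite divr_ge0 // ltW.
rewrite anel_funM uabsM mxE sigma_qpt // -(divfK (lt0r_neq0 B0) (eps / 2)).
rewrite ler_pM ?uabs_ge0 //; apply: le_trans (ltW (ha i)).
exact: supnorm_ub.
Qed.

Lemma map_derivMr m n k (A : 'M[anel]_(m, n)) (B : 'M[anel]_(n, k)) :
  map_mx D (A *m B) = map_mx D A *m B + A *m map_mx D B.
Proof.
apply/matrixP => i j; rewrite !mxE.
rewrite (big_morph D (deriv_anelD v_complete v_mixed (C := C) (X := X)) (deriv_anel0 v_complete v_mixed _ _)).
by rewrite -big_split /=; apply: eq_bigr => l _; rewrite (deriv_anelM v_complete v_mixed) !mxE.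
Qed.

Lemma mx_connection (M : lmodType anel) n (e : 'I_n -> M) (phi : M -> M) G a :
  (forall m m', phi (m + m') = phi m + phi m') ->
  (forall c m, phi (c *: m) = delta1 c *: m + c *: phi m) -> is_mx e e phi G ->
  phi (lincomb e a) = lincomb e (TX *: map_mx D a + a *m G).
Proof.
move=> phiD phiZ hG; have phi0 : phi 0 = 0.
  by apply: (addrI (phi 0)); rewrite -phiD !addr0.
rewrite lincombD /lincomb (big_morph phi phiD phi0) -!/(lincomb e _).
rewrite mulmx_sum_row lincomb_sum -big_split /=; apply: eq_bigr => i _.
by rewrite phiZ hG lincombZ !mxE.
Qed.

End FreeModules.

Section Gen.
Variables (R : realType) (K : fieldType) (v : ultrabs R K) (X : affinoid v).

Lemma uabs_eq1 (q : K) : v (q - 1) < 1 -> v q = 1.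
Proof.
move=> q1; apply/eqP; rewrite eq_le -{1}(subrK 1 q) uabs_add_le ?uabs1 ?(ltW q1) //=.
rewrite leNgt; apply/negP => lt1; have := ltxx (1 : R).
by rewrite -{1}(uabs1 v) -(subKr q 1) uabs_sub_lt.
Qed.

(** The disc is a multiplicative group: as [rho <= r_X <= max(|c_0|, R_0)], its elements satisfy
    [|q - 1| < 1], hence [|q| = 1]. *)
Lemma gen_tau (S : set K) rho q : rho <= min_rad X -> 0 < rho ->
  (forall q, S q -> tau X q < rho) -> gen S q -> tau X q < rho.
Proof.
move=> rhoX rho0 hS; have lt1 t : tau X t < rho -> v (t - 1) < 1.
  by move=> tr; apply: tau_lt1; exact: lt_le_trans rhoX.
elim=> [t /hS //||t t' _ ht _ ht'|t _ ht].
- by rewrite /tau subrr uabs0 mul0r.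
- have -> : tau X (t * t') = v ((t - 1) * t' + (t' - 1)) * max_norm X.
    by rewrite /tau; congr (v _ * _); ring.
  rewrite -ltr_pdivlMr ?max_norm_gt0 // uabs_add_lt ?ltr_pdivlMr ?max_norm_gt0 //.
  by rewrite uabsM (uabs_eq1 (lt1 _ ht')) mulr1.
- have t1 := uabs_eq1 (lt1 _ ht).
  have t0 : t != 0 by rewrite -(uabs_gt0 v) t1.
  suff -> : tau X t^-1 = tau X t by [].
  rewrite /tau; congr (_ * _).
  have -> : t^-1 - 1 = - (t - 1) / t by field.
  by rewrite uabsM uabsN uabsV t1 invr1 mulr1.
Qed.

End Gen.

(** * Cocycle solutions of modules, and matrices intertwining them *)

Section Good.
Variables (R : realType) (p : nat) (K : fieldType) (v : ultrabs R K).
Hypotheses (v_complete : complete_abs v) (v_mixed : mixed_char v p).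
Variables (C : alg_closure v) (X : affinoid v).
Local Notation w := (ac_abs C).
Local Notation points := (points C X).
Local Notation anel := (anel C X).
Local Notation rX := (min_rad X).
Local Notation D := (@deriv_anel R K v C X).
Local Notation TX := (anel_poly C X 'X).
Implicit Types (f g : anel) (x y : points) (q : K).


(** [Y(x, y) = \sum_k a_k(y) (x - y)^k] is a solution, on [U_rho], of all the
    equations of [M] in the basis [e], with [Y(x, x) = 1]; the matrix of [sigma_q] is
    then [Y(qx, x)] and that of [d/dT] is [a_1]. *)
Definition solves (S : set K) (M : smod C X S) n (e : 'I_n -> M) (rho : R)
    (Y : points -> points -> 'M[C]_n) (a : nat -> 'M[anel]_n) : Prop :=
  [/\ is_basis e, 0 < rho <= rX, analytic_on_U rho Y /\ anUm rho Y a, cocycle rho Y &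
   forall q, S q -> tau X q < rho /\ forall (h : gen S q) A,
     is_mx e e (smod_op h) A -> forall x, eval_mx A x = Y (qpt q x) x].

Definition solves_delta (S : set K) (M : sdmod C X S) n (e : 'I_n -> M)
    (a : nat -> 'M[anel]_n) : Prop :=
  forall G, is_mx e e (@sdmod_delta _ _ _ _ _ S M) G -> G = TX *: a 1%N.

Lemma series_cvg_head n (u : nat -> 'M[C]_n) l :
  series_cvg u l -> (forall k, (0 < k)%N -> u k = 0) -> l = u 0%N.
Proof.
move=> ul u0; apply/matrixP => i j; apply: (wlim_uniq (iffRL (wlim_seqP _ _ _) (ul i j))).
move=> e e0; exists 1%N => // -[//|N] _ /=; rewrite big_ord_recl big1 ?addr0.
  by rewrite subrr uabs0.
by move=> k _; rewrite u0 // mxE.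
Qed.

(** Every q-Pochhammer symbol of positive index contains the factor [x - y], which is 0 on the
    diagonal. *)
Lemma q_taylor_diag n rho q (A : 'M[anel]_n) (Y : points -> points -> 'M[C]_n) :
  0 < rho -> is_q_taylor_solution rho q A Y -> forall x, Y x x = 1%:M.
Proof.
move=> rho0 [H1 [_ hY]] x; have xx : w (val x - val x) < rho by rewrite subrr uabs0.
rewrite (series_cvg_head (hY x x xx)) => [|k k0].
  by rewrite eval_mx1 /q_poch /q_fact big_ord0 big_geq // divr1 scale1r.
case: k k0 => // k _.
by rewrite /q_poch big_ord_recl mul1r subrr mul0r mul0r scale0r.
Qed.

Lemma sigma_taylor_solves (S : set K) (M : smod C X S) r q :
  0 < r -> S q -> ~ unity_root q -> sigma_taylor r M ->
  exists n (e : 'I_n -> M) rho Y a, solves e rho Y a /\ r <= rho.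
Proof.
move=> r0 Sq qN [Sr [n [e [rho [Y [eB /andP[r_rho rhoX] Yan hY]]]]]].
have rho0 : 0 < rho := lt_le_trans r0 r_rho.
have [a Ya] := analytic_anUm rhoX Yan.
have St t : S t -> tau X t < rho by move=> /Sr /disc1E tr; exact: lt_le_trans r_rho.
have [A hA] := exists_mx e eB (smod_op (gen_in Sq)).
have /is_matrix_ofE hA' := hA.
have [/(_ qN) hT hq] := hY q (gen_in Sq) A Sq hA'.
have Y1 := q_taylor_diag rho0 hT.
have Yc : cocycle rho Y.
  apply: (cocycle_q v_complete v_mixed rhoX Ya Y1 (A := eval_mx A) qN (St q Sq)) => x y xy.
  by apply: hq => //; apply: val_qpt; exact: lt_le_trans (St q Sq) rhoX.
exists n, e, rho, Y, a; split=> //; split=> //; first by rewrite rho0.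
move=> t S_t; split=> [|h B /is_matrix_ofE hB x]; first exact: St.
have [_ ht] := hY t h B S_t hB.
(* Taking [y = x] in [Y(tx, y) = A(t, x) Y(x, y)] reads off the matrix; this includes the roots of
   unity [t] in [S]. *)
rewrite (ht x x) ?Y1 ?mulmx1 ?subrr ?uabs0 // val_qpt //.
exact: lt_le_trans (St t S_t) rhoX.
Qed.

Lemma sigma_delta_taylor_solves (S : set K) (M : sdmod C X S) r :
  0 < r -> sigma_delta_taylor r M ->
  exists n (e : 'I_n -> M) rho Y a,
    [/\ solves (M := sdmod_smod M) e rho Y a, solves_delta e a & r <= rho].
Proof.
move=> r0 [Sr [n [e [rho [Y [eB /andP[r_rho rhoX] Yan hd hq]]]]]].
have rho0 : 0 < rho := lt_le_trans r0 r_rho.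
have [a Ya] := analytic_anUm rhoX Yan.
have St t : S t -> tau X t < rho by move=> /Sr /disc1E tr; exact: lt_le_trans r_rho.
have [G hG] := exists_mx e eB (@sdmod_delta _ _ _ _ _ S M).
have /is_matrix_ofE hG' := hG.
have [G1 [G1E hs]] := hd G hG'.
have Yc := d_series_cocycle v_complete v_mixed rho0 rhoX Ya hs.
exists n, e, rho, Y, a; split=> //; last first.
  move=> B hB; rewrite (is_mx_uniq eB hB hG) -G1E.
  by rewrite (d_series_coef1 v_complete v_mixed rho0 rhoX Ya hs).
split=> //; first by rewrite rho0.
move=> t S_t; split=> [|h B /is_matrix_ofE hB x]; first exact: St.
have ht := hq t h B S_t hB.
rewrite (ht x x) ?Yc.1 ?mulmx1 ?subrr ?uabs0 // val_qpt //.
exact: lt_le_trans (St t S_t) rhoX.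
Qed.

Lemma solves_sigma_taylor (S : set K) (M : smod C X S) r n (e : 'I_n -> M) rho Y a :
  solves e rho Y a -> S `<=` disc1 X r -> r <= rho -> sigma_taylor r M.
Proof.
move=> [eB /andP[rho0 rhoX] [Yan Ya] Yc hS] Sr r_rho; split=> //.
exists n, e, rho, Y; split=> //; first by rewrite r_rho.
move=> q h A Sq /is_matrix_ofE hA; have [qr hq] := hS q Sq; have AE := hq h A hA.
split; last exact: cocycle_qsol qr AE.
move=> qN; have [H1 H1E] := cocycle_qmatrix rho0 rhoX Ya Yc qr.
apply: (cocycle_q_taylor v_complete v_mixed rho0 rhoX Ya Yc qr qN AE (H1 := H1)).
have -> : A = 1%:M + qd C X q *: H1 by apply: eval_mx_inj => x; rewrite AE H1E.
by rewrite addrC addKr.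
Qed.

Lemma solves_sigma_delta_taylor (S : set K) (M : sdmod C X S) r n (e : 'I_n -> M) rho Y a :
  solves (M := sdmod_smod M) e rho Y a -> solves_delta e a ->
  S `<=` disc1 X r -> r <= rho -> sigma_delta_taylor r M.
Proof.
move=> [eB /andP[rho0 rhoX] [Yan Ya] Yc hS] hd Sr r_rho; split=> //.
exists n, e, rho, Y; split=> //; first by rewrite r_rho.
- move=> G /is_matrix_ofE hG; exists (a 1%N); split; first by rewrite (hd G hG).
  exact: (cocycle_d_series v_complete v_mixed rho0 rhoX Ya Yc erefl).
- move=> q h A Sq /is_matrix_ofE hA; have [qr hq] := hS q Sq.
  exact: cocycle_qsol qr (hq h A hA).
Qed.

Section Morphisms.
Variables (n n' : nat) (rho rho' : R).
Variables (Y : points -> points -> 'M[C]_n) (a : nat -> 'M[anel]_n).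
Variables (Y' : points -> points -> 'M[C]_n') (a' : nat -> 'M[anel]_n').
Hypotheses (rhoP : 0 < rho <= rX) (rhoP' : 0 < rho' <= rX).
Hypotheses (Ya : anUm rho Y a) (Ya' : anUm rho' Y' a').
Hypotheses (Yc : cocycle rho Y) (Yc' : cocycle rho' Y').
Variable F : 'M[anel]_(n, n').

Let r0 := Num.min rho rho'.

Let r0_gt0 : 0 < r0.
Proof. by rewrite lt_min; case/andP: rhoP => ->; case/andP: rhoP' => ->. Qed.

Let r0X : r0 <= rX.
Proof. by rewrite ge_min; case/andP: rhoP => _ ->. Qed.

Let rhoX : rho <= rX. Proof. by case/andP: rhoP. Qed.
Let rhoX' : rho' <= rX. Proof. by case/andP: rhoP'. Qed.

Let ltr0 (t : R) : t < r0 -> t < rho /\ t < rho'.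
Proof. by rewrite lt_min => /andP. Qed.

(** Phrased with the solutions alone, without any operator, so that it can mediate between [sigma_q]
    for different [q] and the connection. *)
Definition intertwines : Prop := forall x y, w (val x - val y) < r0 ->
  eval_mx F x *m Y' x y = Y x y *m eval_mx F y.

Let W y x := eval_mx F x *m Y' x y - Y x y *m eval_mx F y.

Let an_weaken (s s' : R) (g : C -> C) : s <= s' -> an w s' g -> an w s g.
Proof. by move=> ss [b hb]; exists b => z zs; apply: hb; exact: lt_le_trans ss. Qed.

Let W_an y i j : an w r0 (fun z => W y (pshift y z) i j).
Proof.
have r0r : r0 <= rho by rewrite ge_min lexx.
have r0r' : r0 <= rho' by rewrite ge_min lexx orbT.
have h1 := an_sum (index_enum 'I_n') (fun l (_ : true) =>
  anM (an_weaken r0X (anel_an v_complete v_mixed (F i l) y)) (an_weaken r0r' (anUm_an Ya' y l j))).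
have h2 := an_sum (index_enum 'I_n) (fun l (_ : true) =>
  anM (an_weaken r0r (anUm_an Ya y i l)) (an_cst w r0 (F l j y))).
apply: an_ext (anB h1 h2) => z _; rewrite !mxE; congr (_ - _).
  by apply: eq_bigr => l _; rewrite mxE.
by apply: eq_bigr => l _; rewrite mxE.
Qed.

Let W_diag y : W y y = 0.
Proof. by rewrite /W Yc.1 Yc'.1 mulmx1 mul1mx subrr. Qed.

Let W_intertwines : (forall x y, w (val x - val y) < r0 -> W y x = 0) -> intertwines.
Proof. by move=> h x y xy; apply/eqP; rewrite -subr_eq0; apply/eqP/h. Qed.

Lemma intertwines_q q (A : 'M[anel]_n) (A' : 'M[anel]_n') :
  ~ unity_root q -> tau X q < r0 ->
  (forall x, eval_mx A x = Y (qpt q x) x) -> (forall x, eval_mx A' x = Y' (qpt q x) x) ->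
  A *m F = map_mx (sigma q) F *m A' -> intertwines.
Proof.
move=> qN qr AE AE' AF; have [qr1 qr2] := ltr0 qr; have qrX := lt_le_trans qr r0X.
have c1 x y : val y != 0 -> w (val x - val y) < r0 ->
    eval_mx F x *m Y' x y = Y x y *m eval_mx F y.
  move=> y0 xy; apply/eqP; rewrite -subr_eq0; apply/eqP.
  apply: (q_uniq v_mixed (A := eval_mx A) (W := W y) r0X qr qN y0) xy => [i j|t ty|].
  - exact: W_an.
  - have [ty1 ty2] := ltr0 ty.
    have qt : w (val (qpt q t) - val t) < r0 := le_lt_trans (qpt_dist t qrX) qr.
    have [qt1 qt2] := ltr0 qt.
    rewrite /W mulmxBr !mulmxA -eval_mxM AF eval_mxM eval_mx_sigma // AE' AE.
    by rewrite -(mulmxA _ _ (Y' t y)) -(Yc'.2 _ _ _ qt2 ty2) -(Yc.2 _ _ _ qt1 ty1).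
  - exact: W_diag.
move=> x y xy; have [y0|y0] := eqVneq (val y) 0; last exact: c1.
have [x0|x0] := eqVneq (val x) 0.
  have -> : x = y by apply: val_inj; rewrite x0 y0.
  by rewrite Yc.1 Yc'.1 mulmx1 mul1mx.
have yx : w (val y - val x) < r0 by rewrite uabs_subC.
have [xy1 xy2] := ltr0 xy; have [yx1 yx2] := ltr0 yx.
have h := c1 y x x0 yx.
(* For [y = 0] the relation with [x] and [y] exchanged is inverted: [F(y) = F(y) Y'(y, x) Y'(x, y) =
   Y(y, x) F(x) Y'(x, y)]. *)
rewrite -[eval_mx F y]mulmx1 -(Yc'.1 y) (Yc'.2 _ _ _ yx2 xy2) (mulmxA (eval_mx F y)) h.
by rewrite !mulmxA -(Yc.2 _ _ _ xy1 yx1) Yc.1 mul1mx.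
Qed.

Let pderiv_FY y : (forall x, w (val x - val y) < r0 -> forall i j,
    pderiv (fun t => (eval_mx F t *m Y' t y) i j) x
      ((eval_mx (map_mx D F + F *m a' 1%N) x *m Y' x y) i j)).
Proof.
move=> x xy i j; have [_ xy2] := ltr0 xy.
have h := has_deriv_sum (index_enum 'I_n') (fun l (_ : true) =>
   has_derivM (deriv_anelP v_complete v_mixed (F i l) x)
     (cocycle_deriv v_mixed (andP rhoP').1 rhoX' Ya' Yc' l j xy2)).
have E : \sum_l (deriv_anel (F i l) x * Y' (pshift x 0) y l j +
    F i l (pshift x 0) * (eval_mx (a' 1%N) x *m Y' x y) l j) =
    (eval_mx (map_mx D F + F *m a' 1%N) x *m Y' x y) i j.
  rewrite eval_mxD mulmxDl eval_mxM -mulmxA mxE [X in X + _]mxE [X in _ + X]mxE.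
  rewrite pshift0 big_split /=; congr (_ + _); apply: eq_bigr => l _.
    by rewrite !mxE.
  by rewrite [eval_mx F x i l]mxE.
rewrite -E; apply: has_deriv_near h.
  by rewrite /= !mxE; apply: eq_bigr => l _; rewrite mxE.
by apply: filterE => t /=; rewrite !mxE; apply: eq_bigr => l _; rewrite mxE.
Qed.

Let pderiv_YF y : (forall x, w (val x - val y) < r0 -> forall i j,
    pderiv (fun t => (Y t y *m eval_mx F y) i j) x
      ((eval_mx (a 1%N) x *m (Y x y *m eval_mx F y)) i j)).
Proof.
move=> x xy i j; have [xy1 _] := ltr0 xy.
have h := has_deriv_sum (index_enum 'I_n) (fun l (_ : true) =>
   has_derivM (cocycle_deriv v_mixed (andP rhoP).1 rhoX Ya Yc i l xy1) (has_deriv_cst w (F l j y) 0)).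
have E : \sum_l ((eval_mx (a 1%N) x *m Y x y) i l * F l j y + Y (pshift x 0) y i l * 0) =
    (eval_mx (a 1%N) x *m (Y x y *m eval_mx F y)) i j.
  rewrite mulmxA mxE; apply: eq_bigr => l _.
  by rewrite mulr0 addr0 [eval_mx F y l j]mxE.
rewrite -E; apply: has_deriv_near h.
  by rewrite /= !mxE; apply: eq_bigr => l _; rewrite mxE.
by apply: filterE => t /=; rewrite !mxE; apply: eq_bigr => l _; rewrite mxE.
Qed.

(** Both sides, as functions of [x], solve [W' = a_1 W], and they agree at [x = y]. *)
Lemma intertwines_d : a 1%N *m F = map_mx D F + F *m a' 1%N -> intertwines.
Proof.
move=> aF; apply: W_intertwines => x y xy.
apply: (ode_uniq v_complete v_mixed (W := W y) (G := a 1%N) r0_gt0 r0X) xy => [i j|t ty i j|].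
- exact: W_an.
- have := has_derivD (pderiv_FY ty i j) (has_derivN (pderiv_YF ty i j)).
  have -> : (eval_mx (map_mx D F + F *m a' 1%N) t *m Y' t y) i j +
      - (eval_mx (a 1%N) t *m (Y t y *m eval_mx F y)) i j =
      (eval_mx (a 1%N) t *m W y t) i j.
    by rewrite /W mulmxBr -aF eval_mxM -mulmxA [in RHS]mxE [X in _ = _ + X]mxE.
  apply: has_deriv_near.
    by rewrite /= /W [in RHS]mxE [X in _ = _ + X]mxE.
  by apply: filterE => s /=; rewrite /W [in RHS]mxE [X in _ = _ + X]mxE.
- exact: W_diag.
Qed.

(** The relation at the pair [(q x, x)]. *)
Lemma intertwines_commute_q q (A : 'M[anel]_n) (A' : 'M[anel]_n') : intertwines ->
  tau X q < r0 ->
  (forall x, eval_mx A x = Y (qpt q x) x) -> (forall x, eval_mx A' x = Y' (qpt q x) x) ->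
  A *m F = map_mx (sigma q) F *m A'.
Proof.
move=> hF qr AE AE'; have qrX := lt_le_trans qr r0X; apply: eval_mx_inj => x.
rewrite !eval_mxM eval_mx_sigma // AE AE' hF //.
exact: le_lt_trans (qpt_dist x qrX) qr.
Qed.

(** The derivative of the relation with respect to [x], at [x = y]. *)
Lemma intertwines_commute_d : intertwines -> a 1%N *m F = map_mx D F + F *m a' 1%N.
Proof.
move=> hF; apply: eval_mx_inj => y; apply/matrixP => i j.
have yy : w (val y - val y) < r0 by rewrite subrr uabs0.
have h1 := pderiv_FY yy i j; have h2 := pderiv_YF yy i j.
rewrite Yc.1 mul1mx -eval_mxM in h2; rewrite Yc'.1 mulmx1 in h1.
apply: (pderiv_uniq v_mixed h2); apply: has_deriv_near h1.
  by rewrite pshift0 hF.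
apply: filterS (dn0_lt w r0_gt0) => h /= hr; rewrite hF // add0r.
by rewrite val_pshift 1?addrAC ?subrr ?add0r // (lt_le_trans hr).
Qed.

End Morphisms.

End Good.

(** * Equivalences of categories *)

Section Categories.

Lemma functor_eq (A B : category) (o : A -> B)
    (m m' : forall a b, mor a b -> mor (o a) (o b)) p1 p2 p1' p2' :
  (forall a b (f : mor a b), m a b f = m' a b f) ->
  @Functor A B o m p1 p2 = @Functor A B o m' p1' p2'.
Proof.
move=> mm'; have E : m = m'.
  by apply: functional_extensionality_dep => a; apply: functional_extensionality_dep => b;
     apply: functional_extensionality_dep => f.
move: p1' p2'; rewrite -E => p1' p2'.
by rewrite (Prop_irrelevance p1 p1') (Prop_irrelevance p2 p2').
Qed.

Lemma equivalence_of_ff (A B : category) (F : functor A B) :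
  (forall a a' (g : mor (F a) (F a')), exists f, fmor F f = g) ->
  (forall a a' (f f' : mor a a'), fmor F f = fmor F f' -> f = f') ->
  (forall b, exists a (i : mor (F a) b) (j : mor b (F a)),
     comp_mor i j = idmor b /\ comp_mor j i = idmor (F a)) ->
  is_equivalence F.
Proof.
move=> full faith es.
pose o b := sval (cid (es b)).
pose i b : mor (F (o b)) b := sval (cid (svalP (cid (es b)))).
pose j b : mor b (F (o b)) := sval (cid (svalP (cid (svalP (cid (es b)))))).
have ij b : comp_mor (i b) (j b) = idmor b.
  by case: (svalP (cid (svalP (cid (svalP (cid (es b))))))).
have ji b : comp_mor (j b) (i b) = idmor (F (o b)).
  by case: (svalP (cid (svalP (cid (svalP (cid (es b))))))).
pose pre a a' (g : mor (F a) (F a')) := sval (cid (full a a' g)).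
have preP a a' (g : mor (F a) (F a')) : fmor F (pre a a' g) = g.
  exact: svalP (cid (full a a' g)).
pose m b b' (g : mor b b') : mor (o b) (o b') := pre _ _ (comp_mor (j b') (comp_mor g (i b))).
have mE b b' (g : mor b b') : fmor F (m b b' g) = comp_mor (j b') (comp_mor g (i b)).
  exact: preP.
have m1 b : m b b (idmor b) = idmor (o b).
  by apply: faith; rewrite mE comp_idl ji fmor_id.
have mM b b' b'' (f : mor b' b'') (g : mor b b') :
    m b b'' (comp_mor f g) = comp_mor (m b' b'' f) (m b b' g).
  apply: faith; rewrite fmor_comp !mE -!comp_morA.
  by rewrite [comp_mor (i b') _]comp_morA ij comp_idl.
pose G := Functor m1 mM; exists G; split.
  exists (fun a => pre (o (F a)) a (i (F a))), (fun a => pre a (o (F a)) (j (F a))).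
  split=> [a a' f|a|a]; apply: faith; rewrite !fmor_comp ?fmor_id !preP //=.
  by rewrite comp_morA ij comp_idl.
exists i, j; split=> // b b' g /=.
by rewrite mE comp_morA ij comp_idl.
Qed.

Lemma quasi_inverse_sym (A B : category) (F : functor A B) (G : functor B A) :
  quasi_inverse F G -> is_equivalence G.
Proof. by move=> [h1 h2]; exists F; split. Qed.

Lemma nat_iso_comp (A B D : category) (F : functor A B) (F' : functor B A)
    (G : functor B D) (G' : functor D B) :
  nat_iso (fcomp F' F) (fid A) -> nat_iso (fcomp G' G) (fid B) ->
  nat_iso (fcomp (fcomp F' G') (fcomp G F)) (fid A).
Proof.
move=> [eta [eps [n1 n2 n3]]] [eta' [eps' [n1' n2' n3']]].
exists (fun a => comp_mor (eta a) (fmor F' (eta' (F a)))).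
exists (fun a => comp_mor (fmor F' (eps' (F a))) (eps a)).
split=> [a b f|a|a] /=.
- rewrite -comp_morA -fmor_comp (n1' _ _ (fmor F f)) /= fmor_comp comp_morA.
  by rewrite (n1 _ _ f) /= comp_morA.
- rewrite -comp_morA [comp_mor (eps a) _]comp_morA n2 /= comp_idl.
  by rewrite -fmor_comp n2' /= fmor_id.
- rewrite -comp_morA [comp_mor (fmor F' (eta' _)) _]comp_morA -fmor_comp n3' /=.
  by rewrite fmor_id comp_idl n3.
Qed.

Lemma equivalence_comp (A B D : category) (F : functor A B) (G : functor B D) :
  is_equivalence F -> is_equivalence G -> is_equivalence (fcomp G F).
Proof.
move=> [F' [h1 h2]] [G' [h3 h4]]; exists (fcomp F' G'); split.
  exact: nat_iso_comp.
exact: nat_iso_comp.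
Qed.

Lemma transport_of_equivalences (A B B' : category)
    (F : functor A B) (F' : functor A B')
    (PA : A -> Prop) (PB : B -> Prop) (PB' : B' -> Prop)
    (f : forall a, PA a -> PB (F a)) (f' : forall a, PA a -> PB' (F' a)) :
  is_equivalence (frestrict f) -> is_equivalence (frestrict f') ->
  transport_equivalence F F' PA PB PB'.
Proof.
move=> hf hf'; exists f, f'; split=> // G /quasi_inverse_sym hG.
exact: equivalence_comp.
Qed.

(** A composite of restrictions and the restriction of the composite differ only in proofs of
    membership, so commutation of the ambient functors suffices. *)
Lemma square_of_equivalences (A B D E : category)
    (top : functor A B) (left : functor B E)
    (right : functor A D) (bot : functor D E)
    (PA : A -> Prop) (PB : B -> Prop) (PD : D -> Prop) (PE : E -> Prop)
    (t : forall a, PA a -> PB (top a)) (l : forall b, PB b -> PE (left b))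
    (r : forall a, PA a -> PD (right a)) (b : forall d, PD d -> PE (bot d)) :
  fcomp left top = fcomp bot right ->
  is_equivalence (frestrict t) -> is_equivalence (frestrict l) ->
  is_equivalence (frestrict r) -> is_equivalence (frestrict b) ->
  equivalence_square top left right bot PA PB PD PE.
Proof.
move=> comm ht hl hr hb; exists t, l, r, b; split=> //.
have -> : fcomp (frestrict l) (frestrict t) =
    frestrict (F := fcomp left top) (fun a pa => l _ (t a pa)).
  exact: functor_eq.
have -> : fcomp (frestrict b) (frestrict r) =
    frestrict (F := fcomp bot right) (fun a pa => b _ (r a pa)).
  exact: functor_eq.
move: (fun a pa => l _ (t a pa)) (fun a pa => b _ (r a pa)) => /=.
(* With both families of membership proofs generalised, [comm] can replace one composite by the
   other, after which they coincide by proof irrelevance. *)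
change ((forall h1 : (forall a, PA a -> PE ((fcomp left top) a)),
   forall h2 : (forall a, PA a -> PE ((fcomp bot right) a)), frestrict h1 = frestrict h2)).
rewrite -comm => h1 h2.
by rewrite (Prop_irrelevance h1 h2).
Qed.

End Categories.

Section LinearFunctor.
Variables (R : realType) (K : fieldType) (v : ultrabs R K).
Variables (C : alg_closure v) (X : affinoid v).
Local Notation H := (anel C X).
Variables (O O' : Type) (car : O' -> lmodType H) (F : O -> O').
Variable good : forall M N : O, (car (F M) -> car (F N)) -> Prop.
Variable good' : forall M N : O', (car M -> car N) -> Prop.
Hypothesis good_id : forall M, @good M M (fun m => m).
Hypothesis good_comp :
  forall M N P (f : car (F N) -> car (F P)) (g : car (F M) -> car (F N)),
  good f -> good g -> @good M P (fun m => f (g m)).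
Hypothesis good'_id : forall M, good' (fun m : car M => m).
Hypothesis good'_comp : forall M N P (f : car N -> car P) (g : car M -> car N),
  good' f -> good' g -> good' (fun m => f (g m)).
Hypothesis good_good' : forall M N (f : car (F M) -> car (F N)),
  good f -> good' f.

(** Faithfulness is automatic because the functor keeps the underlying maps; the two premises are
    fullness and essential surjectivity. *)
Lemma linear_functor_equivalence (P : O -> Prop) (Q : O' -> Prop)
    (PQ : forall a : linear_cat good_id good_comp, P a ->
       Q (linear_functor good_id good_comp good'_id good'_comp good_good' a)) :
  (forall M N, P M -> P N -> forall f : car (F M) -> car (F N),
     linear f -> good' f -> good f) ->
  (forall N, Q N -> exists M, P M /\
     exists (i : car (F M) -> car N) (j : car N -> car (F M)),
     [/\ linear i /\ good' i, linear j /\ good' j, cancel j i & cancel i j]) ->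
  is_equivalence (frestrict PQ).
Proof.
move=> full es; apply: equivalence_of_ff => [[M PM] [N PN] [f [lf gf]]|a a' f f' ff'|[N QN]].
- by exists (exist _ f (conj lf (full M N PM PN f lf gf))); exact: sval_inj.
- by apply: sval_inj; move: (congr1 sval ff').
- have [M [PM [i [j [hi hj ij ji]]]]] := es N QN.
  exists (exist _ M PM), (exist _ i hi), (exist _ j hj).
  by split; apply: sval_inj; apply: funext.
Qed.

End LinearFunctor.

(** * Module morphisms, and operators reconstructed from a cocycle *)

Section ModuleMorphisms.
Variables (R : realType) (p : nat) (K : fieldType) (v : ultrabs R K).
Hypotheses (v_complete : complete_abs v) (v_mixed : mixed_char v p).
Variables (C : alg_closure v) (X : affinoid v).
Local Notation iota := (ac_inj C).
Local Notation points := (points C X).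
Local Notation anel := (anel C X).
Local Notation rX := (min_rad X).
Local Notation D := (@deriv_anel R K v C X).
Local Notation TX := (anel_poly C X 'X).
Implicit Types (f g : anel) (x y : points) (q : K).

Lemma commute_sigma_mx (S S' : set K) (M : smod C X S) (N : smod C X S') q
    (h : gen S q) (h' : gen S' q) m n (e : 'I_m -> M) (e' : 'I_n -> N) (phi : M -> N) F A A' :
  tau X q < rX -> is_basis e -> is_basis e' -> linear phi -> is_mx e e' phi F ->
  is_mx e e (smod_op h) A -> is_mx e' e' (smod_op h') A' ->
  (forall u, phi (smod_op h u) = smod_op h' (phi u)) <->
  A *m F = map_mx (sigma q) F *m A'.
Proof.
move=> qr eB eB' lphi hF hA hA'.
have opE a : smod_op h (lincomb e a) = lincomb e (map_mx (sigma q) a *m A).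
  by apply: mx_semilinear hA; [exact: smod_add|exact: smod_semilin].
have opE' a : smod_op h' (lincomb e' a) = lincomb e' (map_mx (sigma q) a *m A').
  by apply: mx_semilinear hA'; [exact: smod_add|exact: smod_semilin].
split=> [comm|AF x].
  apply/row_matrixP => i; apply: (lincomb_inj eB').
  by rewrite !row_mul -map_row -opE' -hF -comm hA (mx_linear _ lphi hF).
rewrite -(basis_coordK eB x) opE !(mx_linear _ lphi hF) opE'; congr lincomb.
by rewrite map_sigmaM // -!mulmxA AF.
Qed.

(** As [delta_1 = T d/dT], commutation gives this relation multiplied by [T]; [mulX_inj] cancels [T]
    even when 0 is in [X]. *)
Lemma commute_delta_mx (S S' : set K) (M : sdmod C X S) (N : sdmod C X S')
    m n (e : 'I_m -> M) (e' : 'I_n -> N) (phi : M -> N) F (a : 'M[anel]_m) (a' : 'M[anel]_n) :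
  is_basis e -> is_basis e' -> linear phi -> is_mx e e' phi F ->
  is_mx e e (@sdmod_delta _ _ _ _ _ S M) (TX *: a) ->
  is_mx e' e' (@sdmod_delta _ _ _ _ _ S' N) (TX *: a') ->
  (forall u, phi (sdmod_delta u) = sdmod_delta (phi u)) <->
  a *m F = map_mx D F + F *m a'.
Proof.
move=> eB eB' lphi hF hG hG'.
have dE b := mx_connection b (@sdmod_deltaD _ _ _ _ _ S M) (@sdmod_deltaZ _ _ _ _ _ S M) hG.
have dE' b := mx_connection b (@sdmod_deltaD _ _ _ _ _ S' N) (@sdmod_deltaZ _ _ _ _ _ S' N) hG'.
split=> [comm|aF x].
  suff E : TX *: (a *m F) = TX *: (map_mx D F + F *m a').
    apply/matrixP => i j; have := congr1 (fun A : 'M[anel]_(m, n) => A i j) E.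
    rewrite mxE [in RHS]mxE -[ 'X]scale1r.
    by apply: (mulX_inj v_complete v_mixed); rewrite oner_eq0.
  apply/row_matrixP => i; apply: (lincomb_inj eB').
  rewrite scalemxAl row_mul -(mx_linear _ lphi hF) -hG comm hF dE'.
  congr lincomb; rewrite -scalemxAr -scalerDr map_row -row_mul.
  by apply/rowP => j; rewrite !mxE.
rewrite -(basis_coordK eB x) dE !(mx_linear _ lphi hF) dE'; congr lincomb.
rewrite mulmxDl (map_derivMr v_complete v_mixed) scalerDr -addrA -scalemxAl; congr (_ + _).
by rewrite -!scalemxAr -scalemxAl -scalerDr -!mulmxA -mulmxDr aF.
Qed.

Definition solvable (S : set K) (M : smod C X S) : Prop :=
  exists n (e : 'I_n -> M) rho Y a, solves e rho Y a.

Definition sd_solvable (S : set K) (M : sdmod C X S) : Prop :=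
  exists n (e : 'I_n -> M) rho Y a,
    solves (M := sdmod_smod M) e rho Y a /\ solves_delta e a.

Section Two.
Variables (S S' : set K) (M : smod C X S) (N : smod C X S').
Variables (n n' : nat) (e : 'I_n -> M) (e' : 'I_n' -> N) (rho rho' : R).
Variables (Y : points -> points -> 'M[C]_n) (a : nat -> 'M[anel]_n).
Variables (Y' : points -> points -> 'M[C]_n') (a' : nat -> 'M[anel]_n').
Hypotheses (hM : solves e rho Y a) (hN : solves e' rho' Y' a').
Variables (phi : M -> N) (F : 'M[anel]_(n, n')).
Hypotheses (lphi : linear phi) (hF : is_mx e e' phi F).

Let eB : is_basis e. Proof. by case: hM. Qed.
Let eB' : is_basis e'. Proof. by case: hN. Qed.
Let rhoP : 0 < rho <= rX. Proof. by case: hM. Qed.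
Let rhoP' : 0 < rho' <= rX. Proof. by case: hN. Qed.
Let Ya : anUm rho Y a. Proof. by case: hM => _ _ []. Qed.
Let Ya' : anUm rho' Y' a'. Proof. by case: hN => _ _ []. Qed.
Let Yc : cocycle rho Y. Proof. by case: hM. Qed.
Let Yc' : cocycle rho' Y'. Proof. by case: hN. Qed.

Let tau_min q : S q -> S' q -> tau X q < Num.min rho rho'.
Proof.
by move=> Sq Sq'; case: hM => _ _ _ _ /(_ q Sq)[h _]; case: hN => _ _ _ _ /(_ q Sq')[h' _];
   rewrite lt_min h.
Qed.

Let tau_rX q : S q -> tau X q < rX.
Proof.
move=> Sq; case: hM => _ /andP[_ rhoX] _ _ /(_ q Sq)[h _].
exact: lt_le_trans rhoX.
Qed.

Lemma commute_intertwines q (h : gen S q) (h' : gen S' q) : S q -> S' q ->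
  ~ unity_root q -> (forall u, phi (smod_op h u) = smod_op h' (phi u)) ->
  intertwines rho rho' Y Y' F.
Proof.
move=> Sq Sq' qN comm.
have [A hA] := exists_mx e eB (smod_op h); have [A' hA'] := exists_mx e' eB' (smod_op h').
have AF := (commute_sigma_mx (tau_rX Sq) eB eB' lphi hF hA hA').1 comm.
case: hM => _ _ _ _ /(_ q Sq)[_ /(_ h A hA) AE].
case: hN => _ _ _ _ /(_ q Sq')[_ /(_ h' A' hA') AE'].
exact: (intertwines_q v_complete v_mixed rhoP Ya Ya' Yc Yc' qN (tau_min Sq Sq') AE AE' AF).
Qed.

Lemma intertwines_commutes T : intertwines rho rho' Y Y' F ->
  T `<=` S -> T `<=` S' -> commutes_sigma T phi.
Proof.
move=> hI TS TS' q Tq h h' x; have Sq := TS q Tq; have Sq' := TS' q Tq.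
have [A hA] := exists_mx e eB (smod_op h); have [A' hA'] := exists_mx e' eB' (smod_op h').
move: x; apply/(commute_sigma_mx (tau_rX Sq) eB eB' lphi hF hA hA').
case: hM => _ _ _ _ /(_ q Sq)[_ /(_ h A hA) AE].
case: hN => _ _ _ _ /(_ q Sq')[_ /(_ h' A' hA') AE'].
exact: (intertwines_commute_q rhoP hI (tau_min Sq Sq') AE AE').
Qed.

End Two.

(** [S] and [S'] may differ because two objects of the union may live over different discs. *)
Lemma commutes_sigma_extend (S S' T : set K) (M : smod C X S) (N : smod C X S') q
    (phi : M -> N) :
  solvable M -> solvable N -> S q -> S' q -> ~ unity_root q -> linear phi ->
  commutes_sigma [set q] phi -> T `<=` S -> T `<=` S' -> commutes_sigma T phi.
Proof.
move=> [n [e [rho [Y [a hM]]]]] [n' [e' [rho' [Y' [a' hN]]]]] Sq Sq' qN lphi comm TS TS'.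
have eB' : is_basis e' by case: hN.
have [F hF] := exists_mx e eB' phi.
have hI := commute_intertwines hM hN lphi hF Sq Sq' qN
  (comm q erefl (gen_in Sq) (gen_in Sq')).
exact: (intertwines_commutes hM hN lphi hF hI TS TS').
Qed.

Lemma commutes_delta_of_sigma (S S' : set K) (M : sdmod C X S) (N : sdmod C X S') q
    (phi : M -> N) :
  sd_solvable M -> sd_solvable N -> S q -> S' q -> ~ unity_root q -> linear phi ->
  commutes_sigma [set q] phi -> commutes_delta phi.
Proof.
move=> [n [e [rho [Y [a [hM dM]]]]]] [n' [e' [rho' [Y' [a' [hN dN]]]]]] Sq Sq' qN lphi comm.
have eB' : is_basis e' by case: hN.
have eB : is_basis e by case: hM.
have [F hF] := exists_mx e eB' phi.
have hI := commute_intertwines hM hN lphi hF Sq Sq' qN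
  (comm q erefl (gen_in Sq) (gen_in Sq')).
have [G hG] := exists_mx e eB (@sdmod_delta _ _ _ _ _ S M).
have [G' hG'] := exists_mx e' eB' (@sdmod_delta _ _ _ _ _ S' N).
have GE := dM G hG; have GE' := dN G' hG'; rewrite GE in hG; rewrite GE' in hG'.
move=> x; move: x; apply/(commute_delta_mx eB eB' lphi hF hG hG').
case: hM => _ rhoP [_ Ya] Yc _; case: hN => _ rhoP' [_ Ya'] Yc' _.
exact: (intertwines_commute_d v_complete v_mixed rhoP rhoP' Ya Ya' Yc Yc' hI).
Qed.

Lemma commutes_sigma_of_delta (S S' T : set K) (M : sdmod C X S) (N : sdmod C X S')
    (phi : M -> N) :
  sd_solvable M -> sd_solvable N -> linear phi ->
  commutes_delta phi -> T `<=` S -> T `<=` S' -> commutes_sigma T phi.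
Proof.
move=> [n [e [rho [Y [a [hM dM]]]]]] [n' [e' [rho' [Y' [a' [hN dN]]]]]] lphi comm.
have eB' : is_basis e' by case: hN.
have eB : is_basis e by case: hM.
have [F hF] := exists_mx e eB' phi.
have [G hG] := exists_mx e eB (@sdmod_delta _ _ _ _ _ S M).
have [G' hG'] := exists_mx e' eB' (@sdmod_delta _ _ _ _ _ S' N).
have GE := dM G hG; have GE' := dN G' hG'; rewrite GE in hG; rewrite GE' in hG'.
have aF := (commute_delta_mx eB eB' lphi hF hG hG').1 comm.
have hI : intertwines rho rho' Y Y' F.
  case: (hM) => _ rhoP [_ Ya] Yc _; case: (hN) => _ rhoP' [_ Ya'] Yc' _.
  exact: (intertwines_d v_complete v_mixed rhoP rhoP' Ya Ya' Yc Yc' aF).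
exact: (intertwines_commutes hM hN lphi hF hI).
Qed.

Section Construction.
Variables (M : lmodType anel) (n : nat) (e : 'I_n -> M) (rho : R).
Variables (Y : points -> points -> 'M[C]_n) (a : nat -> 'M[anel]_n).
Hypotheses (eB : is_basis e) (rhoP : 0 < rho <= rX).
Hypotheses (Ya : anUm rho Y a) (Yc : cocycle rho Y).
Variable S : set K.
Hypothesis Srho : forall q, S q -> tau X q < rho.

Let rhoX : rho <= rX. Proof. by case/andP: rhoP. Qed.
Let rho0 : 0 < rho. Proof. by case/andP: rhoP. Qed.

Let gen_rho q : gen S q -> tau X q < rho.
Proof. exact: gen_tau. Qed.

Let gen_rX q : gen S q -> tau X q < rX.
Proof. by move=> /gen_rho qr; exact: lt_le_trans rhoX. Qed.

(** The default of [xget] is excluded by [cocycle_qmatrix] as soon as [tau X q < rho]. *)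
Definition cocycle_mx q : 'M[anel]_n :=
  xget 0 [set A : 'M[anel]_n | forall x, eval_mx A x = Y (qpt q x) x].

Lemma cocycle_mxE q x : tau X q < rho -> eval_mx (cocycle_mx q) x = Y (qpt q x) x.
Proof.
move=> qr; rewrite /cocycle_mx; case: xgetP => [A _ /(_ x) //|no].
have [H1 hH] := cocycle_qmatrix rho0 rhoX Ya Yc qr.
by case: (no _ hH).
Qed.

Definition cocycle_op q (m : M) : M :=
  lincomb e (map_mx (sigma q) (basis_coord e m) *m cocycle_mx q).

Lemma cocycle_opD q m m' : gen S q ->
  cocycle_op q (m + m') = cocycle_op q m + cocycle_op q m'.
Proof.
move=> /gen_rX qr; rewrite /cocycle_op -lincombD -mulmxDl basis_coordD //; congr (lincomb _ (_ *m _)).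
by apply/rowP => i; rewrite !mxE sigmaD.
Qed.

Lemma cocycle_opZ q f m : gen S q ->
  cocycle_op q (f *: m) = sigma q f *: cocycle_op q m.
Proof.
move=> /gen_rX qr; rewrite /cocycle_op -lincombZ scalemxAl basis_coordZ //; congr (lincomb _ (_ *m _)).
by apply/rowP => i; rewrite !mxE sigmaM.
Qed.

Lemma cocycle_op_cont q : gen S q -> continuous_endo (cocycle_op q).
Proof.
move=> hq; apply: (semilinear_continuous (gen_rX hq)) => [m m'|c m].
  exact: cocycle_opD.
exact: cocycle_opZ.
Qed.

Lemma qpt1 x : qpt 1 x = x.
Proof. by rewrite /qpt subrr rmorph0 mul0r pshift0. Qed.

Lemma tau1 : tau X 1 = 0.
Proof. by rewrite /tau subrr uabs0 mul0r. Qed.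

Lemma cocycle_op1 m : cocycle_op 1 m = m.
Proof.
have t1 : tau X 1 < rho by rewrite tau1.
have t1X : tau X 1 < rX := lt_le_trans t1 rhoX.
have -> : cocycle_op 1 m = lincomb e (basis_coord e m); last exact: basis_coordK.
congr lincomb; apply: eval_mx_inj => x.
by rewrite eval_mxM eval_mx_sigma // cocycle_mxE // qpt1 Yc.1 mulmx1.
Qed.

(** The group law is the cocycle relation [Y(q' q x, x) = Y(q' q x, q x) Y(q x, x)]. *)
Lemma cocycle_opM q q' m : gen S q -> gen S q' ->
  cocycle_op (q * q') m = cocycle_op q (cocycle_op q' m).
Proof.
move=> hq hq'; have hqq' := gen_mul hq hq'.
have qX := gen_rX hq; have q'X := gen_rX hq'; have qq'X := gen_rX hqq'.
rewrite /cocycle_op basis_coord_lincomb //; congr lincomb; apply: eval_mx_inj => x.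
have qptM : qpt (q * q') x = qpt q' (qpt q x).
  by apply: val_inj; rewrite !val_qpt // rmorphM mulrA [iota q' * _]mulrC.
rewrite !eval_mxM !eval_mx_sigma // eval_mxM eval_mx_sigma // !cocycle_mxE ?gen_rho //.
rewrite qptM -mulmxA; congr (_ *m _); apply: Yc.2.
  exact: le_lt_trans (qpt_dist _ q'X) (gen_rho hq').
exact: le_lt_trans (qpt_dist _ qX) (gen_rho hq).
Qed.

Definition smod_of : smod C X S :=
  @SMod R K v C X S M (ex_intro _ n (ex_intro _ e eB))
    (fun q _ => cocycle_op q)
    (fun q h => cocycle_op_cont h)
    (fun q h m m' => cocycle_opD m m' h)
    (fun q h f m => cocycle_opZ f m h)
    (fun _ m => cocycle_op1 m)
    (fun q q' h h' _ m => cocycle_opM m h h').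

Lemma smod_of_solves : analytic_on_U rho Y -> solves (M := smod_of) e rho Y a.
Proof.
move=> Yan; split=> // q Sq; split=> [|h A hA x]; first exact: Srho.
rewrite -cocycle_mxE ?Srho //; congr eval_mx.
apply/row_matrixP => i; apply: (lincomb_inj eB); rewrite -hA /= /cocycle_op.
rewrite basis_coord_basis //; congr lincomb; rewrite -[in RHS](mul1mx (cocycle_mx q)) row_mul.
congr (_ *m _); apply: eval_mx_inj => y.
rewrite eval_mx_sigma ?gen_rX //.
by apply/rowP => j; rewrite !mxE eqxx /= eq_sym; case: (i == j).
Qed.

End Construction.

Section Connection.
Variables (S : set K) (N : smod C X S) (n : nat) (e : 'I_n -> N).
Hypothesis eB : is_basis e.
Variable G : 'M[anel]_n.

Definition conn_op (m : N) : N :=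
  lincomb e (TX *: map_mx D (basis_coord e m) + basis_coord e m *m G).

Lemma conn_opD m m' : conn_op (m + m') = conn_op m + conn_op m'.
Proof.
have E : map_mx D (basis_coord e (m + m')) =
    map_mx D (basis_coord e m) + map_mx D (basis_coord e m').
  by rewrite (basis_coordD eB); apply/rowP => i; rewrite !mxE (deriv_anelD v_complete v_mixed).
by rewrite /conn_op E (basis_coordD eB) mulmxDl scalerDr addrACA lincombD.
Qed.

Lemma conn_opZ f m : conn_op (f *: m) = delta1 f *: m + f *: conn_op m.
Proof.
rewrite -[X in delta1 f *: X](basis_coordK eB m) /conn_op (basis_coordZ eB).
rewrite -!lincombZ -lincombD -scalemxAl scalerDr addrA; congr (lincomb _ (_ + _)).
apply/rowP => i; rewrite !mxE (deriv_anelM v_complete v_mixed) /delta1.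
by rewrite mulrDr mulrA mulrCA.
Qed.

Definition sdmod_of : sdmod C X S := @SDMod R K v C X S N conn_op conn_opD conn_opZ.

Lemma sdmod_of_delta a : G = TX *: a 1%N -> solves_delta (M := sdmod_of) e a.
Proof.
move=> GE B hB; rewrite -GE; apply/row_matrixP => i; apply: (lincomb_inj eB).
rewrite -hB /= /conn_op basis_coord_basis // rowE; congr lincomb.
have -> : map_mx D (delta_mx 0 i : 'rV_n) = 0; last by rewrite scaler0 add0r.
apply/rowP => j; rewrite !mxE eqxx /=; case: (j == i).
  exact: deriv_anel1 v_complete v_mixed _ _.
exact: deriv_anel0 v_complete v_mixed _ _.
Qed.

End Connection.

(** Equal solutions in corresponding bases force equal operators, since the identity matrix
    intertwines [Y] with itself. In the applications [phi] is the identity of a common carrier. *)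
Lemma id_commutes (T S S' : set K) (M : smod C X S) (N : smod C X S')
    (phi : M -> N) n (e : 'I_n -> M) (e' : 'I_n -> N) rho Y a :
  linear phi -> (forall i, phi (e i) = e' i) ->
  solves e rho Y a -> solves e' rho Y a ->
  T `<=` S -> T `<=` S' -> commutes_sigma T phi.
Proof.
move=> lphi phie hM hN TS TS'.
have hF : is_mx e e' phi 1%:M.
  by move=> i; rewrite phie -[in LHS](lincomb_delta e' i); congr lincomb; rewrite row1.
have hI : intertwines rho rho Y Y 1%:M.
  by move=> x y _; rewrite !eval_mx1 mul1mx mulmx1.
exact: (intertwines_commutes hM hN lphi hF hI TS TS').
Qed.

End ModuleMorphisms.

(** * Roots of unity in the open unit disc about 1 *)

Section RootsOfUnity.
Variables (R : realType) (p : nat) (K : fieldType) (v : ultrabs R K).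
Hypothesis v_mixed : mixed_char v p.

(** If [|m| < 1], a Bezout relation [1 = a m - b p] would give [|1| < 1]. *)
Lemma uabs_coprime m : coprime p m -> (0 < m)%N -> v m%:R = 1.
Proof.
move=> pm m0; apply/eqP; rewrite eq_le uabs_nat leNgt; apply/negP => lt1.
have [_ _ vp] := v_mixed.
case: (egcdnP p m0) => a b E _; rewrite gcdnC (eqP pm) in E.
have {}E : 1 = a%:R * m%:R - b%:R * p%:R :> K.
  by rewrite -!natrM E natrD addrC addKr.
have := ltxx (1 : R); rewrite -{1}(uabs1 v) E uabs_sub_lt // uabsM.
  by rewrite (le_lt_trans _ lt1) // ler_piMl ?uabs_ge0 ?uabs_nat.
by rewrite (le_lt_trans _ vp) // ler_piMl ?uabs_ge0 ?uabs_nat.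
Qed.

(** Write [n = m p^a] with [m] prime to [p], and [u = q^(p^a)]. If [u != 1], the sum of the [u^i]
    over [i < m] is 0; but it differs from [m], of absolute value 1, by at most [|u - 1| < 1]. *)
Lemma not_unity_root q : v (q - 1) < 1 ->
  ~ (exists n : nat, q ^+ (p ^ n)%N = 1) -> ~ unity_root q.
Proof.
move=> q1 qN [n n0 qn]; have [p_prime _ _] := v_mixed.
have [m pm nE] := pfactor_coprime p_prime n0.
set u := q ^+ (p ^ logn p n); have u1 : u - 1 != 0.
  by rewrite subr_eq0; apply/eqP => u1; apply: qN; exists (logn p n).
have m0 : (0 < m)%N by move: n0; rewrite nE muln_gt0 => /andP[].
have um : u ^+ m = 1 by rewrite -exprM mulnC -nE.
have vu : v (u - 1) < 1 := le_lt_trans (uabs_expr_sub1 _ q1) q1.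
have S0 : \sum_(i < m) u ^+ i = 0.
  by apply: (mulfI u1); rewrite mulr0 -subrX1 um subrr.
have := uabs_coprime pm m0.
have -> : m%:R = - \sum_(i < m) (u ^+ i - 1).
  by rewrite sumrB S0 sub0r opprK sumr_const card_ord.
rewrite uabsN => E; have := ltxx (1 : R); rewrite -{1}E => /negbT/negP; apply.
apply: le_lt_trans (vu).
apply: uabs_sum_le => [|i _]; first exact: uabs_ge0.
exact: uabs_expr_sub1 vu.
Qed.

End RootsOfUnity.

(** * The functors are equivalences *)

Section Equivalences.
Variables (R : realType) (p : nat) (K : fieldType) (v : ultrabs R K).
Hypotheses (v_complete : complete_abs v) (v_mixed : mixed_char v p).
Variables (C : alg_closure v) (X : affinoid v).
Local Notation anel := (anel C X).
Local Notation rX := (min_rad X).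
Implicit Types (q : K) (r : R) (S : set K).

Lemma sigma_taylor_of_delta S r (M : sdmod C X S) : 0 < r ->
  sigma_delta_taylor r M -> sigma_taylor r (sdmod_smod M).
Proof.
move=> r0 hM; have Sr := hM.1.
have [n [e [rho [Y [a [h _ r_rho]]]]]] := sigma_delta_taylor_solves v_complete v_mixed r0 hM.
exact: (solves_sigma_taylor v_complete v_mixed h Sr r_rho).
Qed.

Lemma sigma_taylor_res S S' (sub : S' `<=` S) r (M : smod C X S) :
  sigma_taylor r M -> sigma_taylor r (smod_res sub M).
Proof.
move=> [Sr [n [e [rho [Y [eB h1 h2 h3]]]]]]; split; first exact: subset_trans Sr.
exists n, e, rho, Y; split=> // q h A Sq; exact: (h3 q (gen_sub sub h) A (sub q Sq)).
Qed.

Lemma sigma_delta_taylor_res S S' (sub : S' `<=` S) r (M : sdmod C X S) :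
  sigma_delta_taylor r M -> sigma_delta_taylor r (sdmod_res sub M).
Proof.
move=> [Sr [n [e [rho [Y [eB h1 h2 h3 h4]]]]]]; split; first exact: subset_trans Sr.
exists n, e, rho, Y; split=> // q h A Sq; exact: (h4 q (gen_sub sub h) A (sub q Sq)).
Qed.

Lemma res_commutes S S' T (sub : S' `<=` S) (M N : smod C X S) (f : M -> N) :
  T `<=` S' -> @commutes_sigma _ _ _ _ _ T _ _ (smod_res sub M) (smod_res sub N) f ->
  commutes_sigma T f.
Proof.
move=> TS' cf q Tq h h' m; have hq := gen_in (TS' q Tq).
rewrite (Prop_irrelevance h (gen_sub sub hq)) (Prop_irrelevance h' (gen_sub sub hq)).
exact: (cf q Tq hq hq).
Qed.

Lemma solvable_of_taylor S r q (M : smod C X S) : 0 < r -> S q -> ~ unity_root q ->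
  sigma_taylor r M -> solvable M.
Proof.
move=> r0 Sq qN hM.
have [n [e [rho [Y [a [h _]]]]]] := sigma_taylor_solves v_complete v_mixed r0 Sq qN hM.
by exists n, e, rho, Y, a.
Qed.

Lemma sd_solvable_of_taylor S r (M : sdmod C X S) : 0 < r ->
  sigma_delta_taylor r M -> sd_solvable M.
Proof.
move=> r0 hM.
have [n [e [rho [Y [a [h hd _]]]]]] := sigma_delta_taylor_solves v_complete v_mixed r0 hM.
by exists n, e, rho, Y, a.
Qed.

(** The connection has matrix [T a_1]. The equality with [N], stronger than an isomorphism, reduces
    essential surjectivity to identity maps. *)
Lemma exists_connection S r q (N : smod C X S) : 0 < r -> S q -> ~ unity_root q ->
  sigma_taylor r N ->
  exists2 M : sdmod C X S, sigma_delta_taylor r M & sdmod_smod M = N.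
Proof.
move=> r0 Sq qN hN; have Sr := hN.1.
have [n [e [rho [Y [a [h r_rho]]]]]] := sigma_taylor_solves v_complete v_mixed r0 Sq qN hN.
have eB : is_basis e by case: h.
pose M := sdmod_of v_complete v_mixed eB (anel_poly C X 'X *: a 1%N).
exists M => //; apply: (solves_sigma_delta_taylor v_complete v_mixed (M := M) h _ Sr r_rho).
exact: sdmod_of_delta.
Qed.

Lemma id_linear (M : lmodType anel) : linear (fun m : M => m).
Proof. by move=> ? ? ?. Qed.

(** The carrier of [N] is kept and the operators over [S] are rebuilt from [Y]; the clause on [T]
    says that they agree with the given ones for every [q] in both sets. *)
Lemma exists_extension S S' r q (N : smod C X S') : 0 < r -> S' q -> ~ unity_root q ->
  S `<=` disc1 X r -> sigma_taylor r N ->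
  exists2 M : smod C X S, sigma_taylor r M &
    exists (i : M -> N) (j : N -> M),
    [/\ linear i, linear j, cancel i j & cancel j i] /\
    forall T, T `<=` S -> T `<=` S' -> commutes_sigma T i /\ commutes_sigma T j.
Proof.
move=> r0 Sq qN Sr hN.
have [n [e [rho [Y [a [h r_rho]]]]]] := sigma_taylor_solves v_complete v_mixed r0 Sq qN hN.
case: (h) => eB rhoP [Yan Ya] Yc _.
have Srho t : S t -> tau X t < rho by move=> /Sr /disc1E tr; exact: lt_le_trans r_rho.
pose M := smod_of eB rhoP Ya Yc Srho.
have hM : solves (M := M) e rho Y a by exact: smod_of_solves.
exists M; first exact: (solves_sigma_taylor v_complete v_mixed hM Sr r_rho).
exists (fun m => m), (fun m => m); split; first by split=> //; exact: id_linear.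
move=> T TS TS'; split.
  by apply: (id_commutes (phi := fun m : M => m : N) _ _ hM h TS TS') => //; exact: id_linear.
by apply: (id_commutes (phi := fun m : N => m : M) _ _ h hM TS' TS) => //; exact: id_linear.
Qed.

(** Here the cocycle comes from the connection, which is carried over unchanged, so the identity
    commutes with it by definition. *)
Lemma exists_sd_extension S S' r (N : sdmod C X S') : 0 < r ->
  S `<=` disc1 X r -> sigma_delta_taylor r N ->
  exists2 M : sdmod C X S, sigma_delta_taylor r M &
    exists (i : M -> N) (j : N -> M),
    [/\ linear i, linear j, cancel i j & cancel j i] /\
    (forall T, T `<=` S -> T `<=` S' -> commutes_sigma T i /\ commutes_sigma T j) /\
    (commutes_delta i /\ commutes_delta j).
Proof.
move=> r0 Sr hN.
have [n [e [rho [Y [a [h hd r_rho]]]]]] := sigma_delta_taylor_solves v_complete v_mixed r0 hN.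
case: (h) => eB rhoP [Yan Ya] Yc _.
have Srho t : S t -> tau X t < rho by move=> /Sr /disc1E tr; exact: lt_le_trans r_rho.
pose M0 := smod_of eB rhoP Ya Yc Srho.
have hM : solves (M := M0) e rho Y a by exact: smod_of_solves.
pose M : sdmod C X S := @SDMod R K v C X S M0 (@sdmod_delta _ _ _ _ _ _ N)
  (@sdmod_deltaD _ _ _ _ _ _ N) (@sdmod_deltaZ _ _ _ _ _ _ N).
exists M; first exact: (solves_sigma_delta_taylor v_complete v_mixed (M := M) hM hd Sr r_rho).
exists (fun m => m), (fun m => m); split; first by split=> //; exact: id_linear.
split=> // T TS TS'; split.
  by apply: (id_commutes (phi := fun m : M0 => m : N) _ _ hM h TS TS') => //; exact: id_linear.
by apply: (id_commutes (phi := fun m : N => m : M0) _ _ h hM TS' TS) => //; exact: id_linear.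
Qed.

Lemma forget_delta_equivalence S r q (t : forall M, sigma_delta_taylor r M ->
    sigma_taylor r (forget_delta C X S M)) : 0 < r -> S q -> ~ unity_root q ->
  is_equivalence (frestrict (F := forget_delta C X S) t).
Proof.
move=> r0 Sq qN; apply: linear_functor_equivalence => [M N hM hN f lf cf|N hN].
  split=> //; apply: (commutes_delta_of_sigma v_complete v_mixed _ _ Sq Sq qN lf).
  - exact: sd_solvable_of_taylor hM.
  - exact: sd_solvable_of_taylor hN.
  - by move=> _ ->; exact: cf.
have [M hM ME] := exists_connection r0 Sq qN hN; exists M; split=> //.
move: N {hN} ME => _ <-; exists (fun m => m), (fun m => m).
by split=> //; split; try exact: id_linear; exact: smod_mor_id.
Qed.

Lemma res_sigma_equivalence S r q (Sq : S q) (l : forall M, sigma_taylor r M ->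
    sigma_taylor r (res_sigma C X (sub_set1 Sq) M)) : 0 < r -> S `<=` disc1 X r ->
  ~ unity_root q -> is_equivalence (frestrict (F := res_sigma C X (sub_set1 Sq)) l).
Proof.
move=> r0 Sr qN; apply: (linear_functor_equivalence
  (car := @smod_car R K v C X [set q]) (F := smod_res (sub_set1 Sq))
  (good := fun M N f => commutes_sigma S (M := M) (N := N) f)
  (good' := fun M N f => commutes_sigma [set q] (M := M) (N := N) f)) => [M N hM hN f lf cf|N hN].
  have sM := solvable_of_taylor r0 Sq qN hM; have sN := solvable_of_taylor r0 Sq qN hN.
  apply: (commutes_sigma_extend v_complete v_mixed sM sN Sq Sq qN lf) => //.
  exact: res_commutes cf.
have [M hM [i [j [[li lj ij ji] ct]]]] := exists_extension r0 (erefl q) qN Sr hN.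
exists M; split=> //; exists i, j.
have [ci cj] := ct [set q] (sub_set1 Sq) (fun _ => id).
split=> //; split=> // t tq h h' m; first exact: (ci t tq (gen_sub (sub_set1 Sq) h)).
exact: (cj t tq h (gen_sub (sub_set1 Sq) h')).
Qed.

Lemma res_sigma_delta_equivalence S r q (Sq : S q) (l : forall M, sigma_delta_taylor r M ->
    sigma_delta_taylor r (res_sigma_delta C X (sub_set1 Sq) M)) : 0 < r ->
  S `<=` disc1 X r ->
  is_equivalence (frestrict (F := res_sigma_delta C X (sub_set1 Sq)) l).
Proof.
move=> r0 Sr; apply: (linear_functor_equivalence
  (car := fun M : sdmod C X [set q] => M : lmodType anel) (F := sdmod_res (sub_set1 Sq))
  (good := @sdmod_mor R K v C X S) (good' := @sdmod_mor R K v C X [set q])) =>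
  [M N hM hN f lf [cf df]|N hN].
  have sM := sd_solvable_of_taylor r0 hM; have sN := sd_solvable_of_taylor r0 hN.
  by split=> //; exact: (commutes_sigma_of_delta v_complete v_mixed sM sN lf df).
have [M hM [i [j [[li lj ij ji] [ct [di dj]]]]]] := exists_sd_extension r0 Sr hN.
exists M; split=> //; exists i, j.
have [ci cj] := ct [set q] (sub_set1 Sq) (fun _ => id).
split=> //; split=> //; split=> // t tq h h' m.
  exact: (ci t tq (gen_sub (sub_set1 Sq) h)).
exact: (cj t tq h (gen_sub (sub_set1 Sq) h')).
Qed.

Lemma forget_delta_adm_equivalence S q (t : forall M, sigma_delta_adm M ->
    sigma_adm (forget_delta C X S M)) : S q -> ~ unity_root q ->
  is_equivalence (frestrict (F := forget_delta C X S) t).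
Proof.
move=> Sq qN; apply: linear_functor_equivalence =>
  [M N [r /andP[r0 _] hM] [s /andP[s0 _] hN] f lf cf
  |N [r rP hN]].
  split=> //; apply: (commutes_delta_of_sigma v_complete v_mixed _ _ Sq Sq qN lf).
  - exact: sd_solvable_of_taylor hM.
  - exact: sd_solvable_of_taylor hN.
  - by move=> _ ->; exact: cf.
have [M hM ME] := exists_connection (andP rP).1 Sq qN hN; exists M; split; first by exists r.
move: N {hN} ME => _ <-; exists (fun m => m), (fun m => m).
by split=> //; split; try exact: id_linear; exact: smod_mor_id.
Qed.

Lemma union_forget_delta_equivalence q (t : forall M, @union_sigma_delta_adm R K v C X q M ->
    @union_sigma_adm R K v C X q (union_forget_delta C X q M)) : ~ unity_root q ->
  is_equivalence (frestrict (F := union_forget_delta C X q) t).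
Proof.
move=> qN; apply: (linear_functor_equivalence
  (car := fun M : usmod C X q => M : lmodType anel)
  (F := fun M : usdmod C X q => USMod (usd_radP M) M)
  (good := @usdmod_mor R K v C X q) (good' := @usmod_mor R K v C X q)) =>
  [M N [r /andP[r0 _] hM] [s /andP[s0 _] hN] f lf cf
  |N [r rP hN]].
  have Mq : disc1 X (usd_rad M) q by apply/disc1E; case/andP: (usd_radP M).
  have Nq : disc1 X (usd_rad N) q by apply/disc1E; case/andP: (usd_radP N).
  split=> //; apply: (commutes_delta_of_sigma v_complete v_mixed _ _ Mq Nq qN lf).
  - exact: sd_solvable_of_taylor hM.
  - exact: sd_solvable_of_taylor hN.
  - by case: cf => r' /andP[qr' _] cf _ ->; apply: cf; apply/disc1E.
have Nq : disc1 X (us_rad N) q by apply/disc1E; case/andP: (us_radP N).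
have [M hM ME] := exists_connection (andP rP).1 Nq qN hN.
case: N hN Nq M hM ME => s sP N hN Nq /= M hM ME.
exists (USDMod sP M); split; first by exists r.
move: N {hN Nq} ME => _ <-; exists (fun m => m), (fun m => m).
by split=> //; split; try exact: id_linear; exact: (usmod_mor_id (USMod sP M)).
Qed.

Lemma union_res_sigma_equivalence q (l : forall M, @union_sigma_adm R K v C X q M ->
    sigma_adm (union_res_sigma C X q M)) : ~ unity_root q ->
  is_equivalence (frestrict (F := union_res_sigma C X q) l).
Proof.
move=> qN; apply: (linear_functor_equivalence
  (car := @smod_car R K v C X [set q]) (F := @usmod_res R K v C X q)
  (good := @usmod_mor R K v C X q)
  (good' := fun M N f => commutes_sigma [set q] (M := M) (N := N) f)) =>
  [M N [r /andP[r0 _] hM] [s /andP[s0 _] hN] f lf cf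
  |N [r rP hN]].
  have qM := us_radP M; have qN' := us_radP N.
  have Mq : disc1 X (us_rad M) q by apply/disc1E; case/andP: qM.
  have Nq : disc1 X (us_rad N) q by apply/disc1E; case/andP: qN'.
  have sM := solvable_of_taylor r0 Mq qN hM; have sN := solvable_of_taylor s0 Nq qN hN.
  (* On the smaller of the two discs both families of operators are defined, and commutation with
     [sigma_q] propagates to all of it. *)
  exists (Num.min (us_rad M) (us_rad N)).
    by rewrite lexx andbT lt_min; case/andP: qM => ->; case/andP: qN' => ->.
  apply: (commutes_sigma_extend v_complete v_mixed sM sN Mq Nq qN lf).
  - move=> _ -> h h' m; have hq : gen [set q] q := gen_in erefl.
    rewrite (Prop_irrelevance h (gen_sub (union_sub qM) hq)).
    rewrite (Prop_irrelevance h' (gen_sub (union_sub qN') hq)).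
    have := cf q erefl hq hq m.
    by rewrite /usmod_res /= (Prop_irrelevance (us_radP M) qM) (Prop_irrelevance (us_radP N) qN').
  - by apply: disc1_sub; rewrite ge_min lexx.
  - by apply: disc1_sub; rewrite ge_min lexx orbT.
(* The inclusion of the singleton in [disc1 X r] gives [tau_q < r], so the radius [r] attached to
   [N] is itself a legitimate index of the union. *)
have qr : tau X q < r by apply/disc1E; apply: hN.1.
have qrP : tau X q < r <= rX by rewrite qr; case/andP: rP.
have [M hM [i [j [[li lj ij ji] ct]]]] :=
  exists_extension (S := disc1 X r) (andP rP).1 (erefl q) qN (@subset_refl _ _) hN.
exists (USMod qrP M); split; first by exists r.
exists i, j; have [ci cj] := ct [set q] (union_sub qrP) (fun _ => id).
split=> //; split=> // t tq h h' m; first exact: (ci t tq (gen_sub (union_sub qrP) h)).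
exact: (cj t tq h (gen_sub (union_sub qrP) h')).
Qed.

Lemma union_res_sigma_delta_equivalence q
    (l : forall M, @union_sigma_delta_adm R K v C X q M ->
    sigma_delta_adm (union_res_sigma_delta C X q M)) :
  is_equivalence (frestrict (F := union_res_sigma_delta C X q) l).
Proof.
apply: (linear_functor_equivalence
  (car := fun M : sdmod C X [set q] => M : lmodType anel) (F := @usdmod_res R K v C X q)
  (good := @usdmod_mor R K v C X q) (good' := @sdmod_mor R K v C X [set q])) =>
  [M N [r /andP[r0 _] hM] [s /andP[s0 _] hN] f lf [cf df]
  |N [r rP hN]].
  have qM := usd_radP M; have qN' := usd_radP N.
  have sM := sd_solvable_of_taylor r0 hM; have sN := sd_solvable_of_taylor s0 hN.
  split=> //; exists (Num.min (usd_rad M) (usd_rad N)).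
    by rewrite lexx andbT lt_min; case/andP: qM => ->; case/andP: qN' => ->.
  apply: (commutes_sigma_of_delta v_complete v_mixed sM sN lf df).
  - by apply: disc1_sub; rewrite ge_min lexx.
  - by apply: disc1_sub; rewrite ge_min lexx orbT.
have qr : tau X q < r by apply/disc1E; apply: hN.1.
have qrP : tau X q < r <= rX by rewrite qr; case/andP: rP.
have [M hM [i [j [[li lj ij ji] [ct [di dj]]]]]] :=
  exists_sd_extension (S := disc1 X r) (andP rP).1 (@subset_refl _ _) hN.
exists (USDMod qrP M); split; first by exists r.
exists i, j; have [ci cj] := ct [set q] (union_sub qrP) (fun _ => id).
split=> //; split=> //; split=> // t tq h h' m.
  exact: (ci t tq (gen_sub (union_sub qrP) h)).
exact: (cj t tq h (gen_sub (union_sub qrP) h')).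
Qed.

End Equivalences.

Theorem corollary7p9
    (R : realType) (p : nat) (K : fieldType) (v : ultrabs R K)
    (v_complete : complete_abs v) (v_mixed : mixed_char v p)
    (C : alg_closure v) (X : affinoid v)
    (r : R) (r_gt0 : 0 < r) (r_le : r <= min_rad X) :
  (forall S : set K, S `<=` disc1 X r -> non_roots S !=set0 ->
   forall (q : K) (Sq : S q), ~ unity_root q ->
     equivalence_square
       (forget_delta C X S) (res_sigma C X (sub_set1 Sq))
       (res_sigma_delta C X (sub_set1 Sq)) (forget_delta C X [set q])
       (sigma_delta_taylor r) (sigma_taylor r)
       (sigma_delta_taylor r) (sigma_taylor r)
     /\
     equivalence_square
       (union_forget_delta C X q) (union_res_sigma C X q)
       (union_res_sigma_delta C X q) (forget_delta C X [set q])
       (@union_sigma_delta_adm R K v C X q) (@union_sigma_adm R K v C X q)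
       (@sigma_delta_adm R K v C X [set q]) (@sigma_adm R K v C X [set q]))
  /\
  (forall q q' : K, v (q - 1) < 1 -> v (q' - 1) < 1 ->
     ~ (exists n : nat, q ^+ (p ^ n)%N = 1) ->
     ~ (exists n : nat, q' ^+ (p ^ n)%N = 1) ->
     Num.max (v (q - 1)) (v (q' - 1)) * max_norm X < r ->
     exists (Dq : disc1 X r q) (Dq' : disc1 X r q'),
       transport_equivalence
         (res_sigma C X (sub_set1 Dq)) (res_sigma C X (sub_set1 Dq'))
         (sigma_taylor r) (sigma_taylor r) (sigma_taylor r))
  /\
  (forall q q' : K, v (q - 1) < 1 -> v (q' - 1) < 1 ->
     Num.max (v (q - 1)) (v (q' - 1)) * max_norm X < r ->
     exists (Dq : disc1 X r q) (Dq' : disc1 X r q'),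
       transport_equivalence
         (res_sigma_delta C X (sub_set1 Dq)) (res_sigma_delta C X (sub_set1 Dq'))
         (sigma_delta_taylor r) (sigma_delta_taylor r) (sigma_delta_taylor r)).
Proof.
have discs q q' : Num.max (v (q - 1)) (v (q' - 1)) * max_norm X < r ->
    disc1 X r q /\ disc1 X r q'.
  rewrite -ltr_pdivlMr ?max_norm_gt0 // gt_max => /andP[].
  by [].
split; [|split].
- move=> S Sr _ q Sq qN; split.
  + pose t := fun M => @sigma_taylor_of_delta R p K v v_complete v_mixed C X S r M r_gt0.
    pose b := fun M => @sigma_taylor_of_delta R p K v v_complete v_mixed C X [set q] r M r_gt0.
    pose l := @sigma_taylor_res R K v C X S [set q] (sub_set1 Sq) r.
    pose d := @sigma_delta_taylor_res R K v C X S [set q] (sub_set1 Sq) r.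
    apply: (square_of_equivalences (top := forget_delta C X S)
      (left := res_sigma C X (sub_set1 Sq)) (right := res_sigma_delta C X (sub_set1 Sq))
      (bot := forget_delta C X [set q]) (t := t) (l := l) (r := d) (b := b)).
    (* The two composites agree on objects and on underlying maps; only the proofs carried by
       morphisms differ. *)
    * by apply: functor_eq => M N f; exact: sval_inj.
    * exact: (forget_delta_equivalence v_complete v_mixed t r_gt0 Sq qN).
    * exact: (res_sigma_equivalence v_complete v_mixed l r_gt0 Sr qN).
    * exact: (res_sigma_delta_equivalence v_complete v_mixed d r_gt0 Sr).
    * exact: (forget_delta_equivalence v_complete v_mixed b r_gt0 (erefl q) qN).
  + have t M : @union_sigma_delta_adm R K v C X q M ->
        @union_sigma_adm R K v C X q (union_forget_delta C X q M).
      move=> [s sP hM]; exists s => //; case/andP: sP => s0 _.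
      exact: (sigma_taylor_of_delta v_complete v_mixed s0 hM).
    have b M : sigma_delta_adm M -> sigma_adm (forget_delta C X [set q] M).
      move=> [s sP hM]; exists s => //; case/andP: sP => s0 _.
      exact: (sigma_taylor_of_delta v_complete v_mixed s0 hM).
    have l M : @union_sigma_adm R K v C X q M -> sigma_adm (union_res_sigma C X q M).
      by move=> [s sP hM]; exists s => //; exact: sigma_taylor_res.
    have d M : @union_sigma_delta_adm R K v C X q M ->
        sigma_delta_adm (union_res_sigma_delta C X q M).
      by move=> [s sP hM]; exists s => //; exact: sigma_delta_taylor_res.
    apply: (square_of_equivalences (top := union_forget_delta C X q)
      (left := union_res_sigma C X q) (right := union_res_sigma_delta C X q)
      (bot := forget_delta C X [set q]) (t := t) (l := l) (r := d) (b := b)).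
    * by apply: functor_eq => M N f; exact: sval_inj.
    * exact: (union_forget_delta_equivalence v_complete v_mixed t qN).
    * exact: (union_res_sigma_equivalence v_complete v_mixed l qN).
    * exact: (union_res_sigma_delta_equivalence v_complete v_mixed d).
    * exact: (forget_delta_adm_equivalence v_complete v_mixed b (erefl q) qN).
(* For [|q - 1| < 1] every root of unity has [p]-power order, so neither [q] nor [q'] is a root of
   unity at all. *)
- move=> q q' q1 q1' /(not_unity_root v_mixed q1) qN /(not_unity_root v_mixed q1') qN'.
  move=> /discs[Dq Dq']; exists Dq, Dq'.
  apply: (transport_of_equivalences (F := res_sigma C X (sub_set1 Dq))
    (F' := res_sigma C X (sub_set1 Dq'))
    (f := @sigma_taylor_res _ _ _ C X _ _ (sub_set1 Dq) r)
    (f' := @sigma_taylor_res _ _ _ C X _ _ (sub_set1 Dq') r)).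
    exact: (res_sigma_equivalence v_complete v_mixed).
  exact: (res_sigma_equivalence v_complete v_mixed).
- move=> q q' q1 q1' /discs[Dq Dq']; exists Dq, Dq'.
  apply: (transport_of_equivalences (F := res_sigma_delta C X (sub_set1 Dq))
    (F' := res_sigma_delta C X (sub_set1 Dq'))
    (f := @sigma_delta_taylor_res _ _ _ C X _ _ (sub_set1 Dq) r)
    (f' := @sigma_delta_taylor_res _ _ _ C X _ _ (sub_set1 Dq') r)).
    exact: (res_sigma_delta_equivalence v_complete v_mixed).
  exact: (res_sigma_delta_equivalence v_complete v_mixed).
Qed.
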